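(* Let $X=\mathbb{R}^n\times G$, where $n\ge 0$ and $G$ is a countable discrete Abelian group containing no elements of order $2$. Let $\alpha$ be a topological automorphism of the group $X$ satisfying the condition $\mathrm{Ker}(I+\alpha)=\{0\}$. Let $\xi_1$ and $\xi_2$ be independent random variables with values in $X$ and distributions $\mu_1$ and $\mu_2$. If the conditional distribution of the linear form $L_2=\xi_1+\alpha\xi_2$ given $L_1=\xi_1+\xi_2$ is symmetric, then there exist $\gamma_1,\gamma_2\in\Gamma(\mathbb{R}^n)$, a finite subgroup $K$ of the group $G$, and elements $g_1,g_2\in G$ such that $\mu_j=\gamma_j*m_K*E_{g_j}$, $j=1,2$. Moreover, $\alpha(K)=K$.
   Context: $I$ denotes the identity automorphism of a group. $\mathbb{R}^n$ and $G$ are identified with the subgroups $\mathbb{R}^n\times\{0\}$ and $\{0\}\times G$ of $X$, and distributions on subgroups are regarded as distributions on $X$. $\Gamma(\mathbb{R}^n)$ is the set of Gaussian distributions on $\mathbb{R}^n$ (possibly degenerate, with arbitrary mean). The conditional distribution of $L_2$ given $L_1$ is symmetric if the conditional distributions of $L_2$ given $L_1$ and of $-L_2$ given $L_1$ coincide, equivalently the random pairs $(L_1,L_2)$ and $(L_1,-L_2)$ are identically distributed. $m_K$ denotes the Haar distribution (normalized Haar measure) of a compact subgroup $K$; $E_x$ is the degenerate distribution concentrated at $x$; $*$ is convolution of probability distributions. *)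

(* Defs.v *)
From HB Require Import structures.
From mathcomp Require Import all_boot all_order all_algebra.
From mathcomp Require Import complex.
From mathcomp Require Import all_classical all_reals all_analysis.
From mathcomp Require Import measurable_realfun.
Set Implicit Arguments.
Unset Strict Implicit.
Unset Printing Implicit Defensive.
Import Order.TTheory GRing.Theory Num.Theory.
Import numFieldNormedType.Exports.
Local Open Scope classical_set_scope.
Local Open Scope ring_scope.

(* The sigma-algebra on row vectors generated by the coordinates; over a
   realType this is the Borel sigma-algebra of R^n, as for [n.-tuple R]. *)
Definition measure_rV_display : measure_display -> measure_display.
Proof. exact. Qed.

Section measurable_rV.
Context {d} {T : sigmaRingType d} (n : nat).

Definition rV_coord (i : 'I_n) (v : 'rV[T]_n) : T := v ord0 i.

Let rV_set0 : g_sigma_preimage rV_coord set0.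
Proof. exact: sigma_algebra0. Qed.

Let rV_setC A : g_sigma_preimage rV_coord A -> g_sigma_preimage rV_coord (~` A).
Proof. exact: sigma_algebraC. Qed.

Let rV_bigcup (F : _^nat) : (forall i, g_sigma_preimage rV_coord (F i)) ->
  g_sigma_preimage rV_coord (\bigcup_i (F i)).
Proof. exact: sigma_algebra_bigcup. Qed.

HB.instance Definition _ := @isMeasurable.Build (measure_rV_display d)
  'rV[T]_n (g_sigma_preimage rV_coord) rV_set0 rV_setC rV_bigcup.

End measurable_rV.

Lemma measurable_rV_coord {d} {T : sigmaRingType d} {n} (i : 'I_n) :
  measurable_fun [set: 'rV[T]_n] (@rV_coord d T n i).
Proof.
move=> _ Y mY; rewrite setTI; apply: sub_sigma_algebra => /=.
case: n i => [[] []//|n] i.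
rewrite -bigcup_mkord_ord; exists i; first exact: ltn_ord.
by exists Y => //; rewrite setTI (_ : inord i = i)//; exact/val_inj/inordK.
Qed.

Lemma measurable_fun_rV {d1 d2} {T1 : measurableType d1}
    {T2 : measurableType d2} {n} (f : T1 -> 'rV[T2]_n) :
  (forall i, measurable_fun [set: T1] (rV_coord i \o f)) ->
  measurable_fun [set: T1] f.
Proof.
move=> mf; have pref : g_sigma_preimage (fun i => rV_coord i \o f) `<=`
    measurable.
  apply: smallest_sub; first exact: sigma_algebra_measurable.
  case: n => [|n] in f mf *; first by rewrite big_ord0.
  rewrite -bigcup_mkord_ord; apply: bigcup_sub => i Ii.
  by move=> A [B mB <-]; exact: mf.
move=> _ A mA; apply: pref; rewrite g_sigma_preimage_comp.
by exists A.
Qed.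

(* Alias carrying the discrete topology; the Borel
   sigma-algebra is then the full power set. *)
Definition discrete_group (G : countZmodType) : Type := G.

Section discrete_group.
Variable G : countZmodType.

HB.instance Definition _ := GRing.Zmodule.copy (discrete_group G) G.
HB.instance Definition _ := Countable.copy (discrete_group G) G.
HB.instance Definition _ := isPointed.Build (discrete_group G) 0.
HB.instance Definition _ := hasNbhs.Build (discrete_group G) principal_filter.
HB.instance Definition _ := Discrete_ofNbhs.Build (discrete_group G) erefl.
HB.instance Definition _ := @isMeasurable.Build default_measure_display
  (discrete_group G) (@discrete_measurable G) (@discrete_measurable0 G)
  (@discrete_measurableC G) (@discrete_measurableU G).

Lemma measurable_discrete_group2 (A : set (discrete_group G * discrete_group G)) :
  measurable A.
Proof.
apply: countable_measurable => [[a b]|]; last exact: countableP.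
by rewrite (_ : [set (a, b)] = [set a] `*` [set b]);
  [exact: measurableX | apply/seteqP; split => -[x y] /= [-> ->]].
Qed.

End discrete_group.

Notation RnxG R n G := ('rV[R]_n * discrete_group G)%type.

Section product_group.
Variables (R : realType) (n : nat) (G : countZmodType).
Local Notation X := (RnxG R n G).

Definition topological_automorphism (f : X -> X) :=
  {morph f : x y / x + y} /\
  exists g : X -> X, [/\ cancel f g, cancel g f, continuous f & continuous g].

Definition embR (v : 'rV[R]_n) : X := (v, 0).
Definition embG (g : discrete_group G) : X := (0, g).
Definition addX (p : X * X) : X := p.1 + p.2.

Lemma measurable_embR : measurable_fun [set: 'rV[R]_n] embR.
Proof. by apply: measurable_fun_pair. Qed.

Lemma measurable_embG : measurable_fun [set: discrete_group G] embG.
Proof. by apply: measurable_fun_pair. Qed.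

Lemma measurable_addX : measurable_fun [set: X * X] addX.
Proof.
apply: measurable_fun_pair => /=.
- apply: measurable_fun_rV => i.
  pose c (v : 'rV[R]_n) : R := rV_coord i v.
  have mc : measurable_fun setT c by exact: measurable_rV_coord.
  rewrite (_ : _ \o _ = (fun p : X * X => c p.1.1 + c p.2.1)); last first.
    by apply/funext => p; rewrite /c /rV_coord /= mxE.
  by apply: measurable_funD; apply: (measurableT_comp mc);
    exact: measurableT_comp.
- pose s (q : discrete_group G * discrete_group G) : discrete_group G :=
    q.1 + q.2.
  apply: (@measurableT_comp _ _ _ _ _ _ s _
    (fun p : X * X => (p.1.2, p.2.2))).
    by move=> _ A _; rewrite setTI; exact: measurable_discrete_group2.
  by apply: measurable_fun_pair; exact: measurableT_comp.
Qed.

HB.instance Definition _ := isMeasurableFun.Build _ _ _ _ embR measurable_embR.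
HB.instance Definition _ := isMeasurableFun.Build _ _ _ _ embG measurable_embG.
HB.instance Definition _ := isMeasurableFun.Build _ _ _ _ addX measurable_addX.

Definition convolution (mu nu : probability X R) : probability X R :=
  distribution (mu \x nu)%E addX.

End product_group.

Arguments embR {R n G}.
Arguments embG {R n G}.

Definition finite_subgroup (G : zmodType) (K : set G) :=
  [/\ K 0, forall x y, K x -> K y -> K (x - y) & finite_set K].

(* The normalized Haar measure of [K], regarded as a measure on [G]. *)
Definition is_haar_distribution (R : realType) (G : countZmodType)
    (K : set (discrete_group G)) (m : probability (discrete_group G) R) :=
  m K = 1%E /\
  forall x A, K x -> m [set x + y | y in A] = m A.

Section gaussian.
Variables (R : realType) (n : nat).

Definition dotrV (u v : 'rV[R]_n) : R := (u *m v^T) 0 0.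

Definition expi (t : R) : R[i] := (cos t +i* sin t)%C.

Definition char_function (mu : probability 'rV[R]_n R) (s : 'rV[R]_n) : R[i] :=
  (Rintegral mu setT (fun x => cos (dotrV x s)) +i*
   Rintegral mu setT (fun x => sin (dotrV x s)))%C.

(* Gaussian in the wide sense: the covariance matrix [S] may be singular, so
   that degenerate distributions are included. *)
Definition is_gaussian (mu : probability 'rV[R]_n R) :=
  exists (m : 'rV[R]_n) (S : 'M[R]_n),
    [/\ S^T = S, forall s, 0 <= dotrV (s *m S) s &
      forall s, char_function mu s =
        expi (dotrV m s) * (expR (- (dotrV (s *m S) s / 2)))%:C%C].

End gaussian.

Section random_variables.
Context {d d1 d2} {Omega : measurableType d} {T1 : measurableType d1}
  {T2 : measurableType d2} {R : realType} (P : probability Omega R).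

Definition independent_RV (U : Omega -> T1) (V : Omega -> T2) :=
  forall A B, measurable A -> measurable B ->
    P (U @^-1` A `&` V @^-1` B) = (P (U @^-1` A) * P (V @^-1` B))%E.

Definition is_conditional_distribution (V : Omega -> T2) (U : Omega -> T1)
    (k : R.-pker T1 ~> T2) :=
  forall A B, measurable A -> measurable B ->
    P (U @^-1` A `&` V @^-1` B) = (\int[P]_(w in U @^-1` A) k (U w) B)%E.

(* A conditional distribution given [U] is determined up to a null set of the
   law of [U]; two of them coincide when they have a common version. *)
Definition same_conditional_distribution (V V' : Omega -> T2)
    (U : Omega -> T1) :=
  exists k : R.-pker T1 ~> T2,
    is_conditional_distribution V U k /\ is_conditional_distribution V' U k.

End random_variables.

(* Main.v *)
Require Import Defs.
From HB Require Import structures.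
From mathcomp Require Import all_boot all_order all_algebra.
From mathcomp Require Import complex ring lra zify.
From mathcomp Require Import all_classical all_reals all_analysis.
From mathcomp Require Import measurable_realfun.
Import Order.TTheory GRing.Theory Num.Theory.
Import numFieldNormedType.Exports.

(**
Write [alpha (v, g) = (v A + h g, beta g)].  Such a form exists because a
continuous additive map sends [R^n], the identity component, to itself and is
linear there; triviality of the kernels of [alpha] and [I + alpha] makes [A]
and [1 + A] invertible and [beta], [1 + beta] injective
([automorphism_structure]).  Symmetry of the conditional law means that
[(L1, L2)] and [(L1, - L2)] have the same law.

Discrete component.  Let [k1], [k2] be the components of the variables in [G]
and [L1], [L2] those of the forms.  Symmetry exchanges
[L1 - L2 = (1 - beta) k2] with [L1 + L2 = 2 k1 + (1 + beta) k2], and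
[beta L1 - L2 = (beta - 1) k1] with
[beta L1 + L2 = (1 + beta) k1 + 2 beta k2].  Since 2 and [2 beta] are
injective, an atom of the right hand sides is at most the largest atom of
[k1], respectively [k2] ([mixture_le]).  The largest atoms of [k1] and [k2]
are therefore equal, and the case of equality ([mixture_max]) forces both laws
to be uniform on finite sets of the same size ([support_structure]).  The
relation [2 x + (1 + beta) y = (1 - beta) y'] between points of these supports
then shows that they are cosets of one finite subgroup [K] stable under
[beta] ([coset_structure]).

Vector component.  Conditionally on [k1 = x] and [k2 = y] the symmetry becomes
a relation between conditional characteristic functions, the joint values of
[k1] and [k2] being recovered from those of the two forms.  For
[x = - beta y] the pair [(x, y)] is sent to itself and the relation is the
Heyde equation
[phi (u + v) psi (u + v M) = phi (u - v) psi (u - v M)], [M] the transpose of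
[A].  A third multiplicative difference eliminates three of its four factors
and leaves
[phi (x + h) phi (x + k) phi (h + k) = phi x phi h phi k phi (x + h + k)].
The vectors [x] reached in this way are those in the image of [1 - M]; on the
complementary generalized kernel [phi] has modulus one and is a character
([heyde_unimod_ker]), which also gives non-vanishing ([heyde_neq0]) and the
identity for all [x] ([heyde_cube]).  A characteristic function satisfying it
is Gaussian ([cubic_gauss_form]).

Independence of the two components.  Comparing the relations for different
[(x, y)] shows that the ratio of the conditional characteristic functions over
[x0 + k] and [x0] is multiplicative in [k], hence a root of unity since [K] is
finite; two nowhere vanishing solutions of the cubic equation with equal
powers coincide ([cubic_root_eq]).  So the conditional laws of the vector
component are the same over all points of the support ([char_uniqueness],
[fiber_prob]), and each law is the product of a Gaussian law and a translated
Haar law ([product_law]).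
*)

Local Open Scope classical_set_scope.
Local Open Scope ring_scope.

Set Implicit Arguments.
Unset Strict Implicit.

Local Notation Re := complex.Re.
Local Notation Im := complex.Im.

(** * Identities in Abelian groups *)

(** Two expressions in the language of Abelian groups agree as soon as each
variable has the same integer coefficient in both; the coefficients of
concrete expressions are computed. *)
Section zmodule_reflection.

Inductive zexp := ZVar of nat | ZZero | ZAdd of zexp & zexp | ZOpp of zexp.

Variables (V : zmodType) (env : seq V).

Fixpoint zeval e : V :=
  match e with
  | ZVar i => nth 0 env i
  | ZZero => 0
  | ZAdd a b => zeval a + zeval b
  | ZOpp a => - zeval a
  end.

Fixpoint zcoef e (i : nat) : int :=
  match e with
  | ZVar j => (j == i)%:Z
  | ZZero => 0
  | ZAdd a b => zcoef a i + zcoef b i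
  | ZOpp a => - zcoef a i
  end.

Lemma zevalE e : zeval e = \sum_(i < size env) nth 0 env i *~ zcoef e i.
Proof.
elim: e => [j||a IHa b IHb|a IH] /=.
- have [js|sj] := ltnP j (size env); last first.
    rewrite nth_default// big1// => i _.
    by rewrite [_ == _]gtn_eqF ?mulr0z// (leq_trans (ltn_ord i)).
  rewrite (bigD1 (Ordinal js))//= eqxx mulr1z big1 ?addr0// => i ij.
  by rewrite (_ : (j == i) = false) ?mulr0z//; apply/negbTE; rewrite eq_sym; exact: ij.
- by rewrite big1// => i _; rewrite mulr0z.
- by rewrite IHa IHb -big_split/=; apply: eq_bigr => i _; rewrite mulrzDr.
- by rewrite IH -sumrN; apply: eq_bigr => i _; rewrite mulrNz.
Qed.

Lemma zexp_eq e1 e2 :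
  all (fun i => zcoef e1 i == zcoef e2 i) (iota 0 (size env)) ->
  zeval e1 = zeval e2.
Proof.
move=> /allP h; rewrite !zevalE; apply: eq_bigr => i _.
by rewrite (eqP (h i _))// mem_iota/=.
Qed.

End zmodule_reflection.

(** For deriving an equation from a consequence of hypotheses: the remaining
premise [a - b = c - e] is an identity for [zmodule]. *)
Lemma eq_of_subr (V : zmodType) (a b c e : V) : c = e -> a - b = c - e -> a = b.
Proof. by move=> ->; rewrite subrr => /eqP; rewrite subr_eq0 => /eqP. Qed.

Ltac zm_in x l :=
  lazymatch l with
  | nil => constr:(false)
  | cons x _ => constr:(true)
  | cons _ ?l' => zm_in x l'
  end.
Ltac zm_idx x l :=
  lazymatch l with
  | cons x _ => constr:(0%N)
  | cons _ ?l' => let k := zm_idx x l' in constr:(S k)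
  end.
Ltac zm_vars t l :=
  lazymatch t with
  | GRing.add ?a ?b => let l := zm_vars a l in zm_vars b l
  | GRing.opp ?a => zm_vars a l
  | GRing.zero => l
  | _ => let b := zm_in t l in
         lazymatch b with true => l | false => constr:(cons t l) end
  end.
Ltac zm_quote t l :=
  lazymatch t with
  | GRing.add ?a ?b =>
      let a := zm_quote a l in let b := zm_quote b l in constr:(ZAdd a b)
  | GRing.opp ?a => let a := zm_quote a l in constr:(ZOpp a)
  | GRing.zero => constr:(ZZero)
  | _ => let i := zm_idx t l in constr:(ZVar i)
  end.
(** Proves equations that hold in every Abelian group. *)
Ltac zmodule :=
  lazymatch goal with
  | |- @eq ?T ?a ?b =>
      let l0 := constr:(@nil T) in
      let l := zm_vars a l0 in
      let l := zm_vars b l in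
      let a' := zm_quote a l in
      let b' := zm_quote b l in
      exact: (@zexp_eq _ l a' b' erefl)
  end.

(** * The Heyde functional equation *)

Section charlike.
Variables (R : realType) (n : nat).
Local Notation V := 'rV[R]_n.

(** The facts about the characteristic function of a law that enter the analysis
of the functional equation.  Unimodularity at [w] means that the phase is
almost surely constant, whence [charlike_unimod]; continuity is only required
at 0 along lines. *)
Record charlike (phi : V -> R[i]) : Prop := Charlike {
  charlike0 : phi 0 = 1;
  charlikeN : forall u, phi (- u) = (phi u)^*%C;
  charlike_le1 : forall u, `|phi u| <= 1;
  charlike_unimod : forall u w, `|phi w| = 1 -> phi (u + w) = phi u * phi w;
  charlike_cvg_Re : forall x, Re (phi (t *: x)) @[t --> (0 : R)] --> (1 : R);
  charlike_cvg_Im : forall x, Im (phi (t *: x)) @[t --> (0 : R)] --> (0 : R)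
}.
Arguments charlike_cvg_Re [phi].
Arguments charlike_cvg_Im [phi].

Lemma charlike_neq0_near (phi : V -> R[i]) (cphi : charlike phi) (x : V) :
  exists N, forall k, (N <= k)%N -> phi (k.+1%:R^-1 *: x) != 0.
Proof.
have /cvgrPdist_lt/(_ _ (ltr01 : 0 < 1 :> R)) := charlike_cvg_Re cphi x.
move=> /nbhs_ballP[e /= e0 He].
have [N _ HN] := near_infty_natSinv_lt (PosNum e0).
exists N => k Nk; apply/eqP => phi0.
have : ball (0 : R) e k.+1%:R^-1.
  by rewrite /ball/= sub0r normrN ger0_norm ?invr_ge0//; exact: (HN k Nk).
by move=> /He; rewrite phi0/= subr0 normr1 ltxx.
Qed.

Definition heyde_eq (M : 'M[R]_n) (phi psi : V -> R[i]) := forall u v,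
  phi (u + v) * psi (u + v *m M) = phi (u - v) * psi (u - v *m M).

Lemma heyde_eq_swap (M : 'M[R]_n) phi psi : M \in unitmx ->
  heyde_eq M phi psi -> heyde_eq (invmx M) psi phi.
Proof.
move=> Mu H u v; have := H u (v *m invmx M).
by rewrite mulmxKV// mulrC => ->; rewrite mulrC.
Qed.

Lemma halfD (x : V) : x = 2^-1 *: x + 2^-1 *: x.
Proof. by rewrite -scalerDl (_ : 2^-1 + 2^-1 = 1 :> R) ?scale1r//; lra. Qed.

Section heyde.
Variables (M : 'M[R]_n) (phi psi : V -> R[i]).
Hypotheses (cphi : charlike phi) (cpsi : charlike psi).
Hypotheses (uM1 : 1%:M + M \in unitmx) (H : heyde_eq M phi psi).

(** Third difference of the Heyde equation.  The shifts of [(u, v)] by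
[(- a M, a)], [(b, b)] and [(c M, c)] leave unchanged [u + v M], [u - v] and
[u - v M] respectively, so in the alternating product over the eight sums of
shifts the three other factors cancel.  The values of [psi] are kept on both
sides, as they may vanish at this stage. *)
Lemma heyde_eq_diff3 (a b c : V) :
  let x := a - a *m M in let h := b + b in let k := c + c *m M in
  let d := b + b *m M in let e := c *m M + c *m M in
  phi (x + h) * phi (x + k) * phi (h + k) * (psi d * psi e * psi (d + e)) =
  phi x * phi h * phi k * phi (x + h + k) * (psi d * psi e * psi (d + e)).
Proof.
move=> x h k d e.
have L u v p q r t : u + v = p -> u + v *m M = q -> u - v = r ->
    u - v *m M = t -> phi p * psi q = phi r * psi t.
  by move=> <- <- <- <-; exact: H.
have vec (y z : V) : (forall i, y ord0 i = z ord0 i) -> y = z.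
  by move=> yz; apply/rowP.
pose r1 := - (a *m M) - a; pose r3 := c *m M - c.
pose t1 := - (a *m M) - a *m M; pose t2 := b - b *m M.
have E1 : phi x * psi 0 = phi r1 * psi t1.
  by apply: (L (- (a *m M)) a); rewrite /x/r1/t1//; apply: vec => i; rewrite !mxE; ring.
have E2 : phi h * psi d = phi 0 * psi t2.
  by apply: (L b b) => //; rewrite subrr.
have E3 : phi k * psi e = phi r3 * psi 0.
  by apply: (L (c *m M) c); rewrite /k/e/r3// ?subrr// addrC.
have E12 : phi (x + h) * psi d = phi r1 * psi (t1 + t2).
  apply: (L (b - a *m M) (a + b)); rewrite ?mulmxDl /x/h/d/r1/t1/t2;
  set aM := a *m M; set bM := b *m M; by apply: vec => i; rewrite !mxE; ring.
have E13 : phi (x + k) * psi e = phi (r1 + r3) * psi t1.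
  apply: (L (c *m M - a *m M) (a + c)); rewrite ?mulmxDl /x/k/e/r1/r3/t1;
  set aM := a *m M; set cM := c *m M; by apply: vec => i; rewrite !mxE; ring.
have E23 : phi (h + k) * psi (d + e) = phi r3 * psi t2.
  apply: (L (b + c *m M) (b + c)); rewrite ?mulmxDl /h/k/d/e/r3/t2;
  set cM := c *m M; set bM := b *m M; by apply: vec => i; rewrite !mxE; ring.
have E123 : phi (x + h + k) * psi (d + e) = phi (r1 + r3) * psi (t1 + t2).
  apply: (L (b + c *m M - a *m M) (a + b + c));
  rewrite ?mulmxDl /x/h/k/d/e/r1/r3/t1/t2;
  set aM := a *m M; set cM := c *m M; set bM := b *m M;
  by apply: vec => i; rewrite !mxE; ring.
have [p0 s0] : phi 0 = 1 /\ psi 0 = 1 by split; apply: charlike0.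
transitivity ((phi (x + h) * psi d) * (phi (x + k) * psi e) *
  (phi (h + k) * psi (d + e))); first by ring.
transitivity ((phi x * psi 0) * (phi h * psi d) * (phi k * psi e) *
  (phi (x + h + k) * psi (d + e))); last by rewrite s0; ring.
by rewrite E1 E2 E3 E12 E13 E23 E123 p0 s0; ring.
Qed.

Let iterN k (x : V) := iter k (fun z : V => z - z *m M) x.

Let iterNM k x (B : 'M[R]_n) : B *m M = M *m B -> iterN k (x *m B) = iterN k x *m B.
Proof. by move=> BM; elim: k => //= k ->; rewrite mulmxBl -!mulmxA BM. Qed.

(** At [u = v = y] the equation reads [phi (2 y) psi (y + y M) = psi (y - y M)].
If the right hand side has modulus one, so has each factor on the left; and
[2] and [1 + M] are bijections commuting with [M], which gives the induction
on the exponent. *)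
Lemma heyde_unimod_ker k w : iterN k w = 0 -> `|phi w| = 1 /\ `|psi w| = 1.
Proof.
elim: k w => [w /= ->|k IH w].
  by rewrite (charlike0 cphi) (charlike0 cpsi) normr1.
have main y : iterN k.+1 y = 0 -> `|phi (y + y)| = 1 /\ `|psi (y + y *m M)| = 1.
  rewrite /iterN iterSr => /IH[_ psi1].
  have := congr1 (fun z => `|z|) (H y y); rewrite subrr (charlike0 cphi) mul1r.
  rewrite psi1 normrM => e1.
  have p1 := charlike_le1 cphi (y + y); have p2 := charlike_le1 cpsi (y + y *m M).
  have q1 := normr_ge0 (phi (y + y)); have q2 := normr_ge0 (psi (y + y *m M)).
  split; apply/eqP; rewrite eq_le ?p1 ?p2 /= -e1.
    exact: ler_piMr.
  exact: ler_piMl.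
move=> iw; split.
  rewrite (halfD w); apply: (main _ _).1.
  by rewrite -mul_mx_scalar iterNM ?iw ?mul0mx// scalar_mxC.
pose y := w *m invmx (1%:M + M).
have -> : w = y + y *m M.
  by rewrite -[in LHS](mulmxKV uM1 w) mulmxDr mulmx1.
apply: (main _ _).2; rewrite iterNM ?iw ?mul0mx//.
apply: (can_inj (mulKmx uM1)); rewrite mulKVmx// mulmxA.
have -> : (1%:M + M) *m M = M *m (1%:M + M) by rewrite mulmxDl mulmxDr mul1mx mulmx1.
by rewrite mulmxK.
Qed.

(** The Fitting decomposition of the row space with respect to [1 - M]: the
images of its powers stabilize for dimension reasons. *)
Let fitting : exists k, forall x, exists w a,
  x = w + (a - a *m M) /\ iterN k w = 0.
Proof.
pose Nk k : 'M[R]_n := iter k (fun B => B *m (1%:M - M)) 1%:M.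
have NkE k x : iterN k x = x *m Nk k.
  elim: k => [|k IH]; first by rewrite mulmx1.
  by rewrite /= mulmxA -IH mulmxBr mulmx1.
have NkS k : Nk k.+1 = (1%:M - M) *m Nk k.
  elim: k => [|k IH]; first by rewrite /= mul1mx mulmx1.
  by rewrite -[LHS]/(Nk k.+1 *m (1%:M - M)) {1}IH -mulmxA.
have NkSsub k : (Nk k.+1 <= Nk k)%MS by rewrite NkS submxMl.
have [k Hk] : exists k, (Nk k <= Nk k.+1)%MS.
  apply: contrapT => nk.
  have rk k : (\rank (Nk k) + k <= n)%N.
    elim: k => [|k IH]; first by rewrite addn0 rank_leq_row.
    apply: leq_trans IH; rewrite addnS -addSn leq_add2r ltn_neqAle mxrankS// andbT.
    apply/eqP => e; apply: nk; exists k.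
    by move: (mxrank_leqif_eq (NkSsub k)) => -[_]; rewrite e eqxx => /esym/andP[].
  by have := rk n.+1; rewrite addnS ltnNge leq_addl.
exists k => x.
have /submxP[D HD] : (x *m Nk k <= Nk k.+1)%MS.
  exact: submx_trans (submxMl _ _) Hk.
exists (x - (D - D *m M)), D; split; first by rewrite subrK.
by rewrite NkE mulmxBl HD NkS mulmxA mulmxBr mulmx1 subrr.
Qed.

(** On the generalized kernel of [1 - M] the modulus is one, so only [z] in the
image of [1 - M] matters.  For a step [z / N] so small that the fixed factors
of [heyde_eq_diff3] do not vanish, that identity propagates non-vanishing from
[m + 1] steps to [m + 2] steps. *)
Lemma heyde_neq0 x : phi x != 0.
Proof.
have [k /(_ x)[w [a [-> /heyde_unimod_ker[p1 _]]]]] := fitting.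
rewrite addrC (charlike_unimod cphi)// mulf_neq0//; last first.
  by rewrite -normr_eq0 p1 oner_neq0.
set z := a - a *m M.
(* With these choices the increments [2 b0] and [c0 + c0 M] both equal [z]. *)
pose b0 := 2^-1 *: z; pose c0 := z *m invmx (1%:M + M).
have [N1 P1] := charlike_neq0_near cphi (z + z).
have [N2 P2] := charlike_neq0_near cpsi (b0 + b0 *m M).
have [N3 P3] := charlike_neq0_near cpsi (c0 *m M + c0 *m M).
have [N4 P4] := charlike_neq0_near cpsi (b0 + b0 *m M + (c0 *m M + c0 *m M)).
have [N5 P5] := charlike_neq0_near cphi z.
pose N := (N1 + N2 + N3 + N4 + N5)%N; pose s : R := N.+1%:R^-1.
have {}P1 := P1 N ltac:(by rewrite /N; lia).
have {}P2 := P2 N ltac:(by rewrite /N; lia).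
have {}P3 := P3 N ltac:(by rewrite /N; lia).
have {}P4 := P4 N ltac:(by rewrite /N; lia).
have {}P5 := P5 N ltac:(by rewrite /N; lia).
pose Q := psi (s *: (b0 + b0 *m M)) * psi (s *: (c0 *m M + c0 *m M)) *
  psi (s *: (b0 + b0 *m M + (c0 *m M + c0 *m M))).
have Q0 : Q != 0 by rewrite !mulf_neq0.
have bb : b0 + b0 = z by rewrite /b0 -halfD.
have cc : c0 + c0 *m M = z by rewrite -[in RHS](mulmxKV uM1 z) mulmxDr mulmx1.
have step m : phi ((m.+1%:R * s) *: z) != 0 -> phi ((m.+2%:R * s) *: z) != 0.
  move=> pm1; apply/eqP => pm2.
  have := heyde_eq_diff3 ((m%:R * s) *: a) (s *: b0) (s *: c0) => /=.
  have -> : (m%:R * s) *: a - (m%:R * s) *: a *m M = (m%:R * s) *: z.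
    by rewrite -scalemxAl -scalerBr.
  have -> : s *: b0 + s *: b0 = s *: z by rewrite -scalerDr bb.
  have -> : s *: c0 + s *: c0 *m M = s *: z by rewrite -scalemxAl -scalerDr cc.
  have -> : s *: b0 + s *: b0 *m M = s *: (b0 + b0 *m M).
    by rewrite -scalemxAl -scalerDr.
  have -> : s *: c0 *m M + s *: c0 *m M = s *: (c0 *m M + c0 *m M).
    by rewrite -scalemxAl -scalerDr.
  rewrite -!scalerDr -/Q -!scalerDl.
  have -> : m%:R * s + s = m.+1%:R * s by rewrite -[m.+1]addn1 natrD; ring.
  have -> : m.+1%:R * s + s = m.+2%:R * s by rewrite -[m.+2]addn1 natrD; ring.
  rewrite pm2 mulr0 mul0r => /eqP; apply/negP.
  by rewrite !mulf_neq0.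
have all m : phi ((m.+1%:R * s) *: z) != 0 by elim: m => [|m /step//]; rewrite mul1r.
by have := all N; rewrite mulfV ?scale1r// pnatr_eq0.
Qed.

(** Once [psi] does not vanish it cancels from [heyde_eq_diff3], which gives the
identity for [x] in the image of [1 - M]; the component of [x] in the
generalized kernel contributes the same factor to both sides. *)
Lemma heyde_cube (psi0 : forall x, psi x != 0) x h k :
  phi (x + h) * phi (x + k) * phi (h + k) = phi x * phi h * phi k * phi (x + h + k).
Proof.
have [K /(_ x)[w [a [-> /heyde_unimod_ker[p1 _]]]]] := fitting.
set z := a - a *m M.
have hE : 2^-1 *: h + 2^-1 *: h = h by rewrite -halfD.
pose c0 := k *m invmx (1%:M + M).
have cc : c0 + c0 *m M = k by rewrite -[in RHS](mulmxKV uM1 k) mulmxDr mulmx1.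
have := heyde_eq_diff3 a (2^-1 *: h) c0 => /=; rewrite hE cc -/z.
move/(mulIf (mulf_neq0 (mulf_neq0 (psi0 _) (psi0 _)) (psi0 _))) => E.
have W u : phi (w + u) = phi u * phi w by rewrite addrC (charlike_unimod cphi).
by rewrite -!addrA !W !addrA; lazymatch type of E with ?a = ?b =>
  transitivity (a * phi w ^+ 2); [ring | rewrite E; ring] end.
Qed.

End heyde.
End charlike.

(** * One-parameter unimodular characters *)

Section one_parameter.
Variable R : realType.

Lemma expiD (s t : R) : expi (s + t) = expi s * expi t.
Proof. by rewrite /expi cosD sinD; apply/eqP; rewrite eq_complex/=; apply/andP; split; apply/eqP; ring. Qed.

Lemma norm_complex1 (z : R[i]) : (`|z| == 1) = (Re z ^+ 2 + Im z ^+ 2 == 1).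
Proof.
rewrite normc_def -[1 in LHS]/(1%:C%C) (inj_eq (@complexI _)); apply/eqP/eqP => [h|->]; last by rewrite sqrtr1.
have := @sqr_sqrtr _ (Re z ^+ 2 + Im z ^+ 2); rewrite h expr1n => <-//.
by rewrite addr_ge0// sqr_ge0.
Qed.

Lemma norm_expi (t : R) : `|expi t| = 1.
Proof. by apply/eqP; rewrite norm_complex1/= cos2Dsin2. Qed.

Lemma int_multiple_approx (x t : R) : 0 < x ->
  exists z : int, `|t - z%:~R * x| <= x.
Proof.
move=> x0; exists (Num.floor (t / x)).
have /andP[h1 h2] := floor_itv (t / x).
rewrite intrD ltr_pdivrMr// mulrDl mul1r in h2.
by rewrite ger0_norm ?subr_ge0 -?ler_pdivlMr//; lra.
Qed.

(** The additive function [g t - t * g 1] vanishes at a small [1 / N], so it is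
periodic and bounded on the whole line; a bounded additive function is zero. *)
Lemma additive_bounded_linear (g : R -> R) (d C : R) :
  {morph g : x y / x + y} -> 0 < d -> (forall t, `|t| < d -> g t <= C) ->
  forall t, g t = t * g 1.
Proof.
move=> gD d0 gC.
have g0 : g 0 = 0 by apply: (addrI (g 0)); rewrite -gD !addr0.
have gN t : g (- t) = - g t by apply/eqP; rewrite -addr_eq0 -gD addNr g0.
have gM m t : g (m%:R * t) = m%:R * g t.
  elim: m => [|m IH]; first by rewrite !mul0r g0.
  by rewrite -[m.+1]addn1 natrD !mulrDl gD IH !mul1r.
have gz (z : int) t : g (z%:~R * t) = z%:~R * g t.
  case: z => m; first exact: gM.
  by rewrite NegzE !mulrNz !mulNr gN -!pmulrn gM.
pose h t := g t - t * g 1.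
have hD s t : h (s + t) = h s + h t by rewrite /h gD; ring.
have hz (z : int) t : h (z%:~R * t) = z%:~R * h t by rewrite /h gz; ring.
pose C' := C + d * `|g 1|.
have hC t : `|t| < d -> `|h t| <= C'.
  have aux s : `|s| < d -> h s <= C'.
    move=> sd; rewrite /h /C'; apply: lerD; first exact: gC.
    apply: le_trans (ler_norm _) _; rewrite normrN normrM.
    by rewrite ler_wpM2r// ltW.
  move=> td; rewrite ler_norml aux// andbT lerNl.
  have -> : - h t = h (- t) by rewrite /h gN; ring.
  by apply: aux; rewrite normrN.
have [N _ HN] := near_infty_natSinv_lt (PosNum d0).
pose x : R := N.+1%:R^-1.
have x0 : 0 < x by rewrite invr_gt0.
have hx : h x = 0.
  have : h (N.+1%:~R * x) = 0.
    rewrite /x -pmulrn mulfV ?pnatr_eq0//; rewrite /h; ring.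
  by rewrite hz => /eqP; rewrite mulf_eq0 -pmulrn pnatr_eq0/= => /eqP.
have hall t : `|h t| <= C'.
  have [z zP] := int_multiple_approx t x0.
  have -> : h t = h (t - z%:~R * x).
    by rewrite -mulNr -mulrNz hD hz hx mulr0 addr0.
  by apply: hC; apply: le_lt_trans zP _; exact: (HN N (leqnn _)).
move=> t; apply/eqP; rewrite -subr_eq0 -/(h t); apply/negPn/negP => ht.
have ht0 : 0 < `|h t| by rewrite normr_gt0.
have C'0 : 0 <= C' by apply: le_trans (hall 0).
have := hall ((Num.truncn (C' / `|h t|)).+1%:~R * t).
rewrite hz normrM -pmulrn ger0_norm// leNgt -ltr_pdivrMr//.
by rewrite truncnS_gt.
Qed.

(** The angle is read off at one small [e]; halving keeps the real part positive,
which selects the right square root, so [c] agrees with an exponential at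
[e / 2 ^ k].  The quotient is then trivial on the dyadic multiples of [e] and,
by continuity at 0, everywhere. *)
Lemma char_line_expi (c : R -> R[i]) :
  (forall s t, c (s + t) = c s * c t) -> (forall t, `|c t| = 1) ->
  Re (c t) @[t --> (0 : R)] --> (1 : R) -> Im (c t) @[t --> (0 : R)] --> (0 : R) ->
  exists a, forall t, c t = expi (a * t).
Proof.
move=> cD c1 cRe cIm.
have cn t : Re (c t) ^+ 2 + Im (c t) ^+ 2 = 1.
  by apply/eqP; rewrite -norm_complex1 c1.
have : \forall t \near (0 : R), 0 < Re (c t).
  exact: cvgr_gt cRe _ ltr01.
move=> /nbhs_ballP[d /= d0 Hd].
pose e := d / 2.
have e0 : 0 < e by rewrite divr_gt0.
pose th := asin (Im (c e)).
have Im1 : -1 <= Im (c e) <= 1.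
  rewrite -ler_norml -(@expr_le1 _ 2)// real_normK ?num_real//.
  by have := cn e; have := sqr_ge0 (Re (c e)); lra.
have pos k : 0 < Re (c (e / 2 ^+ k)).
  apply: Hd; rewrite /ball/= sub0r normrN ger0_norm ?divr_ge0 ?exprn_ge0 ?ltW//.
  apply: (@le_lt_trans _ _ e); last by rewrite /e; lra.
  by rewrite ler_pdivrMr ?exprn_gt0// ler_peMr ?exprn_ege1 ?ler1n//; exact: ltW.
have ck k : c (e / 2 ^+ k) = expi (th / 2 ^+ k).
  elim: k => [|k IH].
    rewrite !expr0 !divr1; have := pos 0; rewrite expr0 divr1 => Re0.
    apply/eqP; rewrite eq_complex/= cos_asin// asinK// eqxx andbT.
    have -> : 1 - Im (c e) ^+ 2 = Re (c e) ^+ 2 by rewrite -(cn e); ring.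
    by rewrite sqrtr_sqr ger0_norm// ltW.
  have half (s : R) : s / 2 ^+ k = s / 2 ^+ k.+1 + s / 2 ^+ k.+1.
    by rewrite exprS; field; rewrite expf_neq0.
  move: IH; rewrite (half e) cD (half th) expiD -!expr2 => /eqP.
  rewrite eqf_sqr => /orP[/eqP//|/eqP E].
  have := pos k.+1; rewrite E/= ltNge => /negP[].
  rewrite oppr_le0 ltW// cos_gt0_pihalf//.
  have p0 := pi_gt0 R.
  have := asin_geNpi2 Im1; have := asin_lepi2 Im1; rewrite -/th => h1 h2.
  have q0 : 0 < (2 ^+ k.+1)^-1 :> R by rewrite invr_gt0 exprn_gt0.
  have q1 : (2 ^+ k.+1)^-1 <= 2^-1 :> R.
    by rewrite lef_pV2 ?posrE ?exprn_gt0// exprS ler_peMr// exprn_ege1// ler1n.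
  by apply/andP; split; nra.
pose a := th / e; exists a.
pose g t := c t * expi (- (a * t)).
suff g1 t : g t = 1.
  by move=> t; rewrite -[RHS]mul1r -(g1 t) /g -mulrA -expiD addNr /expi cos0 sin0 mulr1.
have gD s u : g (s + u) = g s * g u.
  by rewrite /g cD mulrDr opprD expiD; ring.
have g0 : g 0 = 1.
  have : g 0 * g 0 = g 0 by rewrite -gD addr0.
  move=> /eqP; rewrite -subr_eq0 -{3}[g 0]mulr1 -mulrBr mulf_eq0 subr_eq0 => /orP[|/eqP//].
  by rewrite -normr_eq0 normrM c1 norm_expi mul1r oner_eq0.
have gk k : g (e / 2 ^+ k) = 1.
  rewrite /g ck -expiD (_ : _ + _ = 0) ?/expi ?cos0 ?sin0//.
  by rewrite /a; field; rewrite expf_neq0//= gt_eqF.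
have gM k (z : int) : g (z%:~R * (e / 2 ^+ k)) = 1.
  have gN s : g s = 1 -> g (- s) = 1.
    by move=> gs; rewrite -g0 -(addrN s) gD gs mul1r.
  have gm (m : nat) : g (m%:R * (e / 2 ^+ k)) = 1.
    elim: m => [|m IH]; first by rewrite mul0r.
    by rewrite -[m.+1]addn1 natrD mulrDl gD IH !mul1r gk.
  by case: z => m; rewrite ?NegzE ?mulrNz ?mulNr -?pmulrn//; exact/gN/gm.
have gcvg : Re (g t) @[t --> (0 : R)] --> (1 : R).
  have -> : (fun t => Re (g t)) =
      (fun t => Re (c t) * cos (a * t) + Im (c t) * sin (a * t)).
    apply/funext => u; rewrite /g; case: (c u) => x y /=.
    by rewrite cosN sinN; ring.
  have at0 : a * t @[t --> (0 : R)] --> (a * 0 : R).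
    by apply: cvgM; [exact: cvg_cst|exact: cvg_id].
  have cc : cos (a * t) @[t --> (0 : R)] --> cos (a * 0 : R).
    by apply: continuous_cvg at0; exact: continuous_cos.
  have ss : sin (a * t) @[t --> (0 : R)] --> sin (a * 0 : R).
    by apply: continuous_cvg at0; exact: continuous_sin.
  have := cvgD (cvgM cRe cc) (cvgM cIm ss).
  rewrite mulr0 cos0 sin0 mulr1 mulr0 addr0; apply.
have gn : Re (g t) ^+ 2 + Im (g t) ^+ 2 = 1.
  by apply/eqP; rewrite -norm_complex1 normrM c1 norm_expi mul1r.
suff Re1 : 1 <= Re (g t).
  have Im0 : Im (g t) ^+ 2 = 0.
    by have := sqr_ge0 (Im (g t)); have : 1 <= Re (g t) ^+ 2 by [rewrite exprn_ege1]; lra.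
  apply/eqP; rewrite eq_complex/=; move/eqP: (Im0); rewrite sqrf_eq0 => ->; rewrite andbT.
  by move: gn; rewrite Im0 addr0 => /eqP; rewrite sqrf_eq1 => /orP[//|/eqP E]; move: Re1; rewrite E; lra.
apply/ler_addgt0Pr => eps eps0.
have : \forall t \near (0 : R), 1 - eps < Re (g t).
  by apply: (cvgr_gt _ gcvg); rewrite ltrBlDr ltrDl.
move=> /nbhs_ballP[r /= r0 Hr].
have re0 : 0 < r / e by rewrite divr_gt0.
have [N _ HN] := near_infty_natSinv_expn_lt (PosNum re0).
have /= HNN := HN N (leqnn _).
have x0 : 0 < e / 2 ^+ N by rewrite divr_gt0// exprn_gt0.
have [z zP] := int_multiple_approx t x0.
have -> : g t = g (t - z%:~R * (e / 2 ^+ N)).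
  by rewrite -mulNr -mulrNz gD gM mulr1.
rewrite -lerBlDr ltW//; apply: Hr; rewrite /ball/= sub0r normrN.
apply: le_lt_trans zP _.
by move: HNN; rewrite div1r ltr_pdivlMr// mulrC.
Qed.

End one_parameter.

(** * The cubic equation and Gaussian functions *)

Section cubic.
Variables (R : realType) (n : nat).
Local Notation V := 'rV[R]_n.

(** The multiplicative form of the equation for polynomials of degree at most
two: for [phi] nowhere zero it says that [phi (x + k) / (phi x * phi k)] is
multiplicative in [x]. *)
Definition cubic (phi : V -> R[i]) := forall x h k,
  phi (x + h) * phi (x + k) * phi (h + k) =
  phi x * phi h * phi k * phi (x + h + k).

(** The quotient [th] is again cubic and has values of order dividing [j].  Its
defect [B] is multiplicative in each variable, and vectors are divisible by
[j], so [B] is trivial; then [th] itself is multiplicative and trivial for the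
same reason. *)
Lemma cubic_root_eq (phi psi : V -> R[i]) :
  (forall x, phi x != 0) -> (forall x, psi x != 0) ->
  phi 0 = 1 -> psi 0 = 1 -> cubic phi -> cubic psi ->
  (exists2 j, (0 < j)%N & forall x, phi x ^+ j = psi x ^+ j) ->
  phi =1 psi.
Proof.
move=> phi0 psi0 phi1 psi1 cphi cpsi [j j0 e].
have [th thE] : exists th, forall x, th x = phi x / psi x by exists (fun x => phi x / psi x).
have th0 x : th x != 0 by rewrite thE mulf_neq0// invr_neq0.
have thj x : th x ^+ j = 1 by rewrite thE expr_div_n e divff// expf_neq0.
have cth x h k : th (x + h) * th (x + k) * th (h + k) =
    th x * th h * th k * th (x + h + k).
  rewrite !thE; have E1 := cphi x h k; have E2 := cpsi x h k.
  transitivity ((phi (x + h) * phi (x + k) * phi (h + k)) /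
    (psi (x + h) * psi (x + k) * psi (h + k))); first by field; rewrite !psi0.
  by rewrite E1 E2; field; rewrite !psi0.
pose B x y := th (x + y) / (th x * th y).
have BD x h k : B (x + h) k = B x k * B h k.
  rewrite /B; have E := cth x h k.
  apply: (mulfI (th0 (x + h))); apply: (mulfI (mulf_neq0 (th0 x) (th0 h))).
  transitivity (th x * th h * th k * th (x + h + k) / th k ^+ 2).
    by field; rewrite !th0.
  by rewrite -E; field; rewrite !th0.
have BM x k m : B (m%:R *: x) k = B x k ^+ m.
  elim: m => [|m IH]; last by rewrite -natr1 scalerDl scale1r BD IH exprSr.
  have h00 : B 0 k = B 0 k * B 0 k by rewrite -BD addr0.
  rewrite scale0r expr0; apply: (mulfI (_ : B 0 k != 0)); last by rewrite -h00 mulr1.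
  by rewrite /B mulf_neq0// invr_neq0// mulf_neq0.
have jn0 : j%:R != 0 :> R by rewrite pnatr_eq0 -lt0n.
have B1 x k : B x k = 1.
  have -> : x = j%:R *: (j%:R^-1 *: x) by rewrite scalerA mulfV// scale1r.
  by rewrite BM /B expr_div_n exprMn !thj mulr1 divff ?oner_neq0.
have thD x y : th (x + y) = th x * th y.
  have := B1 x y; rewrite /B => /(congr1 (fun z => z * (th x * th y))).
  by rewrite divfK ?mul1r// mulf_neq0.
have thM x m : th (m%:R *: x) = th x ^+ m.
  elim: m => [|m IH]; first by rewrite scale0r expr0 thE phi1 psi1 divff ?oner_neq0.
  by rewrite -natr1 scalerDl scale1r thD IH exprSr.
move=> x; have : th x = 1.
  have -> : x = j%:R *: (j%:R^-1 *: x) by rewrite scalerA mulfV// scale1r.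
  by rewrite thM thj.
by move=> /(congr1 (fun z => z * psi x)); rewrite thE divfK// mul1r.
Qed.

(** The defect [B] of [phi] is a symmetric bicharacter.  It is real because [phi]
is Hermitian, and positive because vectors can be halved, so [B = exp (- L)]
with [L] biadditive.  The bound [|phi| <= 1] makes [L] bilinear, gives
[|phi x| ^ 2 = exp (- L x x)], and leaves a unimodular character as the
remaining factor of [phi]. *)
Section gauss_form.
Variable phi : V -> R[i].
Hypotheses (cphi : charlike phi) (phi0 : forall x, phi x != 0) (qphi : cubic phi).

Let B (x y : V) := phi (x + y) / (phi x * phi y).

Let B0 x y : B x y != 0.
Proof. by rewrite /B mulf_neq0// invr_neq0// mulf_neq0. Qed.

Let BD x h k : B (x + h) k = B x k * B h k.
Proof.
rewrite /B; have E := qphi x h k.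
apply: (mulfI (phi0 (x + h))); apply: (mulfI (mulf_neq0 (phi0 x) (phi0 h))).
transitivity (phi x * phi h * phi k * phi (x + h + k) / phi k ^+ 2).
  by field; rewrite !phi0.
by rewrite -E; field; rewrite !phi0.
Qed.

Let BC x y : B x y = B y x.
Proof. by rewrite /B addrC [phi y * _]mulrC. Qed.

Let B00 y : B 0 y = 1.
Proof. by rewrite /B add0r (charlike0 cphi) mul1r divff. Qed.

Let BN x y : B (- x) y = (B x y)^-1.
Proof. by apply: (mulfI (B0 x y)); rewrite -BD addrN B00 mulfV. Qed.

Let Bconj x y : (B x y)^*%C = B x y.
Proof.
have E : B (- x) (- y) = B x y by rewrite BN BC BN invrK BC.
by rewrite -{1}E /B -opprD !(charlikeN cphi) rmorphM fmorphV rmorphM/= !conjcK.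
Qed.

Let b (x y : V) := Re (B x y).

Let BE x y : B x y = (b x y)%:C%C.
Proof.
have := congr1 (@complex.Im R) (Bconj x y); rewrite /b; case: (B x y) => u v /= vE.
by congr Complex; lra.
Qed.

Let b_gt0 x y : 0 < b x y.
Proof.
have E : B x y = B (2^-1 *: x) y * B (2^-1 *: x) y by rewrite -BD -halfD.
have : b x y = b (2^-1 *: x) y ^+ 2.
  by move: E; rewrite !BE -rmorphM => /complexI ->; rewrite expr2.
move=> ->; rewrite exprn_even_gt0//=; apply/eqP => b0.
by have := B0 (2^-1 *: x) y; rewrite BE b0 eqxx.
Qed.

Let L (x y : V) := - ln (b x y).

Let bE x y : b x y = expR (- L x y).
Proof. by rewrite /L opprK lnK ?posrE ?b_gt0. Qed.

Let LD x h k : L (x + h) k = L x k + L h k.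
Proof.
have : b (x + h) k = b x k * b h k.
  by apply: (@complexI R); rewrite rmorphM/= -!BE BD.
by rewrite /L => ->; rewrite lnM ?posrE ?b_gt0// opprD.
Qed.

Let LC x y : L x y = L y x.
Proof. by rewrite /L /b BC. Qed.

Let N (z : R[i]) : R := Re `|z|.

Let NE (z : R[i]) : `|z| = (N z)%:C%C.
Proof. by rewrite /N RRe_real// normr_real. Qed.

Let bN x y : b x y * (N (phi x) * N (phi y)) = N (phi (x + y)).
Proof.
apply: (@complexI R); rewrite !rmorphM/= -!NE -[(b x y)%:C%C]ger0_norm; last first.
  by rewrite ler0c ltW.
by rewrite -BE -!normrM /B divfK// mulf_neq0.
Qed.

Let N_gt0 x : 0 < N (phi x).
Proof. by rewrite -ltcR -NE normr_gt0. Qed.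

Let N_le1 x : N (phi x) <= 1.
Proof. by rewrite -lecR -NE charlike_le1. Qed.

Let LZ t x y : L (t *: x) y = t * L x y.
Proof.
have : \forall t \near (0 : R), 2^-1 < Re (phi (t *: x)).
  by apply: (cvgr_gt _ (charlike_cvg_Re cphi x)); lra.
move=> /nbhs_ballP[d /= d0 Hd].
have -> := @additive_bounded_linear R (fun t => L (t *: x) y) d
  (ln (2 / N (phi y))) _ d0; first by rewrite scale1r.
- by move=> s u; rewrite scalerDl LD.
- move=> s sd; have -> : L (s *: x) y = ln (b (- s *: x) y).
    by rewrite bE expRK scaleNr /L /b BN -/(b _ _) BE -fmorphV/= lnV ?posrE ?b_gt0// opprK.
  rewrite ler_ln ?posrE ?b_gt0 ?divr_gt0// ler_pdivlMr//.
  have h1 : 2^-1 < N (phi (- s *: x)).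
    apply: (@lt_le_trans _ _ (Re (phi (- s *: x)))).
      by apply: Hd; rewrite /ball/= sub0r normrN normrN.
    by rewrite -lecR -NE; apply: le_trans (normc_ge_Re _); rewrite lecR ler_norm.
  have := bN (- s *: x) y; have := N_le1 (- s *: x + y).
  have := N_gt0 y; have := b_gt0 (- s *: x) y; set p := b _ _; set q := N (phi y).
  set r := N (phi (_ *: _)) in h1 *; set m := N _ => p0 q0 m1 E.
  have pq : 0 < p * q by rewrite mulr_gt0.
  nra.
Qed.

Let LZr t x y : L x (t *: y) = t * L x y.
Proof. by rewrite LC LZ LC. Qed.

Let L0 y : L 0 y = 0.
Proof. by rewrite -(scale0r 0) LZ mul0r. Qed.

Let NL x : N (phi x) ^+ 2 = expR (- L x x).
Proof.
have bxx : b x (- x) = expR (L x x).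
  by rewrite bE LC -(scaleN1r x) LZ mulN1r opprK.
have := bN x (- x); rewrite addrN bxx {3}/N (charlike0 cphi) normr1.
have -> : N (phi (- x)) = N (phi x) by rewrite (charlikeN cphi) /N normcJ.
by move=> E; rewrite expRN; apply/(mulfI (lt0r_neq0 (expR_gt0 (L x x)))); rewrite expr2 E mulfV// gt_eqF ?expR_gt0.
Qed.

Let L_ge0 x : 0 <= L x x.
Proof.
rewrite -oppr_le0 -expR_le1 -NL expr_le1//; last by rewrite ltW.
Qed.

Let c (x : V) := phi x * (expR (L x x / 2))%:C%C.

Let cE x : phi x = c x * (expR (- (L x x / 2)))%:C%C.
Proof. by rewrite /c -mulrA -rmorphM -expRD addrN expR0 mulr1. Qed.

Let cD x y : c (x + y) = c x * c y.
Proof.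
have -> : c (x + y) = phi x * phi y * B x y * (expR (L (x + y) (x + y) / 2))%:C%C.
  by congr (_ * _); rewrite /B mulrC divfK// mulf_neq0.
rewrite BE bE -mulrA -rmorphM -expRD /c.
have -> : - L x y + L (x + y) (x + y) / 2 = L x x / 2 + L y y / 2.
  by rewrite LD (LC x (x + y)) (LC y (x + y)) !LD (LC y x); lra.
by rewrite expRD rmorphM/=; ring.
Qed.

Let c1 x : `|c x| = 1.
Proof.
rewrite normrM NE ger0_norm ?ler0c ?expR_ge0// -rmorphM/=.
suff -> : N (phi x) * expR (L x x / 2) = 1 by [].
apply/eqP; rewrite -(@eqrXn2 _ 2)// ?mulr_ge0 ?expR_ge0// ?ltW//.
rewrite expr1n exprMn NL -expRM_natl -expRD.
apply/eqP; transitivity (expR (0 : R)); [congr expR; lra|exact: expR0].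
Qed.

Let expR_sqr_cvg (l : R) : expR (t * (t * l) / 2) @[t --> (0 : R)] --> (1 : R).
Proof.
have e0 : t * (t * l) / 2 @[t --> (0 : R)] --> (0 * (0 * l) / 2 : R).
  apply: cvgM; last exact: cvg_cst.
  by apply: cvgM; [exact: cvg_id|apply: cvgM; [exact: cvg_id|exact: cvg_cst]].
rewrite -[X in _ --> X]expR0 -[X in expR X](_ : 0 * (0 * l) / 2 = 0); last by rewrite !mul0r.
by apply: continuous_cvg e0; exact: continuous_expR.
Qed.

Let c_line (x : V) : exists a, forall t, c (t *: x) = expi (a * t).
Proof.
apply: (@char_line_expi R (fun t => c (t *: x))).
- by move=> s t; rewrite scalerDl cD.
- by [].
- have -> : (fun t => Re (c (t *: x))) =
      (fun t => Re (phi (t *: x)) * expR (t * (t * L x x) / 2)).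
    by apply/funext => t; rewrite /c LZ LZr; case: (phi _) => p q /=; ring.
  rewrite -[X in _ --> X]mulr1.
  exact: cvgM (charlike_cvg_Re cphi x) (expR_sqr_cvg (L x x)).
- have -> : (fun t => Im (c (t *: x))) =
      (fun t => Im (phi (t *: x)) * expR (t * (t * L x x) / 2)).
    by apply/funext => t; rewrite /c LZ LZr; case: (phi _) => p q /=; ring.
  rewrite -[X in _ --> X](mul0r 1).
  exact: cvgM (charlike_cvg_Im cphi x) (expR_sqr_cvg (L x x)).
Qed.

Lemma cubic_gauss_form : exists (m : 'rV[R]_n) (S : 'M[R]_n),
  [/\ S^T = S, forall s, 0 <= dotrV (s *m S) s &
    forall s, phi s = expi (dotrV m s) *
      (expR (- (dotrV (s *m S) s / 2)))%:C%C].
Proof.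
have /choice[a aP] i := c_line (delta_mx 0 i).
pose m : V := \row_i a i; pose S : 'M[R]_n := \matrix_(i, j) L 'e_i 'e_j.
have LS s : L s s = dotrV (s *m S) s.
  have Lsum (u : V) y : L u y = \sum_i u 0 i * L 'e_i y.
    rewrite {1}(row_sum_delta u).
    rewrite (big_morph (L^~ y) (id1 := 0) (op1 := +%R))//.
    by apply: eq_bigr => i _; rewrite LZ.
  rewrite /dotrV mxE [LHS]Lsum; under eq_bigr => i _ do rewrite LC Lsum mulr_sumr.
  rewrite exchange_big/=; apply: eq_bigr => j _; rewrite !mxE mulr_suml.
  by apply: eq_bigr => i _; rewrite mxE (LC 'e_j); ring.
exists m, S; split.
- by apply/matrixP => i j; rewrite !mxE LC.
- by move=> s; rewrite -LS.
- move=> s; rewrite -LS [LHS]cE; congr (_ * _).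
  have c0 : c 0 = 1.
    by rewrite /c (charlike0 cphi) L0 mul0r expR0 mulr1.
  rewrite {1}(row_sum_delta s) (big_morph c (id1 := 1) (op1 := *%R))//.
  rewrite /dotrV mxE (big_morph (@expi R) (id1 := 1) (op1 := *%R)); last 2 first.
  - exact: expiD.
  - by rewrite /expi cos0 sin0.
  by apply: eq_bigr => i _; rewrite aP !mxE.
Qed.

End gauss_form.
End cubic.

Section heyde_pair.
Variables (R : realType) (n : nat) (M : 'M[R]_n) (phi psi : 'rV[R]_n -> R[i]).
Hypotheses (cphi : charlike phi) (cpsi : charlike psi).
Hypotheses (uM : M \in unitmx) (uM1 : 1%:M + M \in unitmx) (H : heyde_eq M phi psi).

Let uMi : 1%:M + invmx M \in unitmx.
Proof.
have -> : 1%:M + invmx M = invmx M *m (1%:M + M).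
  by rewrite mulmxDr mulmx1 mulVmx// addrC.
by rewrite unitmx_mul unitmx_inv uM.
Qed.

(** The equation is symmetric under exchange of the two functions and inversion
of [M], so what holds for [phi] holds for [psi]. *)
Lemma heyde_pair_cubic : [/\ forall u, phi u != 0, forall u, psi u != 0,
  cubic phi & cubic psi].
Proof.
have phi0 := heyde_neq0 cphi cpsi uM1 H.
have psi0 := heyde_neq0 cpsi cphi uMi (heyde_eq_swap uM H).
split=> // x y z; first exact: (heyde_cube cphi cpsi uM1 H psi0).
exact: (heyde_cube cpsi cphi uMi (heyde_eq_swap uM H) phi0).
Qed.

End heyde_pair.

(** * Bounded measurable functions *)

Section bounded_measurable.
Context d (T : measurableType d) (R : realType).
Implicit Types f g : T -> R.

Definition bmfun f := measurable_fun setT f /\ exists C, forall x, `|f x| <= C.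

Lemma bmfun_cst (c : R) : bmfun (fun=> c).
Proof. by split; [exact: measurable_cst|exists `|c|]. Qed.

Lemma bmfunD f g : bmfun f -> bmfun g -> bmfun (fun x => f x + g x).
Proof.
move=> [mf [C fC]] [mg [D gD]]; split; first exact: measurable_funD.
by exists (C + D) => x; apply: le_trans (ler_normD _ _) _; exact: lerD.
Qed.

Lemma bmfunM f g : bmfun f -> bmfun g -> bmfun (fun x => f x * g x).
Proof.
move=> [mf [C fC]] [mg [D gD]]; split; first exact: measurable_funM.
by exists (C * D) => x; rewrite normrM ler_pM.
Qed.

Lemma bmfun_indic (A : set T) : measurable A -> bmfun \1_A.
Proof.
move=> mA; split; first exact: measurable_indic.
by exists 1 => x; rewrite indicE; case: (_ \in _); rewrite ?normr1 ?normr0.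
Qed.

Variable mu : {measure set T -> \bar R}.
Hypothesis muoo : (mu setT < +oo)%E.

Lemma bmfun_integrable f : bmfun f -> mu.-integrable setT (EFin \o f).
Proof.
move=> [mf [C fC]]; apply: measurable_bounded_integrable => //.
exists C; split; first exact: num_real.
by move=> M CM x _; apply: le_trans (fC x) (ltW CM).
Qed.

Lemma bmfun_RintegralD f g : bmfun f -> bmfun g ->
  \int[mu]_x (f x + g x) = \int[mu]_x f x + \int[mu]_x g x.
Proof. by move=> bf bg; rewrite RintegralD//; exact: bmfun_integrable. Qed.

Lemma bmfun_RintegralZ c f : bmfun f ->
  \int[mu]_x (c * f x) = c * \int[mu]_x f x.
Proof. by move=> bf; rewrite RintegralZl//; exact: bmfun_integrable. Qed.

Lemma bmfun_Rintegral_cvg (f_ : nat -> T -> R) f C :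
  (forall k, measurable_fun setT (f_ k)) ->
  (forall k x, `|f_ k x| <= C) ->
  (forall x, f_ k x @[k --> \oo] --> f x) ->
  bmfun f /\ \int[mu]_x f_ k x @[k --> \oo] --> \int[mu]_x f x.
Proof.
move=> mf fC ff.
have bf : bmfun f.
  split; first exact: measurable_fun_cvg mf (fun x _ => ff x).
  exists C => x; have nf : `|f_ k x| @[k --> \oo] --> `|f x| by exact: cvg_norm.
  rewrite -(cvg_lim (@Rhausdorff R) nf); apply: limr_le; last exact: nearW.
  by apply: cvgP; exact: nf.
split=> //; rewrite /Rintegral.
apply: fine_cvg; rewrite fineK; last first.
  by apply: integrable_fin_num => //; exact: bmfun_integrable.
apply: (@dominated_cvg _ _ _ mu setT _ (fun k x => (f_ k x)%:E) _ (fun=> C%:E)) => //.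
- by move=> k; exact/measurable_EFinP.
- by move=> x _; apply: cvg_EFin; [exact: nearW|exact: ff].
- exact: bmfun_integrable (bmfun_cst C).
- by move=> k x _; rewrite lee_fin.
Qed.

Lemma Rintegral_indic A : measurable A -> \int[mu]_x \1_A x = fine (mu A).
Proof. by move=> mA; rewrite /Rintegral integral_indic// setIT. Qed.

End bounded_measurable.

Lemma bmfun_comp d d' (S : measurableType d) (T : measurableType d')
    (R : realType) (Z : S -> T) (f : T -> R) :
  measurable_fun setT Z -> bmfun f -> bmfun (fun x => f (Z x)).
Proof.
move=> mZ [mf [C fC]]; split; last by exists C => x; exact: fC.
exact: measurableT_comp mf mZ.
Qed.

(** * Uniqueness of the characteristic function *)

Section char_uniqueness.
Variables (R : realType) (n : nat).
Local Notation V := 'rV[R]_n.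

Lemma measurable_dotrV (s : V) : measurable_fun setT (fun x : V => dotrV x s).
Proof.
rewrite (_ : (fun _ => _) = (fun x : V => \sum_i rV_coord i x * s 0 i)).
  apply: measurable_sum => i; apply: measurable_funM; last exact: measurable_cst.
  exact: measurable_rV_coord.
by apply/funext => x; rewrite /dotrV mxE; apply: eq_bigr => i _; rewrite mxE.
Qed.

Inductive trigpoly : (V -> R) -> Prop :=
| trigpoly_cos s c : trigpoly (fun x => cos (dotrV x s + c))
| trigpolyD f g : trigpoly f -> trigpoly g -> trigpoly (fun x => f x + g x)
| trigpolyZ a f : trigpoly f -> trigpoly (fun x => a * f x).

Lemma dotrVDr (x s t : V) : dotrV x (s + t) = dotrV x s + dotrV x t.
Proof. by rewrite /dotrV linearD/= mulmxDr mxE. Qed.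

Lemma dotrVZr (x s : V) a : dotrV x (a *: s) = a * dotrV x s.
Proof. by rewrite /dotrV linearZ/= -scalemxAr mxE. Qed.

Lemma dotrVNr (x s : V) : dotrV x (- s) = - dotrV x s.
Proof. by rewrite -scaleN1r dotrVZr mulN1r. Qed.

Lemma dotrV_delta (x : V) i : dotrV x 'e_i = x 0 i.
Proof.
rewrite /dotrV mxE (bigD1 i)//= big1 ?addr0 => [|j ji].
  by rewrite !mxE !eqxx mulr1.
by rewrite !mxE (negPf ji) andbF mulr0.
Qed.

Lemma cos_prod_to_sum (a b : R) :
  cos a * cos b = 2^-1 * (cos (a + b) + cos (a - b)).
Proof. by rewrite cosD cosB; field. Qed.

(** Products of cosines are sums of cosines. *)
Lemma trigpolyM f g : trigpoly f -> trigpoly g -> trigpoly (fun x => f x * g x).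
Proof.
move=> tf tg; elim: tf => {f} [s c|f1 f2 _ I1 _ I2|a f _ I].
- elim: tg => {g} [t e|g1 g2 _ I1 _ I2|a g _ I].
  + have -> : (fun x => cos (dotrV x s + c) * cos (dotrV x t + e)) =
      (fun x => 2^-1 * (cos (dotrV x (s + t) + (c + e)) +
                        cos (dotrV x (s - t) + (c - e)))).
      apply/funext => x; rewrite !dotrVDr dotrVNr.
      set p := dotrV x s; set q := dotrV x t.
      have -> : p + q + (c + e) = p + c + (q + e) by ring.
      have -> : p - q + (c - e) = p + c - (q + e) by ring.
      exact: cos_prod_to_sum.
    by apply: trigpolyZ; apply: trigpolyD; exact: trigpoly_cos.
  + have := trigpolyD I1 I2; congr trigpoly; apply/funext => x; ring.
  + have := trigpolyZ a I; congr trigpoly; apply/funext => x; ring.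
- have := trigpolyD I1 I2; congr trigpoly; apply/funext => x; ring.
- have := trigpolyZ a I; congr trigpoly; apply/funext => x; ring.
Qed.

Lemma trigpoly_cst c : trigpoly (fun=> c).
Proof.
have := trigpolyZ c (trigpoly_cos 0 0); congr trigpoly; apply/funext => x.
by rewrite -(scale0r 0) dotrVZr mul0r addr0 cos0 mulr1.
Qed.

Lemma trigpoly_prod (I : Type) (l : seq I) (F : I -> V -> R) :
  (forall i, trigpoly (F i)) -> trigpoly (fun x => \prod_(i <- l) F i x).
Proof.
move=> tF; elim: l => [|i l IH].
  by under eq_fun do rewrite big_nil; exact: trigpoly_cst.
by under eq_fun do rewrite big_cons; exact: trigpolyM.
Qed.

Lemma trigpoly_bmfun f : trigpoly f -> bmfun f.
Proof.
elim=> {f} [s c|f g _ bf _ bg|a f _ bf]; [|exact: bmfunD|exact: bmfunM (bmfun_cst _ _) bf].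
split; last by exists 1 => x; rewrite ler_norml cos_geN1 cos_le1.
apply: (@measurableT_comp _ _ _ _ _ _ (@cos R)).
  by apply: continuous_measurable_fun; exact: continuous_cos.
by apply: measurable_funD; [exact: measurable_dotrV|exact: measurable_cst].
Qed.

(** A polynomial with attracting fixed points 1 and -1: its iterates turn a
trigonometric polynomial with values in [[-1, 1]] into trigonometric
polynomials that converge boundedly to its sign. *)
Definition signstep (t : R) := (3 * t - t ^+ 3) / 2.

Lemma signstepN t : signstep (- t) = - signstep t.
Proof. by rewrite /signstep; field. Qed.

Lemma signstep_bnd t : `|t| <= 1 -> `|signstep t| <= 1.
Proof.
rewrite !ler_norml /signstep => /andP[h1 h2]; rewrite !exprS expr0 mulr1.
have u : 0 <= (1 - t) * (1 - t) * (2 + t) by rewrite !mulr_ge0//; lra.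
have v : 0 <= (1 + t) * (1 + t) * (2 - t) by rewrite !mulr_ge0//; lra.
by apply/andP; split; nra.
Qed.

Lemma trigpoly_iter_signstep k f : trigpoly f ->
  trigpoly (fun x => iter k signstep (f x)).
Proof.
move=> tf; elim: k => //= k tg; set g := fun x => iter k signstep (f x) in tg.
have := trigpolyD (trigpolyZ (3 / 2) tg)
  (trigpolyZ (- 2^-1) (trigpolyM tg (trigpolyM tg tg))).
by congr trigpoly; apply/funext => x; rewrite /signstep -/(g x); field.
Qed.

Lemma iter_signstep_bnd k t : `|t| <= 1 -> `|iter k signstep t| <= 1.
Proof. by move=> t1; elim: k => //= k; exact: signstep_bnd. Qed.

(** For [0 < t <= 1] one has [1 - signstep u <= (1 - u) (1 - t / 2)] on [[t, 1]],
an interval preserved by [signstep]. *)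
Lemma iter_signstep_cvg t : `|t| <= 1 ->
  iter k signstep t @[k --> \oo] --> Num.sg t.
Proof.
have iterN k u : iter k signstep (- u) = - iter k signstep u.
  by elim: k => //= k ->; rewrite signstepN.
wlog t0 : t / 0 <= t => [H|] t1.
  have [/H|t0] := leP 0 t; first exact.
  have := H (- t) ltac:(by rewrite oppr_ge0 ltW) ltac:(by rewrite normrN).
  rewrite sgrN => c; rewrite -[Num.sg t]opprK.
  have -> : (fun k => iter k signstep t) = (fun k => - iter k signstep (- t)).
    by apply/funext => k; rewrite iterN opprK.
  exact: cvgN.
move: t0; rewrite le_eqVlt => /predU1P[<-|t0].
  rewrite sgr0 (_ : (fun k => _) = (fun=> 0)); first exact: cvg_cst.
  apply/funext => k; elim: k => //= k ->.
  by rewrite /signstep expr0n/= mulr0 subr0 mul0r.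
rewrite gtr0_sg//; have {}t1 : t <= 1 by move: t1; rewrite ger0_norm// ltW.
pose q := 1 - t / 2.
have H k : t <= iter k signstep t <= 1 /\ 1 - iter k signstep t <= q ^+ k.
  elim: k => [|k [/andP[tk k1] kq]] /=.
    by rewrite lexx t1 expr0; split=> //; lra.
  set u := iter k signstep t in tk k1 kq *.
  have E : 1 - signstep u = (1 - u) * ((1 - u) * (2 + u) / 2) by rewrite /signstep; field.
  have E' : signstep u - u = u * ((1 - u) * (1 + u)) / 2 by rewrite /signstep; field.
  have u1 : 0 <= 1 - u by lra.
  have a1 : 0 <= u * ((1 - u) * (1 + u)) / 2 by rewrite divr_ge0// !mulr_ge0//; lra.
  have a2 : 0 <= (1 - u) * ((1 - u) * (2 + u) / 2).
    by rewrite mulr_ge0// divr_ge0// mulr_ge0//; lra.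
  split; first by apply/andP; split; lra.
  rewrite E exprS mulrC; apply: ler_pM => //; first by rewrite divr_ge0// mulr_ge0//; lra.
  by rewrite /q; nra.
have q01 : `|q| < 1 by rewrite /q ltr_norml; apply/andP; split; lra.
apply: (@squeeze_cvgr _ _ _ _ (fun k => 1 - q ^+ k) (fun=> 1)); last 2 first.
- by rewrite -[X in _ --> X]subr0; apply: cvgB; [exact: cvg_cst|exact: cvg_expr].
- exact: cvg_cst.
by apply: nearW => k; have [/andP[_ ->] h] := H k; rewrite andbT; lra.
Qed.

Lemma sg_sin_small (y : R) : \forall j \near \oo,
  Num.sg (sin (y / j.+1%:R)) = Num.sg y.
Proof.
have [N _ HN] : \forall j \near \oo, `|y| <= j%:R.
  exact: nbhs_infty_ger.
exists N => // j /= Nj.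
have yj : `|y| < j.+1%:R by apply: le_lt_trans (HN j Nj) _; rewrite ltr_nat.
have pos (z : R) : 0 < z -> z < j.+1%:R -> 0 < sin (z / j.+1%:R).
  move=> z0 zj; apply: sin_gt0_pi; rewrite divr_gt0//=.
  apply: (@lt_le_trans _ _ 1); first by rewrite ltr_pdivrMr// mul1r.
  by apply: le_trans (pi_ge2 R); lra.
move: yj; rewrite ltr_norml => /andP[yj1 yj2].
have [y0|y0|->] := ltgtP y 0; last by rewrite mul0r sin0.
- rewrite (ltr0_sg y0) ltr0_sg// -oppr_gt0 -sinN -mulNr pos//; lra.
- by rewrite (gtr0_sg y0) gtr0_sg// pos.
Qed.

(** Finite intersections of open half-spaces; they form a pi-system generating
the Borel sets. *)
Definition halfspaces (l : seq (V * R)) : set V :=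
  [set x | all (fun q => q.2 < dotrV x q.1) l].

(** Maps the values -1, 0, 1 of the sign to 0, 0, 1. *)
Let step (b : R) := (b ^+ 2 + b) / 2.

Let step_sg (x s : V) (a : R) :
  step (Num.sg (dotrV x s - a)) = (a < dotrV x s)%R%:R.
Proof.
rewrite /step -[a < _]subr_gt0; set y := _ - a.
have [y0|y0|->] := ltgtP y 0; last by rewrite sgr0 expr0n/= addr0 mul0r.
- by rewrite ltr0_sg// sqrrN expr1n subrr mul0r.
- by rewrite gtr0_sg// expr1n /= mulr1n; field.
Qed.

Let step_bnd b : `|b| <= 1 -> `|step b| <= 1.
Proof. by rewrite !ler_norml /step expr2 => /andP[? ?]; apply/andP; split; nra. Qed.

Let step_cvg (u : nat -> R) (l : R) : u k @[k --> \oo] --> l ->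
  step (u k) @[k --> \oo] --> step l.
Proof.
move=> ul; apply: cvgM; last exact: cvg_cst.
by apply: cvgD => //; rewrite expr2; apply: cvgM.
Qed.

Let prod_cvg (l : seq (V * R)) (u : V * R -> nat -> R) (v : V * R -> R) :
  (forall q, u q k @[k --> \oo] --> v q) ->
  \prod_(q <- l) u q k @[k --> \oo] --> \prod_(q <- l) v q.
Proof.
move=> uv; elim: l => [|q l IH].
  by under eq_fun do rewrite big_nil; rewrite big_nil; exact: cvg_cst.
by under eq_fun do rewrite big_cons; rewrite big_cons; apply: cvgM.
Qed.

Let prod_bnd (l : seq (V * R)) (u : V * R -> R) : (forall q, `|u q| <= 1) ->
  `|\prod_(q <- l) u q| <= 1.
Proof.
move=> u1; elim: l => [|q l IH]; first by rewrite big_nil normr1.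
by rewrite big_cons normrM mulr_ile1.
Qed.

Lemma indic_halfspaces l x :
  \1_(halfspaces l) x = \prod_(q <- l) (q.2 < dotrV x q.1)%R%:R :> R.
Proof.
rewrite indicE; elim: l => [|q l IH]; first by rewrite big_nil mem_set.
rewrite big_cons -IH /halfspaces/=.
by rewrite !mem_setE/= -natrM mulnb.
Qed.

Variables mu nu : {measure set V -> \bar R}.
Hypotheses (muoo : (mu setT < +oo)%E) (nuoo : (nu setT < +oo)%E).
Hypothesis eq_cos : forall s,
  \int[mu]_x cos (dotrV x s) = \int[nu]_x cos (dotrV x s).
Hypothesis eq_sin : forall s,
  \int[mu]_x sin (dotrV x s) = \int[nu]_x sin (dotrV x s).

Let same_int (f : V -> R) := \int[mu]_x f x = \int[nu]_x f x.

Let trigpoly_same_int f : trigpoly f -> same_int f.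
Proof.
elim=> {f} [s c|f g tf If tg Ig|a f tf If].
- have -> : (fun x => cos (dotrV x s + c)) = (fun x : V =>
      cos c * cos (dotrV x s + 0) + (- sin c) * cos (dotrV x s + (- (pi / 2)))).
    by apply/funext => x; rewrite addr0 cosD cosBpihalf; ring.
  have b0 := trigpoly_bmfun (trigpoly_cos s 0).
  have b1 := trigpoly_bmfun (trigpoly_cos s (- (pi / 2))).
  have bz c' f : bmfun f -> bmfun (fun x : V => c' * f x :> R).
    exact: bmfunM (bmfun_cst _ _).
  rewrite /same_int !bmfun_RintegralD//; try exact: bz.
  rewrite !bmfun_RintegralZ//.
  have E1 (m : {measure set V -> \bar R}) :
      \int[m]_x cos (dotrV x s + 0) = \int[m]_x cos (dotrV x s).
    by apply: eq_Rintegral => x _; rewrite addr0.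
  have E2 (m : {measure set V -> \bar R}) :
      \int[m]_x cos (dotrV x s + (- (pi / 2))) = \int[m]_x sin (dotrV x s).
    by apply: eq_Rintegral => x _; rewrite cosBpihalf.
  by rewrite !E1 !E2 eq_cos eq_sin.
- by rewrite /same_int !bmfun_RintegralD ?If ?Ig//; exact: trigpoly_bmfun.
- by rewrite /same_int !bmfun_RintegralZ ?If//; exact: trigpoly_bmfun.
Qed.

Let same_int_cvg (f_ : nat -> V -> R) (f : V -> R) (C : R) :
  (forall k, measurable_fun setT (f_ k)) -> (forall k x, `|f_ k x| <= C) ->
  (forall x, f_ k x @[k --> \oo] --> f x) -> (forall k, same_int (f_ k)) ->
  bmfun f /\ same_int f.
Proof.
move=> mf fC ff sf.
have [bf c1] := bmfun_Rintegral_cvg muoo mf fC ff.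
have [_ c2] := bmfun_Rintegral_cvg nuoo mf fC ff.
split=> //; apply: (cvg_unique (@Rhausdorff R) c1).
by apply: cvg_trans c2; apply: near_eq_cvg; apply: nearW => k; rewrite sf.
Qed.

Let halfspaces_same l : bmfun (\1_(halfspaces l) : V -> R) /\ same_int (\1_(halfspaces l)).
Proof.
pose th j (q : V * R) (x : V) := sin ((dotrV x q.1 - q.2) / j.+1%:R).
have th1 j q x : `|th j q x| <= 1 by rewrite /th ler_norml sin_geN1 sin_le1.
have tth j q : trigpoly (th j q).
  have := trigpoly_cos (j.+1%:R^-1 *: q.1) (- q.2 / j.+1%:R - pi / 2).
  congr trigpoly; apply/funext => x.
  by rewrite addrA cosBpihalf dotrVZr /th mulrDl mulrC.
pose F j k x := \prod_(q <- l) step (iter k signstep (th j q x)).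
have tF j k : trigpoly (F j k).
  apply: trigpoly_prod => q; have tg := trigpoly_iter_signstep k (tth j q).
  have := trigpolyZ 2^-1 (trigpolyD (trigpolyM tg tg) tg).
  by congr trigpoly; apply/funext => x; rewrite /step; field.
pose F' j x := \prod_(q <- l) step (Num.sg (th j q x)).
have sF' j : bmfun (F' j) /\ same_int (F' j).
  apply: (@same_int_cvg (F j) _ 1).
  - by move=> k; exact: (trigpoly_bmfun (tF j k)).1.
  - by move=> k x; apply: prod_bnd => q; apply: step_bnd; exact: iter_signstep_bnd.
  - move=> x; apply: (@prod_cvg l (fun q k => step (iter k signstep (th j q x)))).
    by move=> q; apply: step_cvg; exact: iter_signstep_cvg.
  - by move=> k; exact: trigpoly_same_int.
apply: (@same_int_cvg F' _ 1).
- by move=> j; exact: (sF' j).1.1.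
- move=> j x; apply: prod_bnd => q; apply: step_bnd.
  by rewrite normr_sg; case: (_ == _); rewrite ?normr0 ?normr1.
- move=> x; rewrite indic_halfspaces.
  under eq_bigr => q _ do rewrite -step_sg.
  apply: (@prod_cvg l (fun q j => step (Num.sg (th j q x)))) => q.
  apply: step_cvg; apply: (@cvg_near_cst).
  exact: sg_sin_small.
- by move=> j; exact: (sF' j).2.
Qed.

Let measurable_halfspaces l : measurable (halfspaces l).
Proof.
elim: l => [|q l IH]; first by rewrite (_ : halfspaces _ = setT)//; apply/seteqP; split.
rewrite (_ : halfspaces _ = [set x | q.2 < dotrV x q.1] `&` halfspaces l); last first.
  by apply/seteqP; split => x /=; rewrite /halfspaces/= => /andP.
apply: measurableI => //.
have := measurable_dotrV q.1 measurableT (measurable_itv `]q.2, +oo[).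
by rewrite setTI; congr measurable; apply/seteqP; split => x /=; rewrite in_itv/= andbT.
Qed.

(** Both measures integrate trigonometric polynomials equally.  Signs of
[sin ((x.s - a) / j)] are bounded limits of such polynomials, and as [j] grows
they become the sign of [x.s - a]; products of them give the indicators of the
sets [halfspaces l]. *)
Lemma char_uniqueness A : measurable A -> mu A = nu A.
Proof.
move=> mA; pose G := range halfspaces.
have : <<s G >> A.
  pose GT := g_sigma_algebraType G.
  have mid : measurable_fun setT (fun x : GT => (x : V)).
    apply: measurable_fun_rV => i.
    apply: (measurability _ (RGenOInfty.measurableE R)) => //.
    move=> _ [_ [a ->] <-]; apply: sub_sigma_algebra.
    exists [:: ('e_i, a)] => //.
    apply/seteqP; split => x /=; rewrite /halfspaces/= in_itv/= !andbT /rV_coord/=.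
      by rewrite dotrV_delta; split.
    by rewrite dotrV_delta => -[].
  by have := mid measurableT A mA; rewrite setTI.
apply: (@g_sigma_algebra_measure_unique _ _ _ G _ (fun=> setT)) => //.
- by move=> _ [l _ <-].
- by move=> _; exists [::] => //; apply/seteqP; split.
- by rewrite bigcup_const.
- move=> _ _ [l _ <-] [k _ <-]; exists (l ++ k) => //.
  by apply/seteqP; split => x /=; rewrite /halfspaces/= all_cat => /andP.
- move=> _ [l _ <-]; have [bl] := halfspaces_same l.
  rewrite /same_int !Rintegral_indic// => E.
  have fin (m : {measure set V -> \bar R}) : (m setT < +oo)%E ->
      m (halfspaces l) \is a fin_num.
    move=> moo; rewrite ge0_fin_numE//; apply: le_lt_trans moo.
    by apply: le_measure; rewrite ?inE.
  by rewrite -(fineK (fin mu muoo)) E fineK// fin.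
Qed.

End char_uniqueness.

(** * Laws of pairs and independence *)

Section laws.
Context d dT (Omega : measurableType d) (T : measurableType dT) (R : realType).
Variable P : probability Omega R.

Lemma Rintegral_distribution (X : {mfun Omega >-> T}) (f : T -> R) : bmfun f ->
  \int[distribution P X]_x f x = \int[P]_w f (X w).
Proof.
move=> bf; rewrite /Rintegral; congr fine.
have Poo : (P setT < +oo)%E by rewrite probability_setT ltry.
have bfX := bmfun_comp (@measurable_funPT _ _ _ _ X) bf.
have mf : measurable_fun setT (EFin \o f) by apply/measurable_EFinP; exact: bf.1.
exact: (integral_distribution mf (bmfun_integrable Poo bfX)).
Qed.

Lemma same_law_Rintegral (X Y : {mfun Omega >-> T}) (f : T -> R) :
  (forall A, measurable A -> P (X @^-1` A) = P (Y @^-1` A)) -> bmfun f ->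
  \int[P]_w f (X w) = \int[P]_w f (Y w).
Proof.
move=> XY bf; rewrite -!Rintegral_distribution// /Rintegral; congr fine.
by apply: eq_measure_integral => A mA _; exact: XY.
Qed.

End laws.

Section pair_laws.
Context d d1 d2 (Omega : measurableType d) (T1 : measurableType d1)
  (T2 : measurableType d2) (R : realType).
Variable P : probability Omega R.

Lemma rectangles_same_law (X Y : {mfun Omega >-> (T1 * T2)%type}) :
  (forall A B, measurable A -> measurable B ->
    P (X @^-1` (A `*` B)) = P (Y @^-1` (A `*` B))) ->
  forall D, measurable D -> P (X @^-1` D) = P (Y @^-1` D).
Proof.
move=> XY D mD.
apply: (@measure_unique _ R _ [set A `*` B | A in measurable & B in measurable]
  (fun=> setT) _ _ _ _ (distribution P X) (distribution P Y)) => //.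
- exact: measurable_prod_measurableType.
- move=> _ _ [A mA [B mB <-]] [A' mA' [B' mB' <-]].
  exists (A `&` A'); first exact: measurableI.
  by exists (B `&` B'); [exact: measurableI|rewrite setXI].
- by move=> _; exists setT => //; exists setT => //; rewrite setXTT.
- by rewrite bigcup_const.
- by move=> _ [A mA [B mB <-]]; exact: XY.
- by move=> _; rewrite ltey_eq fin_num_measure.
Qed.

Variables (X : {mfun Omega >-> T1}) (Y : {mfun Omega >-> T2}).
Hypothesis XY : independent_RV P X Y.

Lemma measurable_pairRV : measurable_fun setT (fun w => (X w, Y w)).
Proof. by apply: measurable_fun_pair. Qed.

Lemma indep_law D : measurable D ->
  P ((fun w => (X w, Y w)) @^-1` D) = (distribution P X \x distribution P Y)%E D.
Proof.
move=> mD.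
pose Z : {mfun Omega >-> (T1 * T2)%type} :=
  HB.pack (fun w => (X w, Y w)) (isMeasurableFun.Build _ _ _ _ _ measurable_pairRV).
by rewrite (product_measure_unique (m' := distribution P Z)).
Qed.

Lemma indep_Rintegral (f : T1 -> R) (g : T2 -> R) : bmfun f -> bmfun g ->
  \int[P]_w (f (X w) * g (Y w)) = (\int[P]_w f (X w)) * (\int[P]_w g (Y w)).
Proof.
move=> bf bg.
have Poo d' (T : measurableType d') (Q : probability T R) : (Q setT < +oo)%E.
  by rewrite probability_setT ltry.
pose Z : {mfun Omega >-> (T1 * T2)%type} :=
  HB.pack (fun w => (X w, Y w)) (isMeasurableFun.Build _ _ _ _ _ measurable_pairRV).
pose h (z : T1 * T2) : R := f z.1 * g z.2.
have bh : bmfun h.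
  exact: bmfunM (bmfun_comp measurable_fst bf) (bmfun_comp measurable_snd bg).
have -> : \int[P]_w (f (X w) * g (Y w)) = \int[distribution P Z]_z h z.
  by rewrite (Rintegral_distribution P Z bh).
rewrite -(Rintegral_distribution P X bf) -(Rintegral_distribution P Y bg).
have -> : \int[distribution P Z]_z h z =
    fine (\int[distribution P X \x distribution P Y]_z (h z)%:E)%E.
  rewrite /Rintegral; congr fine; apply: eq_measure_integral => A mA _.
  exact: indep_law.
have prodoo : ((distribution P X \x distribution P Y)%E setT < +oo)%E.
  by rewrite -setXTT product_measure1E// lte_mul_pinfty//; [exact: (@fin_num_measure _ _ _ (distribution P X))|exact: (Poo _ _ (distribution P Y))].
rewrite -integral12_prod_meas1; last exact: (bmfun_integrable prodoo bh).
have PX := Poo _ _ (distribution P X); have PY := Poo _ _ (distribution P Y).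
rewrite mulrC -bmfun_RintegralZ//.
rewrite /Rintegral; congr fine; apply: eq_integral => x _.
rewrite /fubini_F /h/= -[LHS]fineK; last first.
  apply: integrable_fin_num => //.
  exact: (bmfun_integrable (Poo _ _ _) (bmfunM (bmfun_cst _ (f x)) bg)).
congr EFin; rewrite -/(Rintegral (distribution P Y) setT (fun y => f x * g y)).
by rewrite [RHS]mulrC; exact: bmfun_RintegralZ.
Qed.

End pair_laws.

(** * Complex expectations *)

Section complex_expectation.
Context d (T : measurableType d) (R : realType).

Definition cE (mu : {measure set T -> \bar R}) (F : T -> R[i]) : R[i] :=
  ((\int[mu]_x Re (F x)) +i* (\int[mu]_x Im (F x)))%C.

Definition cbmfun (F : T -> R[i]) :=
  bmfun (fun x => Re (F x)) /\ bmfun (fun x => Im (F x)).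

(** Its expectation for [th] linear in [u] is the characteristic function of the
restriction of a law to [E]. *)
Definition phase (E : set T) (th : T -> R) (x : T) : R[i] :=
  (\1_E x)%:C%C * expi (th x).

Lemma Re_phase E th x : Re (phase E th x) = \1_E x * cos (th x).
Proof. by rewrite /phase/= mul0r subr0. Qed.

Lemma Im_phase E th x : Im (phase E th x) = \1_E x * sin (th x).
Proof. by rewrite /phase/= mul0r addr0. Qed.

Lemma bmfun_cos (th : T -> R) : measurable_fun setT th -> bmfun (fun x => cos (th x)).
Proof.
move=> mth; split; last by exists 1 => x; rewrite ler_norml cos_geN1 cos_le1.
have mf : measurable_fun setT (@cos R).
  by apply: continuous_measurable_fun; exact: continuous_cos.
exact: measurableT_comp mf mth.
Qed.

Lemma bmfun_sin (th : T -> R) : measurable_fun setT th -> bmfun (fun x => sin (th x)).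
Proof.
move=> mth; split; last by exists 1 => x; rewrite ler_norml sin_geN1 sin_le1.
have mf : measurable_fun setT (@sin R).
  by apply: continuous_measurable_fun; exact: continuous_sin.
exact: measurableT_comp mf mth.
Qed.

Lemma cbmfun_phase (E : set T) (th : T -> R) : measurable E -> measurable_fun setT th ->
  cbmfun (phase E th).
Proof.
move=> mE mth; split.
  under eq_fun do rewrite Re_phase; apply: bmfunM; first exact: bmfun_indic.
  exact: bmfun_cos.
under eq_fun do rewrite Im_phase; apply: bmfunM; first exact: bmfun_indic.
exact: bmfun_sin.
Qed.

Lemma cbmfunM F G : cbmfun F -> cbmfun G -> cbmfun (fun x => F x * G x).
Proof.
have bN f : bmfun f -> bmfun (fun x : T => - f x : R).
  by move=> bf; have := bmfunM (bmfun_cst _ (-1)) bf; under eq_fun do rewrite mulN1r.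
move=> [F1 F2] [G1 G2]; split.
  rewrite (_ : (fun x => _) = (fun x => Re (F x) * Re (G x) + - (Im (F x) * Im (G x)))).
    exact: bmfunD (bmfunM F1 G1) (bN _ (bmfunM F2 G2)).
  by apply/funext => x; case: (F x) => ? ?; case: (G x).
rewrite (_ : (fun x => _) = (fun x => Re (F x) * Im (G x) + Im (F x) * Re (G x))).
  exact: bmfunD (bmfunM F1 G2) (bmfunM F2 G1).
by apply/funext => x; case: (F x) => ? ?; case: (G x).
Qed.

Lemma cbmfun_sum (I : Type) (l : seq I) (F : I -> T -> R[i]) :
  (forall i, cbmfun (F i)) -> cbmfun (fun x => \sum_(i <- l) F i x).
Proof.
move=> bF; have b0 : bmfun (fun _ : T => 0 : R) by exact: bmfun_cst.
elim: l => [|i l [I1 I2]]; first by split; under eq_fun do rewrite big_nil.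
split; under eq_fun do rewrite big_cons raddfD/=.
  exact: bmfunD (bF i).1 I1.
exact: bmfunD (bF i).2 I2.
Qed.

Variable mu : {measure set T -> \bar R}.
Hypothesis muoo : (mu setT < +oo)%E.

Lemma cED F G : cbmfun F -> cbmfun G ->
  cE mu (fun x => F x + G x) = cE mu F + cE mu G.
Proof.
move=> [F1 F2] [G1 G2]; rewrite /cE.
rewrite -[RHS]/((_ + _) +i* (_ + _))%C -!bmfun_RintegralD//.
by congr (_ +i* _)%C; apply: eq_Rintegral => x _; case: (F x) => ? ?; case: (G x).
Qed.

Lemma cEZ z F : cbmfun F -> cE mu (fun x => z * F x) = z * cE mu F.
Proof.
move=> [F1 F2]; case: z => a b.
have bZ c f : bmfun f -> bmfun (fun x : T => c * f x : R).
  exact: bmfunM (bmfun_cst _ _).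
have -> : (a +i* b)%C * cE mu F = ((a * \int[mu]_x Re (F x) + - b * \int[mu]_x Im (F x))
    +i* (a * \int[mu]_x Im (F x) + b * \int[mu]_x Re (F x)))%C.
  by rewrite /cE; apply/eqP; rewrite eq_complex/=; apply/andP; split; apply/eqP; ring.
rewrite -!bmfun_RintegralZ// -!bmfun_RintegralD//; try exact: bZ.
by congr (_ +i* _)%C; apply: eq_Rintegral => x _; case: (F x) => p q /=; ring.
Qed.

Lemma cE_sum (I : Type) (l : seq I) (F : I -> T -> R[i]) :
  (forall i, cbmfun (F i)) ->
  cE mu (fun x => \sum_(i <- l) F i x) = \sum_(i <- l) cE mu (F i).
Proof.
move=> bF.
elim: l => [|i l IH].
  rewrite big_nil /cE.
  have z : \int[mu]_x (0 : R) = 0 by rewrite /Rintegral integral0.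
  rewrite -[RHS]/(0 +i* 0)%C -[in RHS]z.
  by congr (_ +i* _)%C; apply: eq_Rintegral => x _; rewrite big_nil.
by under eq_fun do rewrite big_cons; rewrite cED ?IH ?big_cons//; exact: cbmfun_sum.
Qed.

Lemma cE_ae_eq F G D : cbmfun F -> cbmfun G -> measurable D -> mu (~` D) = 0%E ->
  {in D, F =1 G} -> cE mu F = cE mu G.
Proof.
move=> [F1 F2] [G1 G2] mD D0 FG.
have aux (f g : T -> R) : bmfun f -> bmfun g -> {in D, f =1 g} ->
    \int[mu]_x f x = \int[mu]_x g x.
  move=> bf bg fg; rewrite /Rintegral; congr fine; apply: ae_eq_integral => //.
  - by apply/measurable_EFinP; exact: bf.1.
  - by apply/measurable_EFinP; exact: bg.1.
  exists (~` D); split => //; first exact: measurableC.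
  by move=> x /= nfg Dx; apply: nfg => _; rewrite fg// inE.
by rewrite /cE; congr (_ +i* _)%C; apply: aux => // x Dx; rewrite FG.
Qed.

End complex_expectation.

Lemma cbmfun_comp d d' (S : measurableType d) (T : measurableType d')
    (R : realType) (Z : S -> T) (F : T -> R[i]) :
  measurable_fun setT Z -> cbmfun F -> cbmfun (fun x => F (Z x)).
Proof. by move=> mZ [F1 F2]; split; [exact: bmfun_comp mZ F1|exact: bmfun_comp mZ F2]. Qed.

Section complex_laws.
Context d d1 d2 (Omega : measurableType d) (T1 : measurableType d1)
  (T2 : measurableType d2) (R : realType) (P : probability Omega R).

Lemma cE_same_law (X Y : {mfun Omega >-> T1}) (F : T1 -> R[i]) :
  (forall A, measurable A -> P (X @^-1` A) = P (Y @^-1` A)) -> cbmfun F ->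
  cE P (fun w => F (X w)) = cE P (fun w => F (Y w)).
Proof.
move=> XY [b1 b2]; rewrite /cE.
by rewrite (same_law_Rintegral XY b1) (same_law_Rintegral XY b2).
Qed.

Lemma cE_indep (X : {mfun Omega >-> T1}) (Y : {mfun Omega >-> T2}) F G :
  independent_RV P X Y -> cbmfun F -> cbmfun G ->
  cE P (fun w => F (X w) * G (Y w)) =
  cE P (fun w => F (X w)) * cE P (fun w => G (Y w)).
Proof.
move=> XY [F1 F2] [G1 G2]; rewrite /cE.
rewrite -[RHS]/((_ - _) +i* (_ + _))%C.
rewrite -(indep_Rintegral XY F1 G1) -(indep_Rintegral XY F1 G2).
rewrite -(indep_Rintegral XY F2 G1) -(indep_Rintegral XY F2 G2).
have b (f : T1 -> R) (g : T2 -> R) : bmfun f -> bmfun g -> bmfun (fun w => f (X w) * g (Y w) : R).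
  by move=> bf bg; exact: bmfunM (bmfun_comp (@measurable_funPT _ _ _ _ X) bf)
    (bmfun_comp (@measurable_funPT _ _ _ _ Y) bg).
have Poo : (P setT < +oo)%E by rewrite probability_setT ltry.
congr (_ +i* _)%C.
  rewrite -mulN1r -(bmfun_RintegralZ Poo _ (b _ _ F2 G2)).
  rewrite -(bmfun_RintegralD Poo); [|exact: b F1 G1|].
    apply: eq_Rintegral => w _; case: (F _) => ? ?; case: (G _) => ? ? /=; ring.
  exact: bmfunM (bmfun_cst _ _) (b _ _ F2 G2).
rewrite -(bmfun_RintegralD Poo); [|exact: b F1 G2|exact: b F2 G1].
by apply: eq_Rintegral => w _; case: (F _) => ? ?; case: (G _).
Qed.

End complex_laws.

(** * Conditional characteristic functions *)

Section conditional_char.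
Context d (Omega : measurableType d) (R : realType) (n : nat).
Variables (P : probability Omega R) (E : set Omega) (V : Omega -> 'rV[R]_n).
Hypotheses (mE : measurable E) (mV : measurable_fun setT V) (PE : (0 < P E)%E).

Definition cond_char (u : 'rV[R]_n) : R[i] :=
  cE P (phase E (fun w => dotrV (V w) u)) / (fine (P E))%:C%C.

Let Poo : (P setT < +oo)%E. Proof. by rewrite probability_setT ltry. Qed.
Let p := fine (P E).
Let p0 : 0 < p.
Proof. by rewrite fine_gt0// PE/= ltey_eq fin_num_measure. Qed.

Let mth u : measurable_fun setT (fun w => dotrV (V w) u).
Proof. exact: measurableT_comp (measurable_dotrV u) mV. Qed.

Let I (f : Omega -> R) := \int[P]_w f w.
Let c u (w : Omega) : R := \1_E w * cos (dotrV (V w) u).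
Let s u (w : Omega) : R := \1_E w * sin (dotrV (V w) u).
Let C u := I (c u).
Let S u := I (s u).
Let b1 : bmfun (\1_E : Omega -> R). Proof. exact: bmfun_indic. Qed.
Let bc u : bmfun (c u). Proof. exact: bmfunM b1 (bmfun_cos (mth u)). Qed.
Let bs u : bmfun (s u). Proof. exact: bmfunM b1 (bmfun_sin (mth u)). Qed.
Let bZ a (f : Omega -> R) : bmfun f -> bmfun (fun w => a * f w : R).
Proof. exact: bmfunM (bmfun_cst _ _). Qed.

Let ID (f g : Omega -> R) : bmfun f -> bmfun g -> I (fun w => f w + g w) = I f + I g.
Proof. exact: bmfun_RintegralD. Qed.
Let IZ a (f : Omega -> R) : bmfun f -> I (fun w => a * f w) = a * I f.
Proof. exact: bmfun_RintegralZ. Qed.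
Let I1 : I \1_E = p. Proof. exact: Rintegral_indic. Qed.

Let charE u : cond_char u = ((C u / p) +i* (S u / p))%C.
Proof.
rewrite /cond_char /cE.
have -> : \int[P]_w Re (phase E (fun w => dotrV (V w) u) w) = C u.
  by apply: eq_Rintegral => w _; rewrite Re_phase.
have -> : \int[P]_w Im (phase E (fun w => dotrV (V w) u) w) = S u.
  by apply: eq_Rintegral => w _; rewrite Im_phase.
by rewrite -fmorphV/=; apply/eqP; rewrite eq_complex/=; apply/andP; split; apply/eqP; ring.
Qed.

Let sq1 w : (\1_E w : R) * \1_E w = \1_E w.
Proof. by rewrite indicE; case: (_ \in _); rewrite ?mulr1 ?mulr0. Qed.

Let cs_sq u w : c u w * c u w + s u w * s u w = \1_E w.
Proof.
rewrite /c /s; have := cos2Dsin2 (dotrV (V w) u); set x := cos _; set y := sin _.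
move=> xy; transitivity ((\1_E w * \1_E w) * (x ^+ 2 + y ^+ 2)); first by ring.
by rewrite xy mulr1 sq1.
Qed.

(** The second moment of the deviation of [e^(i u.V)] from its mean on [E],
scaled by the mass [p] of [E]. *)
Let variance u : I (fun w => (C u * \1_E w - p * c u w) ^+ 2 +
   (S u * \1_E w - p * s u w) ^+ 2) = p * (p ^+ 2 - (C u ^+ 2 + S u ^+ 2)).
Proof.
have -> : (fun w => (C u * \1_E w - p * c u w) ^+ 2 + (S u * \1_E w - p * s u w) ^+ 2)
  = (fun w => (C u ^+ 2 + S u ^+ 2 + p ^+ 2) * \1_E w +
     (- (2 * p * C u) * c u w + - (2 * p * S u) * s u w)).
  apply/funext => w; have e1 := cs_sq u w; have e2 := sq1 w.
  have e3 : \1_E w * c u w = c u w by rewrite /c mulrA sq1.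
  have e4 : \1_E w * s u w = s u w by rewrite /s mulrA sq1.
  transitivity ((C u ^+ 2 + S u ^+ 2) * (\1_E w * \1_E w) +
    p ^+ 2 * (c u w * c u w + s u w * s u w) +
    (- (2 * p * C u) * (\1_E w * c u w) + - (2 * p * S u) * (\1_E w * s u w))).
    by ring.
  by rewrite e1 e2 e3 e4; ring.
rewrite !ID ?IZ ?I1//; try exact: bZ; last exact: bmfunD (bZ _ (bc u)) (bZ _ (bs u)).
by rewrite -/(C u) -/(S u); ring.
Qed.

(** By Cauchy-Schwarz, in the form of a polynomial in [t] that stays
non-negative. *)
Let null_mul (f g : Omega -> R) : bmfun f -> bmfun g -> I (fun w => f w ^+ 2) = 0 ->
  I (fun w => g w * f w) = 0.
Proof.
move=> bf bg f0; apply/eqP/negPn/negP => gf0.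
have bfg := bmfunM bg bf; have bff := bmfunM bf bf; have bgg := bmfunM bg bg.
set x := I (fun w => g w * f w) in gf0; pose y := I (fun w => g w * g w).
have key t : 0 <= y + 2 * t * x.
  have : 0 <= I (fun w => (g w + t * f w) ^+ 2).
    by apply: Rintegral_ge0 => w _; exact: sqr_ge0.
  have -> : (fun w => (g w + t * f w) ^+ 2) = (fun w => g w * g w +
      (2 * t * (g w * f w) + t ^+ 2 * (f w * f w))).
    by apply/funext => w; ring.
  rewrite !ID ?IZ//; try exact: bZ; last exact: bmfunD (bZ _ bfg) (bZ _ bff).
  have -> : I (fun w => f w * f w) = 0.
    by rewrite -f0; congr I; apply/funext => w; rewrite expr2.
  by rewrite mulr0 addr0.
have := key (- (y + 1) / (2 * x)).
suff -> : y + 2 * (- (y + 1) / (2 * x)) * x = - 1 by rewrite oppr_ge0 ler10.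
by field.
Qed.

Let modulus_le u : C u ^+ 2 + S u ^+ 2 <= p ^+ 2.
Proof.
have : 0 <= p * (p ^+ 2 - (C u ^+ 2 + S u ^+ 2)).
  by rewrite -variance; apply: Rintegral_ge0 => w _; rewrite addr_ge0// sqr_ge0.
by rewrite pmulr_rge0// subr_ge0.
Qed.

(** Modulus one at [v] means that the variance vanishes, so [e^(i v.V)] is almost
surely constant on [E] and factors out of expectations. *)
Let unimod_mul v u : C v ^+ 2 + S v ^+ 2 = p ^+ 2 ->
  p * C (u + v) = C u * C v - S u * S v /\ p * S (u + v) = C u * S v + S u * C v.
Proof.
move=> e.
pose f w := C v * \1_E w - p * c v w; pose g w := S v * \1_E w - p * s v w.
have bN (f' : Omega -> R) : bmfun f' -> bmfun (fun w => - f' w).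
  by move=> bf'; have := bZ (-1) bf'; under eq_fun do rewrite mulN1r.
have bf : bmfun f by exact: bmfunD (bZ _ b1) (bN _ (bZ _ (bc v))).
have bg : bmfun g by exact: bmfunD (bZ _ b1) (bN _ (bZ _ (bs v))).
have fg0 : I (fun w => f w ^+ 2) + I (fun w => g w ^+ 2) = 0.
  have := variance v; rewrite e subrr mulr0.
  by rewrite -(ID (bmfunM bf bf) (bmfunM bg bg)).
have f0 : 0 <= I (fun w => f w ^+ 2) by apply: Rintegral_ge0 => w _; exact: sqr_ge0.
have g0 : 0 <= I (fun w => g w ^+ 2) by apply: Rintegral_ge0 => w _; exact: sqr_ge0.
have {}f0 : I (fun w => f w ^+ 2) = 0 by lra.
have {}g0 : I (fun w => g w ^+ 2) = 0 by lra.
have N h : bmfun h -> I (fun w => h w * f w) = 0 /\ I (fun w => h w * g w) = 0.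
  by move=> bh; split; exact: null_mul.
have e3 u' w : \1_E w * c u' w = c u' w by rewrite /c mulrA sq1.
have e4 u' w : \1_E w * s u' w = s u' w by rewrite /s mulrA sq1.
have cD w : c (u + v) w = c u w * c v w - s u w * s v w.
  rewrite /c /s dotrVDr cosD; set x := cos _; set y := cos _; set z := sin _; set t := sin _.
  transitivity ((\1_E w * \1_E w) * (x * y - z * t)); last by ring.
  by rewrite sq1.
have sD w : s (u + v) w = s u w * c v w + c u w * s v w.
  rewrite /c /s dotrVDr sinD; set x := cos _; set y := cos _; set z := sin _; set t := sin _.
  transitivity ((\1_E w * \1_E w) * (z * x + y * t)); last by ring.
  by rewrite sq1.
have [cf cg] := N _ (bc u); have [sf sg] := N _ (bs u).
have I4 k1 k2 k3 k4 a b : bmfun k1 -> bmfun k2 -> bmfun k3 -> bmfun k4 ->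
    I k3 = 0 -> I k4 = 0 ->
    I (fun w => a * k1 w + (b * k2 w + (-1 * k3 w + 1 * k4 w))) = a * I k1 + b * I k2.
  move=> B1 B2 B3 B4 i3 i4.
  have B34 := bmfunD (bZ (-1) B3) (bZ 1 B4).
  by rewrite !ID ?IZ ?i3 ?i4//; try exact: bZ; [ring|exact: bmfunD (bZ _ B2) B34].
split.
- rewrite -[LHS](IZ p (bc (u + v))).
  have -> : (fun w => p * c (u + v) w) = (fun w => C v * c u w + (- S v * s u w +
     (-1 * (c u w * f w) + 1 * (s u w * g w)))).
    apply/funext => w; rewrite cD /f /g.
    have h3 : C v * (\1_E w * c u w) = C v * c u w by rewrite e3.
    have h4 : S v * (\1_E w * s u w) = S v * s u w by rewrite e4.
    lra.
  rewrite (I4 _ _ _ _ (C v) (- S v) (bc u) (bs u) (bmfunM (bc u) bf) (bmfunM (bs u) bg) cf sg).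
  rewrite -/(C u) -/(S u). ring.
- rewrite -[LHS](IZ p (bs (u + v))).
  have -> : (fun w => p * s (u + v) w) = (fun w => C v * s u w + (S v * c u w +
     (-1 * (s u w * f w) + 1 * (- 1 * (c u w * g w))))).
    apply/funext => w; rewrite sD /f /g.
    have h3 : S v * (\1_E w * c u w) = S v * c u w by rewrite e3.
    have h4 : C v * (\1_E w * s u w) = C v * s u w by rewrite e4.
    lra.
  have cg' : I (fun w => - 1 * (c u w * g w)) = 0.
    by rewrite (IZ _ (bmfunM (bc u) bg)) cg mulr0.
  rewrite (I4 _ _ _ _ (C v) (S v) (bs u) (bc u) (bmfunM (bs u) bf) (bZ _ (bmfunM (bc u) bg)) sf cg').
  by rewrite -/(C u) -/(S u); ring.
Qed.

Let cvg_at0 (h : R -> Omega -> R) (l : Omega -> R) (x : 'rV[R]_n) :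
  (forall t w, `|h t w| <= 1) -> (forall t, bmfun (h t)) ->
  (forall w, h t w @[t --> (0 : R)] --> l w) ->
  I (h t) @[t --> (0 : R)] --> I l.
Proof.
move=> h1 bh hl; apply/(@cvg_nbhsP _ R^o) => t t0.
apply: (bmfun_Rintegral_cvg Poo (fun k => (bh (t k)).1) (fun k => h1 (t k)) _).2.
by move=> w; move/(@cvg_nbhsP _ R^o): (hl w); apply.
Qed.

Lemma charlike_cond_char : charlike cond_char.
Proof.
have ind_le1 w : `|\1_E w : R| <= 1.
  by rewrite indicE; case: (_ \in _); rewrite ?normr1 ?normr0.
have pn0 : p != 0 by rewrite gt_eqF.
have dot0 w : dotrV (V w) 0 = 0 by rewrite -(scale0r 0) dotrVZr mul0r.
have C0 : C 0 = p.
  by rewrite -I1; apply: eq_Rintegral => w _; rewrite /c dot0 cos0 mulr1.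
have S0 : S 0 = 0.
  rewrite -[RHS](mul0r (I \1_E)) -IZ//; apply: eq_Rintegral => w _.
  by rewrite /s dot0 sin0 mulr0 mul0r.
split.
- by rewrite charE C0 S0 divff// mul0r.
- move=> u; rewrite !charE; apply/eqP; rewrite eq_complex/=.
  have -> : C (- u) = C u.
    by apply: eq_Rintegral => w _; rewrite /c dotrVNr cosN.
  have -> : S (- u) = - S u.
    rewrite -mulN1r -IZ//; apply: eq_Rintegral => w _.
    by rewrite /s dotrVNr sinN mulrN mulN1r.
  by rewrite mulNr !eqxx.
- move=> u; rewrite charE -(@expr_le1 _ 2)// -add_Re2_Im2/=.
  rewrite lecE/= eqxx/= !expr_div_n -mulrDl ler_pdivrMr ?exprn_gt0// mul1r.
  exact: modulus_le.
- move=> u v /eqP; rewrite charE norm_complex1/= !expr_div_n -mulrDl => /eqP e.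
  have {}e : C v ^+ 2 + S v ^+ 2 = p ^+ 2.
    by rewrite -[RHS]mul1r -e divfK// expf_neq0.
  have [e1 e2] := unimod_mul u e.
  rewrite !charE; apply/eqP; rewrite eq_complex/=; apply/andP; split; apply/eqP.
    apply: (mulfI pn0); transitivity (p * C (u + v) / p); first by ring.
    by rewrite e1; field.
  apply: (mulfI pn0); transitivity (p * S (u + v) / p); first by ring.
  by rewrite e2; field.
- move=> x; rewrite (_ : (fun t : R => _) = (fun t => C (t *: x) / p)); last first.
    by apply/funext => t; rewrite charE.
  rewrite -[X in _ --> X](divff pn0); apply: cvgM; last exact: cvg_cst.
  rewrite -I1; apply: cvg_at0 => // [t w|w]; rewrite ?/c ?/s.
    by rewrite normrM mulr_ile1// ?ind_le1// ler_norml cos_geN1 cos_le1.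
  rewrite -[X in _ --> X]mulr1; apply: cvgM; first exact: cvg_cst.
  rewrite (_ : (fun t : R => _) = (fun t => cos (t * dotrV (V w) x))); last first.
    by apply/funext => t; rewrite dotrVZr.
  rewrite -[X in _ --> X]cos0 -[in X in _ --> X](mul0r (dotrV (V w) x)).
  by apply: continuous_cvg; [exact: continuous_cos|apply: cvgM; [exact: cvg_id|exact: cvg_cst]].
- move=> x; rewrite (_ : (fun t : R => _) = (fun t => S (t *: x) / p)); last first.
    by apply/funext => t; rewrite charE.
  rewrite -[X in _ --> X](mul0r p^-1); apply: cvgM; last exact: cvg_cst.
  have i0 : I (fun=> 0) = 0 by rewrite -[RHS](mul0r (I \1_E)) -IZ//; apply: eq_Rintegral => w _; rewrite mul0r.
  rewrite -[X in _ --> X]i0; apply: cvg_at0 => // [t w|w]; rewrite ?/c ?/s.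
    by rewrite normrM mulr_ile1// ?ind_le1// ler_norml sin_geN1 sin_le1.
  rewrite -[X in _ --> X](mulr0 (\1_E w)); apply: cvgM; first exact: cvg_cst.
  rewrite (_ : (fun t : R => _) = (fun t => sin (t * dotrV (V w) x))); last first.
    by apply/funext => t; rewrite dotrVZr.
  rewrite -[X in _ --> X]sin0 -[in X in _ --> X](mul0r (dotrV (V w) x)).
  by apply: continuous_cvg; [exact: continuous_sin|apply: cvgM; [exact: cvg_id|exact: cvg_cst]].
Qed.

End conditional_char.

(** * Atoms of a law on a countable group *)

Section finite_injection.
Variable T : eqType.

Lemma uniq_inj_surj (l1 l2 : seq T) (f : T -> T) :
  uniq l1 -> {in l1 &, injective f} -> {in l1, forall x, f x \in l2} ->
  (size l2 <= size l1)%N -> uniq l2 -> {in l2, forall y, exists2 x, x \in l1 & f x = y}.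
Proof.
move=> u1 fi fl s u2 y yl2.
have um : uniq (map f l1) by rewrite map_inj_in_uniq.
have sub : {subset map f l1 <= l2} by move=> _ /mapP[x xl ->]; exact: fl.
have [_ e] := uniq_min_size um sub ltac:(by rewrite size_map).
by have := e y; rewrite yl2 => /mapP[x xl ->]; exists x.
Qed.

Lemma seq_argmax (R : realDomainType) (f : T -> R) (l : seq T) x1 : x1 \in l ->
  exists2 x0, x0 \in l & forall x, x \in l -> f x <= f x0.
Proof.
elim: l x1 => // x l IH x1 _; case: l IH => [_|y l IH].
  by exists x; [exact: mem_head|move=> z; rewrite inE => /eqP ->].
have [x0 x0l xm] := IH _ (mem_head _ _).
have [h|h] := leP (f x) (f x0).
  exists x0; first by rewrite inE x0l orbT.
  by move=> z; rewrite inE => /predU1P[->//|]; exact: xm.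
exists x; first exact: mem_head.
by move=> z; rewrite inE => /predU1P[->//|/xm zx0]; exact: le_trans (ltW h).
Qed.

End finite_injection.

Section discrete_laws.
Context d (Omega : measurableType d) (R : realType) (P : probability Omega R).
Variable G : countZmodType.
Local Notation D := (discrete_group G).

Lemma discrete_measurable_all (A : set D) : measurable A.
Proof. by []. Qed.

Lemma measurable_preimage_D (k : {mfun Omega >-> D}) A : measurable (k @^-1` A).
Proof. by rewrite -[X in measurable X]setTI; exact: measurable_funPT. Qed.

Definition pmfD (k : {mfun Omega >-> D}) x : R := fine (P (k @^-1` [set x])).

Lemma pmfDE (k : {mfun Omega >-> D}) x : P (k @^-1` [set x]) = (pmfD k x)%:E.
Proof. by rewrite fineK// fin_num_measure//; exact: measurable_preimage_D. Qed.

Lemma pmfD_ge0 (k : {mfun Omega >-> D}) x : 0 <= pmfD k x.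
Proof. by rewrite fine_ge0. Qed.

Lemma pmfD_seq (k : {mfun Omega >-> D}) (l : seq D) : uniq l ->
  P (k @^-1` [set` l]) = (\sum_(x <- l) pmfD k x)%:E.
Proof.
elim: l => [_|x l IH /= /andP[xl ul]].
  by rewrite big_nil (_ : _ @^-1` _ = set0) ?measure0//; apply/seteqP; split.
rewrite big_cons EFinD -IH// -pmfDE -measureU//; try exact: measurable_preimage_D.
- congr (P _); apply/seteqP; split => w /=; rewrite inE.
    by case/predU1P; [left|right].
  by case=> [->|->]; rewrite ?eqxx// orbT.
- by apply/seteqP; split => w //= [-> h]; rewrite h in xl.
Qed.

(** A countable union of null events. *)
Lemma null_outside_support (k : {mfun Omega >-> D}) :
  P (k @^-1` [set x | ~ (0 < pmfD k x)]) = 0%E.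
Proof.
apply: measure_negligible; first exact: measurable_preimage_D.
pose F i := k @^-1` [set x | ~ (0 < pmfD k x) /\ pickle x = i].
have -> : k @^-1` [set x | ~ 0 < pmfD k x] = \bigcup_i F i.
  by apply/seteqP; split => w /=; [move=> h; exists (pickle (k w))|case=> i _ []].
apply: negligible_bigcup => i; exists (F i); split => //.
  exact: measurable_preimage_D.
have [[w [h wi]]|] := pselect (F i !=set0); last first.
  by move/set0P/negP/negPn/eqP => ->.
apply/eqP; rewrite -measure_le0 (_ : 0%E = P (k @^-1` [set k w])); last first.
  rewrite pmfDE; congr EFin; apply/eqP; rewrite eq_le pmfD_ge0/=.
  by rewrite leNgt; apply/negP.
apply: le_measure; rewrite ?inE; try exact: measurable_preimage_D.
by move=> v [_ vi]; apply: (pcan_inj pickleK); rewrite vi.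
Qed.

Lemma ex_support (k : {mfun Omega >-> D}) : exists x, 0 < pmfD k x.
Proof.
apply: contrapT => h; have := null_outside_support k.
rewrite (_ : _ @^-1` _ = setT) ?probability_setT; first by case=> /eqP; rewrite oner_eq0.
by apply/seteqP; split => // w _ /= kw; apply: h; exists (k w).
Qed.

(** There are at most [1 / m] atoms of mass at least [m]. *)
Lemma pmfD_level_finite (k : {mfun Omega >-> D}) m : 0 < m ->
  exists2 l : seq D, uniq l & forall x, (x \in l) = (m <= pmfD k x).
Proof.
move=> m0; have fin : finite_set [set x | m <= pmfD k x].
  apply: contrapT => /(infinite_set_fset (Num.truncn m^-1).+1)[B sB szB].
  have := @probability_le1 _ _ _ P (k @^-1` [set` finmap.enum_fset B]) (measurable_preimage_D _ _).
  rewrite pmfD_seq ?finmap.fset_uniq// lee_fin leNgt => /negP[].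
  apply: (@lt_le_trans _ _ (\sum_(x <- finmap.enum_fset B) m)).
    rewrite big_const_seq count_predT iter_addr_0 -mulr_natr.
    rewrite -ltr_pdivrMl// mulr1.
    apply: (@lt_le_trans _ _ (Num.truncn m^-1).+1%:R); first exact: truncnS_gt.
    by rewrite ler_nat.
  rewrite big_seq [leRHS]big_seq; apply: ler_sum => x xB; exact: sB.
move/finite_seqP: fin => [l lE]; exists (undup l); first exact: undup_uniq.
move=> x; rewrite mem_undup; apply/idP/idP => [xl|xm].
  by have : [set` l] x by []; rewrite -lE.
by have : [set x | m <= pmfD k x] x by []; rewrite lE.
Qed.

Lemma ex_max_atom (k : {mfun Omega >-> D}) :
  exists2 x0, 0 < pmfD k x0 & forall x, pmfD k x <= pmfD k x0.
Proof.
have [x1 p1] := ex_support k.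
have [l _ lE] := pmfD_level_finite k p1.
have x1l : x1 \in l by rewrite lE.
have [x0 x0l xm] := seq_argmax (pmfD k) x1l.
have x01 := xm _ x1l; exists x0; first exact: lt_le_trans x01.
move=> x; have [/ltW x1x|xx1] := ltP (pmfD k x1) (pmfD k x).
  by apply: xm; rewrite lE.
exact: le_trans x01.
Qed.

End discrete_laws.

(** * Extremal atoms of a sum *)

Section mixture.
Context d (Omega : measurableType d) (R : realType) (P : probability Omega R).
Variable G : countZmodType.
Local Notation D := (discrete_group G).
Variables (X Y : {mfun Omega >-> D}) (F H : D -> D) (c : D) (m : R).
Hypotheses (XY : independent_RV P X Y) (Finj : injective F).
Hypothesis Xm : forall x, pmfD P X x <= m.

Let fiber_le (z : D) : (P [set w | (F (X w) = z)%R] <= m%:E)%E.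
Proof.
have [[x Fx]|nx] := pselect (exists x, F x = z).
  rewrite (_ : [set _ | _] = X @^-1` [set x]).
    by rewrite (pmfDE P) lee_fin.
  by apply/seteqP; split => w /=; [rewrite -Fx => /Finj|move=> ->].
rewrite (_ : [set _ | _] = set0) ?measure0 ?lee_fin.
  by apply: le_trans (Xm 0); exact: pmfD_ge0.
by apply/seteqP; split => // w /= Fz; apply: nx; exists (X w).
Qed.

(** Conditionally on [Y = y], the event says that [X] is the one point which [F]
sends to [c - H y]. *)
Lemma mixture_le (B : set D) :
  (P [set w | (F (X w) + H (Y w) = c)%R /\ B (Y w)] <= m%:E * P (Y @^-1` B))%E.
Proof.
have YX : independent_RV P Y X.
  by move=> A A' mA mA'; rewrite setIC muleC; exact: XY.
pose A : set (D * D) := [set z | F z.2 + H z.1 = c /\ B z.1].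
have := indep_law YX (measurable_discrete_group2 A).
rewrite (_ : _ @^-1` A = [set w | F (X w) + H (Y w) = c /\ B (Y w)])//.
move=> ->; rewrite /product_measure1/=.
have -> : (m%:E * P (Y @^-1` B) = \int[distribution P Y]_y (m%:E * (\1_B y)%:E))%E.
  rewrite ge0_integralZl//=.
  - by rewrite integral_indic// setIT.
  - by rewrite lee_fin; apply: le_trans (Xm 0); exact: pmfD_ge0.
apply: ge0_le_integral => //.
move=> y _ /=; rewrite indicE; case: (boolP (y \in B)) => yB.
  rewrite mule1; apply: le_trans (fiber_le (c - H y)).
  change (P (X @^-1` xsection A y) <= P [set w | (F (X w) = c - H y)%R])%E.
  apply: le_measure; rewrite ?inE; try exact: (measurable_preimage_D X).
    exact: (measurable_preimage_D X [set x | F x = c - H y]).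
  by move=> w /=; rewrite /xsection/= inE => -[<- _]; rewrite addrK.
rewrite mule0 (_ : distribution P X _ = 0%E)//.
rewrite (_ : xsection A y = set0) ?measure0//.
by apply/seteqP; split => // x; rewrite /xsection/= inE => -[_ By]; move: yB; rewrite mem_set.
Qed.

(** An atom of the sum of mass [m] is an average of atoms of [X] that are at most
[m], so each [y] of positive mass contributes an atom of mass exactly [m]. *)
Lemma mixture_max (y : D) : 0 < m ->
  (m%:E <= P [set w | (F (X w) + H (Y w) = c)%R])%E -> 0 < pmfD P Y y ->
  exists2 x, F x + H y = c & pmfD P X x = m.
Proof.
move=> m0 mP py.
pose Ev (B : set D) := [set w | F (X w) + H (Y w) = c /\ B (Y w)].
have mEv B : measurable (Ev B).
  pose A : set (D * D) := [set z | F z.1 + H z.2 = c /\ B z.2].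
  have := measurable_pairRV X Y measurableT (measurable_discrete_group2 A).
  by rewrite setTI.
have : (m%:E <= P [set w | (F (X w) = c - H y)%R])%E.
  have e : [set w | F (X w) + H (Y w) = c] = Ev [set y] `|` Ev (~` [set y]).
    apply/seteqP; split => w; rewrite /Ev/=; last by case=> -[].
    by move=> Fw; have [|] := pselect (Y w = y); [left|right].
  have eD : P (Ev [set y]) = (P [set w | (F (X w) = c - H y)%R] * (pmfD P Y y)%:E)%E.
    rewrite -pmfDE.
    have <- := XY (discrete_measurable_all (F @^-1` [set c - H y])) (discrete_measurable_all [set y]).
    congr (P _); apply/seteqP; split => w; rewrite /Ev/=.
      by case=> <- ->; rewrite addrK.
    by case=> -> ->; rewrite subrK.
  have m2 : (P (Ev (~` [set y])) <= m%:E * P (Y @^-1` (~` [set y])))%E := mixture_le _.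
  have U : (P (Ev [set y] `|` Ev (~` [set y])) =
      P (Ev [set y]) + P (Ev (~` [set y])))%E.
    by rewrite measureU//; apply/seteqP; split => w //= -[[_ yw] [_]].
  move: mP; rewrite e U eD.
  have mF : measurable [set w | F (X w) = c - H y].
    exact: (measurable_preimage_D X [set x | F x = c - H y]).
  have cY : P (Y @^-1` (~` [set y])) = (1 - pmfD P Y y)%:E.
    rewrite -preimage_setC probability_setC ?pmfDE ?EFinB//.
    exact: measurable_preimage_D.
  move: m2; rewrite cY -EFinM => m2 mP.
  have {m2}mP := le_trans mP (leeD2l _ m2).
  move: mP; rewrite -(fineK (fin_num_measure P _ mF)) -EFinM -EFinD !lee_fin => mP.
  by rewrite -(ler_pM2r py); lra.
move=> Fm.
have [x xP] : exists x, F x = c - H y.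
  apply: contrapT => nx; move: Fm; rewrite (_ : [set _ | _] = set0) ?measure0.
    by rewrite lee_fin leNgt m0.
  by apply/seteqP; split => // w /= Fz; apply: nx; exists (X w).
exists x; first by rewrite xP subrK.
apply/eqP; rewrite eq_le Xm/= -lee_fin -pmfDE; apply: le_trans Fm _.
apply: le_measure; rewrite ?inE; try exact: measurable_preimage_D.
  exact: (measurable_preimage_D X [set x | F x = c - H y]).
by move=> w /=; rewrite -xP => /Finj.
Qed.

End mixture.

(** * The discrete component *)

Section heyde_discrete.
Context d (Omega : measurableType d) (R : realType) (P : probability Omega R).
Variable G : countZmodType.
Local Notation D := (discrete_group G).
Variables (beta : D -> D) (k1 k2 : {mfun Omega >-> D}).
Hypotheses (betaD : {morph beta : x y / x + y}).
Hypotheses (two_inj : forall g : D, g + g = 0 -> g = 0)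
  (beta_inj : forall g, beta g = 0 -> g = 0)
  (beta1_inj : forall g, g + beta g = 0 -> g = 0).
Hypothesis k12 : independent_RV P k1 k2.
Hypothesis sym : forall A : set (D * D),
  P [set w | A (k1 w + k2 w, k1 w + beta (k2 w))] =
  P [set w | A (k1 w + k2 w, - (k1 w + beta (k2 w)))].

Let p1 := pmfD P k1.
Let p2 := pmfD P k2.

Let beta0 : beta 0 = 0.
Proof. by apply: (addrI (beta 0)); rewrite -betaD !addr0. Qed.
Let betaN x : beta (- x) = - beta x.
Proof. by apply/eqP; rewrite -addr_eq0 -betaD addNr beta0. Qed.
Let betaB x y : beta (x - y) = beta x - beta y.
Proof. by rewrite betaD betaN. Qed.

Let two_injective : injective (fun x : D => x + x).
Proof.
move=> x y /= h; apply/subr0_eq/two_inj.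
by apply: (eq_of_subr h); zmodule.
Qed.
Let beta_injective : injective beta.
Proof. by move=> x y h; apply/subr0_eq/beta_inj; rewrite betaB h subrr. Qed.
Let beta1_injective : injective (fun x => x + beta x).
Proof.
move=> x y /= h; apply/subr0_eq/beta1_inj; rewrite betaB.
by apply: (eq_of_subr h); zmodule.
Qed.

(** Symmetry applied to [L1 - L2]. *)
Let sym_diff2 c : P [set w | k2 w - beta (k2 w) = c] =
  P [set w | ((k1 w + k1 w) + (k2 w + beta (k2 w)) = c)%R].
Proof.
have := sym [set z | z.1 - z.2 = c].
rewrite (_ : [set w | _] = [set w | k2 w - beta (k2 w) = c]); last first.
  apply/seteqP; split=> w /= <-; zmodule.
move=> ->; congr (P _); apply/seteqP; split=> w /= <-; zmodule.
Qed.

(** Symmetry applied to [beta L1 - L2]. *)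
Let sym_diff1 c : P [set w | beta (k1 w) - k1 w = c] =
  P [set w | ((beta (k2 w) + beta (k2 w)) + (k1 w + beta (k1 w)) = c)%R].
Proof.
have := sym [set z | beta z.1 - z.2 = c].
rewrite (_ : [set w | _] = [set w | beta (k1 w) - k1 w = c]); last first.
  apply/seteqP; split=> w /= <-; rewrite betaD; zmodule.
move=> ->; congr (P _); apply/seteqP; split=> w /= <-; rewrite betaD; zmodule.
Qed.

Let p_le (k : {mfun Omega >-> D}) (F : D -> D) x :
  ((pmfD P k x)%:E <= P [set w | F (k w) = F x])%E.
Proof.
rewrite -pmfDE; apply: le_measure; rewrite ?inE; try exact: measurable_preimage_D.
  exact: (measurable_preimage_D k [set y | F y = F x]).
by move=> w /= ->.
Qed.

Let k21 : independent_RV P k2 k1.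
Proof. by move=> A A' mA mA'; rewrite setIC muleC; exact: k12. Qed.

(** Each atom of [(1 - beta) k2] is an atom of [2 k1 + (1 + beta) k2], at most
the largest atom of [k1]; with the other symmetry this makes the largest atoms
equal.  The equality case assigns to every [y] of positive mass, injectively, a
maximal atom of [k1], and conversely; by counting, all atoms are maximal. *)
Lemma support_structure : exists m : R, exists2 l : seq D * seq D, 0 < m &
  [/\ uniq l.1, uniq l.2 & size l.1 = size l.2] /\
  [/\ (forall x, p1 x = if x \in l.1 then m else 0),
     (forall x, p2 x = if x \in l.2 then m else 0),
     {in l.2 &, injective (fun y => y - beta y)} &
       forall y0 y, y0 \in l.2 -> y \in l.2 ->
         exists2 x, x \in l.1 & (x + x) + (y + beta y) = y0 - beta y0].
Proof.
have [a1 a1p a1m] := ex_max_atom P k1.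
have [a2 a2p a2m] := ex_max_atom P k2.
pose m1 := p1 a1; pose m2 := p2 a2.
have F2 : injective (fun x : D => beta x + beta x).
  by move=> x y /= /two_injective/beta_injective.
have le1 (c : D) : (P [set w | (k2 w - beta (k2 w) = c)%R] <= m1%:E)%E.
  rewrite sym_diff2.
  have := mixture_le (fun y => y + beta y) c k12 two_injective a1m setT.
  rewrite preimage_setT probability_setT mule1; apply: le_trans.
  rewrite (_ : [set w | _ /\ _] = [set w | k1 w + k1 w + (k2 w + beta (k2 w)) = c])//.
  by apply/seteqP; split => w /=; [case|].
have le2 (c : D) : (P [set w | (beta (k1 w) - k1 w = c)%R] <= m2%:E)%E.
  rewrite sym_diff1.
  have := mixture_le (fun y => y + beta y) c k21 F2 a2m setT.
  rewrite preimage_setT probability_setT mule1; apply: le_trans.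
  rewrite (_ : [set w | _ /\ _] = [set w | beta (k2 w) + beta (k2 w) + (k1 w + beta (k1 w)) = c])//.
  by apply/seteqP; split => w /=; [case|].
have m12 : m1 = m2.
  apply/eqP; rewrite eq_le; apply/andP; split; rewrite -lee_fin.
    exact: le_trans (p_le k1 (fun x => beta x - x) a1) (le2 _).
  exact: le_trans (p_le k2 (fun x => x - beta x) a2) (le1 _).
have t1 y0 y : p2 y0 = m2 -> 0 < p2 y ->
    exists2 x, (x + x) + (y + beta y) = y0 - beta y0 & p1 x = m1.
  move=> y0m yp; apply: (mixture_max k12 two_injective a1m (H := fun y => y + beta y)) => //.
  by rewrite -sym_diff2 (_ : pmfD P k1 a1 = p2 y0); [exact: (p_le k2 (fun x => x - beta x))|rewrite y0m].
have t2 x0 x : p1 x0 = m1 -> 0 < p1 x ->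
    exists2 y, (beta y + beta y) + (x + beta x) = beta x0 - x0 & p2 y = m2.
  move=> x0m xp; apply: (mixture_max k21 F2 a2m (H := fun y => y + beta y)) => //.
  by rewrite -sym_diff1 (_ : pmfD P k2 a2 = p1 x0); [exact: (p_le k1 (fun x => beta x - x))|rewrite x0m].
have m0 : 0 < m1 by [].
have m0' : 0 < m2 by [].
(* [l1] and [l2] list the maximal atoms; [f1] and [f2] are the injections
   between them given by the equality case. *)
have [l1 u1 l1P] := pmfD_level_finite P k1 m0.
have [l2 u2 l2P] := pmfD_level_finite P k2 m0'.
have l1m x : x \in l1 -> p1 x = m1.
  by rewrite l1P => h; apply/eqP; rewrite eq_le h andbT; exact: a1m.
have l2m x : x \in l2 -> p2 x = m2.
  by rewrite l2P => h; apply/eqP; rewrite eq_le h andbT; exact: a2m.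
have /choice[f1 f1P] : forall y : D, exists x : D, 0 < p2 y ->
    x + x + (y + beta y) = a2 - beta a2 /\ x \in l1.
  move=> y; have [yp|yp] := pselect (0 < p2 y); last by exists 0 => /yp.
  by have [x xE xm] := t1 a2 y erefl yp; exists x; rewrite l1P -/p1 xm.
have /choice[f2 f2P] : forall x : D, exists y : D, 0 < p1 x ->
    beta y + beta y + (x + beta x) = beta a1 - a1 /\ y \in l2.
  move=> x; have [xp|xp] := pselect (0 < p1 x); last by exists 0 => /xp.
  by have [y yE ym] := t2 a1 x erefl xp; exists y; rewrite l2P -/p2 ym.
have f1i y y' : 0 < p2 y -> 0 < p2 y' -> f1 y = f1 y' -> y = y'.
  move=> /f1P[e1 _] /f1P[e2 _] e; apply: beta1_injective.
  by move: e1; rewrite e -e2 => /addrI.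
have f2i x x' : 0 < p1 x -> 0 < p1 x' -> f2 x = f2 x' -> x = x'.
  move=> /f2P[e1 _] /f2P[e2 _] e; apply: beta1_injective.
  by move: e1; rewrite e -e2 => /addrI.
have pl1 x : x \in l1 -> 0 < p1 x by move=> /l1m ->.
have pl2 x : x \in l2 -> 0 < p2 x by move=> /l2m ->.
(* An atom of positive but not maximal mass would give an injection of a set
   with more elements than [l2] into [l2]. *)
have s2 y : 0 < p2 y -> y \in l2.
  move=> yp; apply: contraT => yl.
  have pos z : z \in y :: l2 -> 0 < p2 z by rewrite inE => /predU1P[->//|/pl2].
  have u : uniq (map (f2 \o f1) (y :: l2)).
    rewrite map_inj_in_uniq/= ?yl//.
    move=> z z' /pos zp /pos zp' /f2i e; apply: f1i => //; apply: e.
      by apply: pl1; have [] := f1P z zp.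
    by apply: pl1; have [] := f1P z' zp'.
  have : {subset map (f2 \o f1) (y :: l2) <= l2}.
    by move=> _ /mapP[z /pos zp ->]; have [_ /pl1/f2P[]] := f1P z zp.
  by move/(uniq_leq_size u); rewrite size_map /= ltnn.
have s1 x : 0 < p1 x -> x \in l1.
  move=> xp; apply: contraT => xl.
  have pos z : z \in x :: l1 -> 0 < p1 z by rewrite inE => /predU1P[->//|/pl1].
  have u : uniq (map (f1 \o f2) (x :: l1)).
    rewrite map_inj_in_uniq/= ?xl//.
    move=> z z' /pos zp /pos zp' /f1i e; apply: f2i => //; apply: e.
      by apply: pl2; have [] := f2P z zp.
    by apply: pl2; have [] := f2P z' zp'.
  have : {subset map (f1 \o f2) (x :: l1) <= l1}.
    by move=> _ /mapP[z /pos zp ->]; have [_ /pl2/f1P[]] := f2P z zp.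
  by move/(uniq_leq_size u); rewrite size_map /= ltnn.
have sz : size l1 = size l2.
  apply/eqP; rewrite eqn_leq; apply/andP; split.
    rewrite -(size_map f2); apply: uniq_leq_size.
      by rewrite map_inj_in_uniq// => x x' /pl1 xp /pl1 xp'; exact: f2i.
    by move=> _ /mapP[x /pl1 xp ->]; have [] := f2P x xp.
  rewrite -(size_map f1); apply: uniq_leq_size.
    by rewrite map_inj_in_uniq// => x x' /pl2 xp /pl2 xp'; exact: f1i.
  by move=> _ /mapP[x /pl2 xp ->]; have [] := f1P x xp.
exists m1, (l1, l2); first by [].
split; first by split.
split=> /=.
- move=> x; case: ifPn => [/l1m//|xl]; apply/eqP; rewrite eq_le pmfD_ge0 andbT leNgt.
  by apply: contra xl; exact: s1.
- move=> x; case: ifPn => [/l2m->//|xl]; apply/eqP; rewrite eq_le pmfD_ge0 andbT leNgt.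
  by apply: contra xl; exact: s2.
(* Two points with the same image would give [(1 - beta) k2] an atom of mass
   [2 m]. *)
- move=> y y' yl yl' /= e; apply: contraPP (le1 (y - beta y)) => yy'; apply/negP.
  rewrite -ltNge; apply: (@lt_le_trans _ _ (P (k2 @^-1` [set` [:: y; y']]))).
    rewrite pmfD_seq; last by rewrite /= inE andbT; apply/eqP.
    by rewrite !big_cons big_nil addr0 lte_fin -/p2 !l2m// -m12 ltrDl.
  apply: le_measure; rewrite ?inE; try exact: measurable_preimage_D.
    exact: (measurable_preimage_D k2 [set z | z - beta z = y - beta y]).
  by move=> w /=; rewrite !inE => /orP[/eqP ->|/eqP ->].
- move=> y0 y y0l yl; have [x xE xm] := t1 y0 y (l2m _ y0l) (pl2 _ yl).
  by exists x => //; rewrite l1P -/p1 xm.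
Qed.

(** By counting, in the relation [2 x + (1 + beta) y = (1 - beta) y'] on the
supports any two of the three points determine the third, which always exists.
Eliminating [y] and [y'] shows that the support of [k1] is stable under
[a - b + c], hence is a coset of a finite subgroup [K]; subtracting two such
relations expresses [y - y'] and [beta (y - y')] by elements of [K] for [y],
[y'] in the support of [k2].  The translate of the support of [k1] is fixed by
the symmetry, which sends pairs of support points to such pairs, and by the
absence of elements of order two in [K]. *)
Lemma coset_structure : exists (K : set D) (y1 : D) (m : R), 0 < m /\
  [/\ finite_subgroup K,
     (forall x, p1 x = if `[< K (x + beta y1) >] then m else 0),
     (forall y, p2 y = if `[< K (y - y1) >] then m else 0),
     (forall k, K k -> K (beta k)) &
     [/\ (forall y y', K (y - y1) -> K (y' - y1) ->
           y - beta y = y' - beta y' -> y = y') &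
       (forall x y, K (x + beta y1) -> K (y - y1) -> exists x' y',
         [/\ K (x' + beta y1), K (y' - y1), x' + y' = x + y &
           x' + beta y' = - (x + beta y)])]].
Proof.
have [m [[l1 l2] m0 [[/= u1 u2 sz] [p1E p2E inj T1]]]] := support_structure.
have pl1 x : (0 < p1 x) = (x \in l1).
  by rewrite p1E; case: ifP => _; rewrite ?ltxx.
have pl2 x : (0 < p2 x) = (x \in l2).
  by rewrite p2E; case: ifP => _; rewrite ?ltxx.
have [s0 s0l] : exists s0, s0 \in l1.
  by have [x xp] := ex_support P k1; exists x; rewrite -pl1.
have [y0 y0l] : exists y0, y0 \in l2.
  by have [x xp] := ex_support P k2; exists x; rewrite -pl2.
have T2 z x : z \in l2 -> x \in l1 ->
    exists2 y, y \in l2 & (x + x) + (y + beta y) = z - beta z.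
  move=> zl xl.
  have /choice[f fP] : forall y, exists x, y \in l2 ->
      x \in l1 /\ (x + x) + (y + beta y) = z - beta z.
    move=> y; have [yl|yl] := boolP (y \in l2); last by exists 0.
    by have [x' ? ?] := T1 z y zl yl; exists x'.
  have fi : {in l2 &, injective f}.
    move=> y y' yl y'l e; apply: beta1_injective.
    have [_ e1] := fP y yl; have [_ e2] := fP y' y'l.
    by move: e1; rewrite e -e2 => /addrI.
  have [||y yl yx] := @uniq_inj_surj _ l2 l1 f u2 fi _ _ u1 x xl.
  - by move=> y /fP[].
  - by rewrite sz.
  by exists y => //; have [_] := fP y yl; rewrite yx.
have T3 y x : y \in l2 -> x \in l1 ->
    exists2 z, z \in l2 & (x + x) + (y + beta y) = z - beta z.
  move=> yl xl.
  have /choice[f fP] : forall z, exists x, z \in l2 ->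
      x \in l1 /\ (x + x) + (y + beta y) = z - beta z.
    move=> z; have [zl|zl] := boolP (z \in l2); last by exists 0.
    by have [x' ? ?] := T1 z y zl yl; exists x'.
  have fi : {in l2 &, injective f}.
    move=> z z' zl z'l e; apply: inj => //=.
    have [_ e1] := fP z zl; have [_ e2] := fP z' z'l.
    by rewrite -e1 -e2 e.
  have [||z zl zx] := @uniq_inj_surj _ l2 l1 f u2 fi _ _ u1 x xl.
  - by move=> z /fP[].
  - by rewrite sz.
  by exists z => //; have [_] := fP z zl; rewrite zx.
(* Doubling is injective, so it suffices to find [x] in [l1] with
   [2 x = 2 a - 2 b + 2 c]; the common value [y0 - beta y0] links [b] to [c]. *)
have sub1 a b c : a \in l1 -> b \in l1 -> c \in l1 -> a - b + c \in l1.
  move=> al bl cl.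
  have [y yl yE] := T2 _ _ y0l bl; have [y' yl' yE'] := T2 _ _ y0l cl.
  have [z zl zE] := T3 y a yl al; have [x xl xE] := T1 z y' zl yl'.
  suff -> : a - b + c = x by [].
  apply: two_injective => /=.
  have e1 := etrans yE (esym yE'); have e2 := etrans xE (esym zE).
  have e := congr2 +%R (esym e1) (esym e2).
  by apply: (eq_of_subr e); zmodule.
pose K : set D := [set k | k + s0 \in l1].
have K0 : K 0 by rewrite /K/= add0r.
have KB x y : K x -> K y -> K (x - y).
  rewrite /K/= => xl yl.
  by rewrite (_ : x - y + s0 = (x + s0) - (y + s0) + s0); [exact: sub1|zmodule].
have KN x : K x -> K (- x) by move=> Kx; rewrite -sub0r; exact: KB.
have KD x y : K x -> K y -> K (x + y).
  by move=> Kx Ky; rewrite -[y]opprK; apply: KB => //; exact: KN.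
have Kdiff a b : a \in l1 -> b \in l1 -> K (a - b).
  move=> al bl; rewrite /K/=; exact: sub1.
(* [1 - beta] and [1 + beta] send differences of points of [l2] to doubles of
   elements of [K]; half sum and half difference give both claims. *)
have L2 y y' : y \in l2 -> y' \in l2 -> K (y - y') /\ K (beta (y - y')).
  move=> yl yl'.
  have [x xl xE] := T1 y0 y y0l yl; have [x' xl' xE'] := T1 y0 y' y0l yl'.
  have [v vl vE] := T1 y y yl yl; have [v' vl' vE'] := T1 y' y yl' yl.
  have e1 := etrans xE (esym xE').
  have h1 : y - y' = (x' - x) + (v - v').
    apply: two_injective => /=.
    have e := congr2 +%R e1 (congr2 +%R (esym vE) vE').
    by apply: (eq_of_subr e); zmodule.
  have h2 : beta (y - y') = (x' - x) - (v - v').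
    apply: two_injective => /=; rewrite betaB.
    have e := congr2 +%R e1 (congr2 +%R vE (esym vE')).
    by apply: (eq_of_subr e); zmodule.
  by rewrite h2 h1; split; [apply: KD|apply: KB]; exact: Kdiff.
have K2 y1 y : y1 \in l2 -> K (y - y1) = (y \in l2) :> Prop.
  move=> y1l; apply/propext; split=> [Ky|yl]; last by case: (L2 y y1).
  have [|||z zl] := @uniq_inj_surj _ l2 l1 (fun z => z - y1 + s0) u2 _ _ _ u1 _ Ky.
  - by move=> a b _ _ /= /addIr/addIr.
  - by move=> z zl; case: (L2 z y1).
  - by rewrite sz.
  - by move/addIr/addIr => <-.
have K1 x : K (x - s0) = (x \in l1) :> Prop by rewrite /K/= subrK.
have Kbeta k : K k -> K (beta k).
  move=> Kk; have [|_] := L2 (k + y0) y0 _ y0l; last by rewrite addrK.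
  by rewrite -(K2 y0)// addrK.
have Kfin : finite_set K.
  apply/finite_seqP; exists (map (fun x => x - s0) l1).
  apply/seteqP; split => k /=; first by move=> Kk; apply/mapP; exists (k + s0) => //; rewrite addrK.
  by case/mapP => x xl ->; exact: Kdiff.
have Khalf g : K (g + g) -> K g.
  have [l lE] := (finite_seqP _).1 Kfin; pose l' := undup l.
  have lK k : K k = (k \in l') :> Prop by rewrite lE/= mem_undup.
  rewrite lK => gl.
  have [|||z zl] := @uniq_inj_surj _ l' l' (fun k => k + k) (undup_uniq _) _ _ _ (undup_uniq _) _ gl.
  - by move=> a b _ _; exact: two_injective.
  - by move=> z; rewrite -!lK => Kz; exact: KD.
  - by [].
  - by move/two_injective <-; rewrite lK.
(* The event of the pair [(x, y)] has positive mass, and so has its image under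
   the symmetry. *)
have pos x y : x \in l1 -> y \in l2 -> exists x' y',
    [/\ x' \in l1, y' \in l2, x' + y' = x + y & x' + beta y' = - (x + beta y)].
  move=> xl yl; apply: contrapT => nxy.
  have := sym [set z | z = (x + y, x + beta y)].
  set E1 := [set w | _]; set E2 := [set w | _] => E12.
  have mE (f : D * D -> D * D) : measurable [set w | f (k1 w, k2 w) = (x + y, x + beta y)].
    have := measurable_pairRV k1 k2 measurableT
      (measurable_discrete_group2 [set z | f z = (x + y, x + beta y)]).
    by rewrite setTI.
  have mE1 : measurable E1 := mE (fun z => (z.1 + z.2, z.1 + beta z.2)).
  have mE2 : measurable E2 := mE (fun z => (z.1 + z.2, - (z.1 + beta z.2))).
  have : ((m * m)%:E <= P E1)%E.
    have -> : (m * m)%:E = P (k1 @^-1` [set x] `&` k2 @^-1` [set y]).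
      by rewrite k12// !pmfDE -/p1 -/p2 p1E p2E xl yl.
    apply: le_measure; rewrite ?inE//.
      by apply: measurableI; exact: measurable_preimage_D.
    by move=> w [/= k1w k2w]; rewrite /E1/= k1w k2w.
  rewrite leNgt => /negP; apply; rewrite E12.
  have N1 := null_outside_support P k1; have N2 := null_outside_support P k2.
  apply: (@le_lt_trans _ _ 0%E); last by rewrite lte_fin mulr_gt0.
  apply: (@le_trans _ _ (P (k1 @^-1` [set x | ~ 0 < p1 x] `|` k2 @^-1` [set x | ~ 0 < p2 x]))).
    apply: le_measure; rewrite ?inE//.
      by apply: measurableU; exact: measurable_preimage_D.
    move=> w [w1 w2]; have [k1l|] := pselect (0 < p1 (k1 w)); last by left.
    right=> /= k2l; apply: nxy; exists (k1 w), (k2 w).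
    by split; rewrite -?pl1 -?pl2// -w2 opprK.
  rewrite le_eqVlt; apply/orP; left; apply/eqP.
  exact: etrans (measureU0 (measurable_preimage_D k1 _) (measurable_preimage_D k2 _) N2) N1.
have s0y0 : K (s0 + beta y0).
  have [x' [y' [xl yl e1 e2]]] := pos s0 y0 s0l y0l.
  apply: Khalf.
  have -> : s0 + beta y0 + (s0 + beta y0) = - ((x' - s0) + beta (y' - y0)).
    by rewrite betaB; apply: (eq_of_subr e2); zmodule.
  by apply: KN; apply: KD; [exact: Kdiff|apply: Kbeta; rewrite K2].
have K1' x : K (x + beta y0) = (x \in l1) :> Prop.
  rewrite -K1; apply/propext; split => Kx.
    by rewrite (_ : x - s0 = x + beta y0 - (s0 + beta y0)); [exact: KB|zmodule].
  by rewrite (_ : x + beta y0 = x - s0 + (s0 + beta y0)); [exact: KD|zmodule].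
exists K, y0, m; split => //; split => //.
- by move=> x; rewrite p1E K1' asboolb.
- by move=> x; rewrite p2E K2// asboolb.
- split.
    by move=> y y'; rewrite !K2// => yl yl' e; exact: inj.
  move=> x y; rewrite K1' K2// => xl yl.
  have [x' [y' [xl' yl' e1 e2]]] := pos x y xl yl.
  by exists x', y'; rewrite K1' K2.
Qed.

End heyde_discrete.

(** * Automorphisms of the product *)

Section automorphism_structure.
Variables (R : realType) (n : nat) (G : countZmodType).
Local Notation X := (RnxG R n G).
Local Notation D := (discrete_group G).

Lemma morph_sub0 (V W : zmodType) (f : V -> W) : {morph f : x y / x + y} -> f 0 = 0.
Proof. by move=> fD; apply: (addrI (f 0)); rewrite -fD !addr0. Qed.

Lemma continuous_line0 (f : X -> X) (v : 'rV[R]_n) : {morph f : x y / x + y} ->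
  continuous f -> f (t *: v, 0) @[t --> (0 : R)] --> (0 : X).
Proof.
move=> fD cf.
have line : ((t *: v, 0) : X) @[t --> (0 : R)] --> ((0, 0) : X).
  have c1 : t *: v @[t --> (0 : R)] --> (0 : 'rV[R]_n).
    by rewrite -[X in _ --> X](scale0r v); exact: scalel_continuous.
  exact: cvg_pair c1 (cvg_cst (0 : D)).
have := @continuous_cvg _ _ _ (nbhs (0 : R)) _ (fun t : R => ((t *: v, 0) : X)) f (0, 0) (cf _) line.
rewrite (morph_sub0 fD : f (0, 0) = 0); apply.
Qed.

(** The discrete component of [f (v / N)] vanishes for large [N] by continuity,
hence so does that of [f v]; each coordinate of the vector component is an
additive function bounded near 0. *)
Lemma continuous_additive_component (f : X -> X) : {morph f : x y / x + y} ->
  continuous f -> exists A : 'M[R]_n, forall v, f (v, 0) = (v *m A, 0).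
Proof.
move=> fD cf.
have D0 (v w : 'rV[R]_n) : f (v + w, 0) = f (v, 0) + f (w, 0).
  by rewrite -fD; congr f; congr pair; rewrite addr0.
have f2 v : (f (v, 0)).2 = 0.
  have nb : nbhs (0 : X) [set z | z.2 = 0].
    exists (setT, [set 0]) => /=; first by split; [exact: filterT|].
    by move=> z [].
  have : \forall t \near (0 : R), (f (t *: v, 0)).2 = 0.
    exact: (continuous_line0 v fD cf nb).
  move=> /nbhs_ballP[e /= e0 He].
  have [N _ HN] := near_infty_natSinv_lt (PosNum e0).
  pose u := N.+1%:R^-1 *: v.
  have fu : (f (u, 0)).2 = 0.
    apply: He; rewrite /ball/= sub0r normrN ger0_norm ?invr_ge0//.
    exact: (HN N (leqnn _)).
  have fk k : (f (k%:R *: u, 0)).2 = 0.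
    elim: k => [|k IH]; first by rewrite scale0r (morph_sub0 fD : f (0, 0) = 0).
    by rewrite -natr1 scalerDl scale1r D0/= IH fu addr0.
  by have := fk N.+1; rewrite /u scalerA mulfV ?scale1r ?pnatr_eq0.
have fi (i j : 'I_n) t : (f (t *: 'e_i, 0)).1 0 j = t * (f ('e_i, 0)).1 0 j.
  have : \forall t \near (0 : R), (f (t *: 'e_i, 0)).1 0 j < 1.
    have c1 : (f (t *: 'e_i, 0)).1 @[t --> (0 : R)] --> (0 : 'rV[R]_n).
      exact: cvg_comp (continuous_line0 _ fD cf) cvg_fst.
    have c2 := @continuous_cvg _ _ _ (nbhs (0 : R)) _ (fun t : R => (f (t *: 'e_i, 0)).1) _ 0 (@coord_continuous R 1 n 0 j 0) c1.
    by apply: (cvgr_lt _ (c2 _)); rewrite mxE.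
  move=> /nbhs_ballP[e /= e0 He].
  rewrite (@additive_bounded_linear R (fun t => (f (t *: 'e_i, 0)).1 0 j) e 1 _ e0); last 2 first.
  - by move=> s u; rewrite scalerDl D0/= mxE.
  - by move=> s se; apply/ltW/He; rewrite /ball/= sub0r normrN.
  by rewrite scale1r.
exists (\matrix_(i, j) (f ('e_i, 0)).1 0 j) => v.
rewrite [LHS]surjective_pairing f2; congr pair.
apply/rowP => j; rewrite {1}(row_sum_delta v) mxE.
rewrite (big_morph (fun u => (f (u, 0)).1 0 j) (id1 := 0) (op1 := +%R)).
- by apply: eq_bigr => i _; rewrite fi mxE.
- by move=> u w; rewrite D0/= mxE.
- by rewrite (morph_sub0 fD : f (0, 0) = 0)/= mxE.
Qed.

Lemma ker0_unitmx (A : 'M[R]_n) : (forall v : 'rV[R]_n, v *m A = 0 -> v = 0) ->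
  A \in unitmx.
Proof.
move=> A0; rewrite -row_free_unit -kermx_eq0; apply/rowV0P => v /sub_kermxP.
exact: A0.
Qed.

(** A vector killed by [A] or [1 + A] lies in the kernel of [alpha] or
[I + alpha].  If [beta] or [1 + beta] kills [g], invertibility of the matrix
yields [v] for which [(v, g)] lies in that kernel. *)
Lemma automorphism_structure (alpha : X -> X) :
  topological_automorphism alpha -> [set x | x + alpha x = 0] = [set 0] ->
  exists (A : 'M[R]_n) (h : D -> 'rV[R]_n) (beta : D -> D),
  [/\ forall v g, alpha (v, g) = (v *m A + h g, beta g),
      A \in unitmx /\ 1%:M + A \in unitmx,
      {morph h : x y / x + y}, {morph beta : x y / x + y} &
      (forall g, beta g = 0 -> g = 0) /\ (forall g, g + beta g = 0 -> g = 0)].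
Proof.
move=> [aD [b [ab ba ca cb]]] ker.
have bD : {morph b : x y / x + y}.
  by move=> x y; apply: (can_inj ab); rewrite aD !ba.
have [A AE] := continuous_additive_component aD ca.
have [B BE] := continuous_additive_component bD cb.
pose h g := (alpha (0, g)).1; pose beta g := (alpha (0, g)).2.
have aE v g : alpha (v, g) = (v *m A + h g, beta g).
  have -> : (v, g) = (v, 0) + (0, g) :> X by congr pair; rewrite ?addr0 ?add0r.
  by rewrite aD AE; congr pair; rewrite add0r.
have uA : A \in unitmx.
  apply: ker0_unitmx => v vA.
  by have := ab (v, 0); rewrite AE vA (morph_sub0 bD : b (0, 0) = 0) => -[<-].
have kerE x : x + alpha x = 0 -> x = 0.
  by move=> x0; have : [set x | x + alpha x = 0] x by []; rewrite ker.
have u1A : 1%:M + A \in unitmx.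
  apply: ker0_unitmx => v; rewrite mulmxDr mulmx1 => vA.
  suff [] : ((v, 0) : X) = 0 by [].
  apply: kerE; rewrite AE; congr pair; last by rewrite addr0.
  exact: vA.
exists A, h, beta; split => //.
- move=> x y; rewrite /h.
  have -> : (0, x + y) = (0, x) + (0, y) :> X by congr pair; rewrite addr0.
  by rewrite aD.
- move=> x y; rewrite /beta.
  have -> : (0, x + y) = (0, x) + (0, y) :> X by congr pair; rewrite addr0.
  by rewrite aD.
split=> g.
- move=> g0; have : alpha (- h g *m invmx A, g) = alpha 0.
    by rewrite aE mulmxKV// g0 addNr (morph_sub0 aD).
  by move/(can_inj ab) => -[].
- move=> g0; pose v := - h g *m invmx (1%:M + A).
  suff [] : ((v, g) : X) = 0 by [].
  apply: kerE; rewrite aE; congr pair; last exact: g0.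
  rewrite /= addrA -[X in X + _ + _](mulmx1 v) -mulmxDr mulmxKV//.
  exact: addNr.
Qed.

End automorphism_structure.

(** * Variables whose law is the same on all fibers *)

Lemma dotrVDl (R : realType) n (x y s : 'rV[R]_n) :
  dotrV (x + y) s = dotrV x s + dotrV y s.
Proof. by rewrite /dotrV mulmxDl mxE. Qed.

Section uniform_fibers.
Context d (Omega : measurableType d) (R : realType) (P : probability Omega R).
Variable G : countZmodType.
Local Notation D := (discrete_group G).
Variables (k : {mfun Omega >-> D}) (l : seq D) (m : R).
Hypotheses (ul : uniq l) (kl : forall x, pmfD P k x = if x \in l then m else 0).
Hypothesis m0 : 0 < m.

Lemma outside_list : P (k @^-1` [set x | x \notin l]) = 0%E.
Proof.
rewrite -(null_outside_support P k); congr (P _); apply/seteqP; split => w /=;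
by rewrite kl; case: ifP; rewrite ?ltxx ?m0.
Qed.

Lemma fin_split (E : set Omega) (C : set D) : measurable E ->
  P (E `&` k @^-1` C) = (\sum_(x <- l | x \in C) P (E `&` k @^-1` [set x]))%E.
Proof.
move=> mE.
have mk A : measurable (k @^-1` A) by exact: measurable_preimage_D.
have -> : P (E `&` k @^-1` C) = P (E `&` k @^-1` (C `&` [set` l])).
  have -> : E `&` k @^-1` C = (E `&` k @^-1` (C `&` [set` l])) `|`
      (E `&` k @^-1` (C `&` [set x | x \notin l])).
    apply/seteqP; split => w /=; last by case=> -[? []].
    by move=> [Ew Cw]; have [kw|kw] := boolP (k w \in l); [left|right].
  apply: measureU0; try exact: measurableI.
  apply/eqP; rewrite -measure_le0 -outside_list; apply: le_measure;
    rewrite ?inE//; first exact: measurableI.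
  by move=> w [_ []].
elim: l ul => [_|x s IH /= /andP[xs us]].
  rewrite big_nil (_ : _ `&` _ = set0) ?measure0//.
  by apply/seteqP; split => // w [_ []].
rewrite big_cons -IH//; case: ifPn => xC.
  rewrite -measureU//; try exact: measurableI.
    congr (P _); apply/seteqP; split => w /=; rewrite inE.
      by move=> [Ew [Cw /predU1P[->|ws]]]; [left|right].
    by case=> -[Ew]; [move=> ->; split => //; rewrite eqxx; split => //; exact/set_mem|case=> ? ->; rewrite orbT].
  by apply/seteqP; split => // w /= [[_ ->] [_ []]] _; rewrite (negPf xs).
congr (P _); apply/seteqP; split => w /=; rewrite inE.
  by move=> [Ew [Cw /predU1P[e|//]]]; move: xC; rewrite -e mem_set.
by move=> [Ew [Cw ->]]; rewrite orbT.
Qed.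

Lemma sum_mass : (size l)%:R * m = 1.
Proof.
have := fin_split setT measurableT.
rewrite setTI preimage_setT probability_setT.
under eq_bigr => x _ do rewrite setTI pmfDE.
rewrite sumEFin => -[e]; rewrite [RHS]e.
rewrite big_seq_cond (eq_bigr (fun=> m)) => [|x /andP[xl _]]; last by rewrite kl xl.
rewrite -big_seq_cond (eq_bigl predT) => [|x]; last by rewrite in_setT.
by rewrite big_const_seq count_predT iter_addr_0 mulr_natl.
Qed.

Variable n : nat.
Variables (eta : {mfun Omega >-> 'rV[R]_n}) (c : 'rV[R]_n) (phi : 'rV[R]_n -> R[i]).
Hypotheses (cphi : charlike phi) (phi0 : forall u, phi u != 0) (qphi : cubic phi).
Hypothesis phiE : forall x u, x \in l ->
  cond_char P (k @^-1` [set x]) (fun w => eta w + c) u = phi u.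

Let mdot u : measurable_fun setT (fun w => dotrV (eta w) u).
Proof. exact: measurableT_comp (measurable_dotrV u) _. Qed.

Let Poo : (P setT < +oo)%E. Proof. by rewrite probability_setT ltry. Qed.

Let mk A : measurable (k @^-1` A). Proof. exact: measurable_preimage_D. Qed.

Let fiber x u := cE P (phase (k @^-1` [set x]) (fun w => dotrV (eta w) u)).

Let b_fiber x u : cbmfun (phase (k @^-1` [set x]) (fun w => dotrV (eta w) u)).
Proof. exact: cbmfun_phase. Qed.

Let expiK (t : R) : expi t * expi (- t) = 1.
Proof. by rewrite -expiD addrN /expi cos0 sin0. Qed.

Let fiberE x u : x \in l -> fiber x u = m%:C%C * (phi u * expi (- dotrV c u)).
Proof.
move=> xl; rewrite -(phiE u xl) /cond_char.
have -> : fine (P (k @^-1` [set x])) = m by rewrite -/(pmfD P k x) kl xl.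
have -> : cE P (phase (k @^-1` [set x]) (fun w => dotrV (eta w + c) u)) =
    expi (dotrV c u) * fiber x u.
  rewrite -cEZ//; congr (cE P); apply/funext => w.
  by rewrite /phase dotrVDl expiD; ring.
have mC : m%:C%C != 0 by rewrite fmorph_eq0 gt_eqF.
transitivity (fiber x u * (expi (dotrV c u) * expi (- dotrV c u))).
  by rewrite expiK mulr1.
by field.
Qed.

Let fiber_eq x y u : x \in l -> y \in l -> fiber x u = fiber y u.
Proof. by move=> xl yl; rewrite !fiberE. Qed.

(** The restrictions of the law of [eta] to two fibers have the same total mass
[m] and the same characteristic function.  To stay with probability laws, the
rest of the mass is moved to the origin: [Z z] is [eta] on the fiber over [z]
and 0 elsewhere. *)
Let fiber_prob_eq x y (B : set 'rV[R]_n) : x \in l -> y \in l -> measurable B ->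
  P (eta @^-1` B `&` k @^-1` [set x]) = P (eta @^-1` B `&` k @^-1` [set y]).
Proof.
move=> xl yl mB.
pose Z z (w : Omega) : 'rV[R]_n := (\1_(k @^-1` [set z]) w : R) *: eta w.
have mZ z : measurable_fun setT (Z z).
  apply: measurable_fun_rV => i.
  rewrite (_ : _ \o _ = (fun w => \1_(k @^-1` [set z]) w * rV_coord i (eta w))).
    apply: measurable_funM; first exact: measurable_indic.
    by apply: measurableT_comp => //; exact: measurable_rV_coord.
  by apply/funext => w; rewrite /Z/rV_coord/= mxE.
pose Z' z : {mfun Omega >-> 'rV[R]_n} :=
  HB.pack (Z z) (isMeasurableFun.Build _ _ _ _ _ (mZ z)).
have dZ z w u : dotrV (Z z w) u = (\1_(k @^-1` [set z]) w : R) * dotrV (eta w) u.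
  by rewrite /Z /dotrV -scalemxAl mxE.
have b1 z : bmfun (\1_(k @^-1` [set z]) : Omega -> R) by exact: bmfun_indic.
have cosZ z u : z \in l ->
    \int[distribution P (Z' z)]_v cos (dotrV v u) = Re (fiber z u) + (1 - m).
  move=> zl; rewrite Rintegral_distribution; last exact: bmfun_cos (measurable_dotrV u).
  have -> : \int[P]_w cos (dotrV (Z' z w) u) = \int[P]_w
      (Re (phase (k @^-1` [set z]) (fun w => dotrV (eta w) u) w) +
        (1 + - 1 * \1_(k @^-1` [set z]) w)).
    apply: eq_Rintegral => w _; rewrite Re_phase [dotrV _ _]dZ indicE.
    by case: (_ \in _) => /=; rewrite ?mulr1n ?mulr0n ?mul1r ?mul0r ?cos0; ring.
  have bN : bmfun (fun w => - 1 * \1_(k @^-1` [set z]) w : R).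
    exact: bmfunM (bmfun_cst _ _) (b1 z).
  rewrite (bmfun_RintegralD Poo (b_fiber z u).1 (bmfunD (bmfun_cst _ _) bN)).
  rewrite (bmfun_RintegralD Poo (bmfun_cst _ _) bN) (bmfun_RintegralZ Poo _ (b1 z)).
  rewrite Rintegral_indic// -/(pmfD P k z) kl zl Rintegral_cst//.
  have -> : fine (P [set: Omega]) = 1 :> R by rewrite probability_setT.
  by rewrite mul1r mulN1r.
have sinZ z u : z \in l ->
    \int[distribution P (Z' z)]_v sin (dotrV v u) = Im (fiber z u).
  move=> zl; rewrite Rintegral_distribution; last exact: bmfun_sin (measurable_dotrV u).
  apply: eq_Rintegral => w _; rewrite Im_phase [dotrV _ _]dZ indicE.
  by case: (_ \in _) => /=; rewrite ?mulr1n ?mulr0n ?mul1r ?mul0r ?sin0.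
have EZ A : measurable A -> P (Z x @^-1` A) = P (Z y @^-1` A).
  move=> mA; apply: (@char_uniqueness _ _ (distribution P (Z' x)) (distribution P (Z' y))) => //.
  - by move=> u; rewrite !cosZ// (fiber_eq u xl yl).
  - by move=> u; rewrite !sinZ// (fiber_eq u xl yl).
have me A : measurable A -> measurable (eta @^-1` A).
  by move=> mA; rewrite -[X in measurable X]setTI; exact: measurable_funPT.
have key z A : z \in l -> measurable A ->
    P (Z z @^-1` A) = (P (eta @^-1` A `&` k @^-1` [set z]) + (\1_A (0 : 'rV[R]_n) * (1 - m))%:E)%E.
  move=> zl mA.
  have -> : Z z @^-1` A = (eta @^-1` A `&` k @^-1` [set z]) `|`
      ((fun=> 0) @^-1` A `&` ~` (k @^-1` [set z])).
    apply/seteqP; split => w /=; rewrite /Z indicE.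
      have [kw|kw] := pselect (k w = z); first by rewrite mem_set// scale1r; left.
      by rewrite memNset// scale0r; right.
    case=> -[Aw kw]; first by rewrite mem_set// scale1r.
    by rewrite memNset// scale0r.
  have mc : measurable ((fun _ : Omega => 0 : 'rV[R]_n) @^-1` A).
    by rewrite preimage_cst; case: ifP.
  rewrite measureU//; last 3 first.
  - by apply: measurableI => //; exact: me.
  - by apply: measurableI => //; exact: measurableC.
  - by apply/seteqP; split => // w [[_ kz] [_]].
  congr (_ + _)%E; rewrite preimage_cst indicE; case: ifP => A0.
    rewrite setTI; apply: etrans; first exact: probability_setC.
    by rewrite pmfDE kl zl mul1r EFinB.
  by rewrite set0I measure0 mul0r.
have := EZ B mB; rewrite !key//.
have fP z : P (eta @^-1` B `&` k @^-1` [set z]) \is a fin_num.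
  by apply: fin_num_measure; apply: measurableI => //; exact: me.
rewrite -(fineK (fP x)) -(fineK (fP y)) -!EFinD => -[/addIr e].
by congr EFin.
Qed.

Lemma fiber_prob x (B : set 'rV[R]_n) : x \in l -> measurable B ->
  P (eta @^-1` B `&` k @^-1` [set x]) = (m%:E * P (eta @^-1` B))%E.
Proof.
move=> xl mB.
have meB : measurable (eta @^-1` B).
  by rewrite -[X in measurable X]setTI; exact: measurable_funPT.
have := fin_split setT meB; rewrite preimage_setT setIT => ->.
rewrite (eq_bigl predT) => [|y]; last by rewrite in_setT.
rewrite big_seq (eq_bigr (fun=> P (eta @^-1` B `&` k @^-1` [set x]))); last first.
  by move=> y yl; exact: fiber_prob_eq.
rewrite -big_seq -(fineK (fin_num_measure P _ (measurableI _ _ meB (mk [set x])))).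
rewrite sumEFin big_const_seq count_predT iter_addr_0 -EFinM; congr EFin.
by rewrite -mulr_natl mulrA [m * _]mulrC sum_mass mul1r.
Qed.

(** The law of [eta] is the average of its laws on the fibers, which all have the
characteristic function [phi] up to the translation by [c]. *)
Lemma gaussian_marginal : is_gaussian (distribution P eta).
Proof.
have [mean [S [S1 S2 phiS]]] := cubic_gauss_form cphi phi0 qphi.
exists (mean - c), S; split => // s.
have -> : char_function (distribution P eta) s = cE P (fun w => expi (dotrV (eta w) s)).
  rewrite /char_function /cE.
  rewrite (Rintegral_distribution P eta (bmfun_cos (measurable_dotrV s))).
  by rewrite (Rintegral_distribution P eta (bmfun_sin (measurable_dotrV s))).
have -> : cE P (fun w => expi (dotrV (eta w) s)) =
    cE P (fun w => \sum_(x <- l) phase (k @^-1` [set x]) (fun w => dotrV (eta w) s) w).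
  apply: (cE_ae_eq (D := k @^-1` [set` l])) => //.
  - by split; [exact: bmfun_cos|exact: bmfun_sin].
  - by apply: cbmfun_sum => x; exact: b_fiber.
  - by rewrite -[RHS]outside_list; congr (P _); apply/seteqP; split => w /= /negP.
  - move=> w; rewrite inE/= => kwl; rewrite (bigD1_seq (k w))//= big1 => [|x xk].
      by rewrite addr0 /phase indicE mem_set// mul1r.
    rewrite /phase indicE memNset ?mul0r//= => kx; by rewrite kx eqxx in xk.
rewrite cE_sum// big_seq (eq_bigr (fun=> m%:C%C * (phi s * expi (- dotrV c s)))); last first.
  by move=> x; exact: fiberE.
rewrite -big_seq big_const_seq count_predT iter_addr_0 -[LHS]mulr_natl.
have e1 : (size l)%:R * m%:C%C = 1 :> R[i].
  by rewrite -(rmorph_nat (real_complex R)) -rmorphM/= sum_mass.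
rewrite [LHS]mulrA e1 mul1r phiS dotrVDl expiD.
have -> : dotrV (- c) s = - dotrV c s by rewrite /dotrV mulNmx mxE.
by ring.
Qed.

End uniform_fibers.

(** * Finite subgroups and measurable maps *)

Section finite_order.
Variable V : zmodType.

Lemma finite_subgroup_order (K : set V) (x : V) : finite_subgroup K -> K x ->
  exists2 j, (0 < j)%N & x *+ j = 0.
Proof.
move=> [K0 KB /finite_seqP[l lE]] Kx.
have KN y : K y -> K (- y) by move=> Ky; rewrite -sub0r; exact: KB.
have Kn j : K (x *+ j).
  by elim: j => [|j IH]; rewrite ?mulr0n// mulrSr -[x in _ + x]opprK; apply: KB => //; exact: KN.
apply: contrapT => nj.
have inj : injective (fun j => x *+ j).
  suff H i j : (i < j)%N -> x *+ i <> x *+ j.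
    by move=> i j e; case: (ltngtP i j) => // /H []//; rewrite e.
  move=> ij e; apply: nj; exists (j - i)%N; first by rewrite subn_gt0.
  by rewrite mulrnBr ?(ltnW ij)// e subrr.
have /uniq_leq_size : uniq (map (fun j => x *+ j) (iota 0 (size l).+1)).
  by rewrite map_inj_uniq// iota_uniq.
move=> /(_ l); rewrite size_map size_iota ltnn => sub; suff : false by []; apply: sub.
by move=> _ /mapP[j _ ->]; have : K (x *+ j) by []; rewrite lE.
Qed.

(** An injective self-map of a finite set is onto. *)
Lemma finite_subgroup_surj (K : set V) (f : V -> V) : finite_subgroup K ->
  (forall x, K x -> K (f x)) -> injective f ->
  forall y, K y -> exists2 x, K x & f x = y.
Proof.
move=> [K0 KB /finite_seqP[l lE]] fK fi y; rewrite lE/= -mem_undup => yl.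
have memK x : (x \in undup l) = `[< K x >] by rewrite mem_undup; apply/idP/asboolP; rewrite lE.
have [|||x xl <-] := @uniq_inj_surj _ (undup l) (undup l) f (undup_uniq _) _ _ _ (undup_uniq _) y yl.
- by move=> ? ? _ _; exact: fi.
- by move=> x; rewrite !memK => /asboolP Kx; apply/asboolP; exact: fK.
- by [].
by exists x => //; rewrite /= -mem_undup.
Qed.

End finite_order.

Section discrete_shift.
Context d (Omega : measurableType d) (G : countZmodType).
Local Notation D := (discrete_group G).

Lemma measurable_from_discrete d' (T : measurableType d') (f : D -> T) :
  measurable_fun setT f.
Proof. by []. Qed.

Definition shift_mfun (k : {mfun Omega >-> D}) (g : D) : {mfun Omega >-> D} :=
  HB.pack (fun w => k w - g) (isMeasurableFun.Build _ _ _ _ _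
    (measurableT_comp (measurable_from_discrete (fun x : D => x - g : D))
      (@measurable_funPT _ _ _ _ k))).

End discrete_shift.

Section measurability.
Variables (R : realType) (n : nat) (G : countZmodType).
Local Notation X := (RnxG R n G).
Local Notation D := (discrete_group G).

Lemma measurable_rV_add d (T : measurableType d) (f g : T -> 'rV[R]_n) :
  measurable_fun setT f -> measurable_fun setT g ->
  measurable_fun setT (fun x => f x + g x).
Proof.
move=> mf mg; apply: measurable_fun_rV => i.
have mc (k : T -> 'rV[R]_n) : measurable_fun setT k ->
    measurable_fun setT (fun x => rV_coord i (k x)).
  by move=> mk; apply: measurableT_comp mk; exact: measurable_rV_coord.
rewrite (_ : _ \o _ = (fun x => rV_coord i (f x) + rV_coord i (g x))).
  by apply: measurable_funD; exact: mc.
by apply/funext => x; rewrite /rV_coord/= mxE.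
Qed.

Lemma measurable_mulmx (B : 'M[R]_n) :
  measurable_fun setT (fun v : 'rV[R]_n => v *m B).
Proof.
apply: measurable_fun_rV => i.
rewrite (_ : _ \o _ = (fun v : 'rV[R]_n => dotrV v (row i B^T))).
  exact: measurable_dotrV.
apply/funext => v; rewrite /rV_coord/= /dotrV !mxE.
by apply: eq_bigr => j _; rewrite !mxE.
Qed.

Lemma measurable_affine_pair (B : 'M[R]_n) (h : D -> 'rV[R]_n) (b : D -> D) :
  measurable_fun setT (fun z : X => (z.1 *m B + h z.2, b z.2) : X).
Proof.
apply: measurable_fun_pair.
  apply: measurable_rV_add.
    exact: measurableT_comp (measurable_mulmx B) measurable_fst.
  exact: measurableT_comp (measurable_from_discrete h) measurable_snd.
exact: measurableT_comp (measurable_from_discrete b) measurable_snd.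
Qed.

End measurability.

(** * The vector component over the discrete one *)

(** A finite subgroup is torsion, and a real vector space is torsion free. *)
Lemma additive_finite_subgroup0 (V : zmodType) (R : numFieldType) (W : lmodType R)
    (K : set V) (f : V -> W) (k : V) :
  {morph f : x y / x + y} -> finite_subgroup K -> K k -> f k = 0.
Proof.
move=> fD Ksub /(finite_subgroup_order Ksub)[j j0 kj].
have f0 : f 0 = 0 by exact: morph_sub0.
have fM i : f (k *+ i) = f k *+ i.
  by elim: i => [|i IH]; rewrite ?mulr0n// !mulrSr fD IH.
apply/eqP; have /eqP := fM j; rewrite kj f0 eq_sym -scaler_nat.
by rewrite scaler_eq0 pnatr_eq0 -[j == _]negbK -lt0n j0.
Qed.

Section heyde_product.
Variables (R : realType) (n : nat) (G : countZmodType).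
Local Notation X := (RnxG R n G).
Local Notation D := (discrete_group G).
Variables (A : 'M[R]_n) (h : D -> 'rV[R]_n) (beta : D -> D).
Hypotheses (uA : A \in unitmx) (u1A : 1%:M + A \in unitmx).
Hypotheses (hD : {morph h : x y / x + y}) (betaD : {morph beta : x y / x + y}).
Hypotheses (two_inj : forall g : D, g + g = 0 -> g = 0)
  (beta_inj : forall g, beta g = 0 -> g = 0)
  (beta1_inj : forall g, g + beta g = 0 -> g = 0).
Context d (Omega : measurableType d) (P : probability Omega R).
Variables (xi1 xi2 : {mfun Omega >-> X}).
Hypothesis xi12 : independent_RV P xi1 xi2.

Let al (z : X) : X := (z.1 *m A + h z.2, beta z.2).
Let L1 w := xi1 w + xi2 w.
Let L2 w := xi1 w + al (xi2 w).

Hypothesis L_sym : forall B C, measurable B -> measurable C ->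
  P (L1 @^-1` B `&` L2 @^-1` C) = P (L1 @^-1` B `&` (fun w => - L2 w) @^-1` C).

Let mL1 : measurable_fun setT L1.
Proof.
have := measurableT_comp (@measurable_addX R n G) (measurable_pairRV xi1 xi2).
by [].
Qed.

Let mL2 : measurable_fun setT L2.
Proof.
have mal : measurable_fun setT (fun w => al (xi2 w)).
  exact: measurableT_comp (measurable_affine_pair A h beta) (@measurable_funPT _ _ _ _ xi2).
exact: measurableT_comp (@measurable_addX R n G)
  (measurable_fun_pair (@measurable_funPT _ _ _ _ xi1) mal).
Qed.

Let mL2N : measurable_fun setT (fun w => - L2 w).
Proof.
have := measurableT_comp (measurable_affine_pair (- 1%:M) (fun=> 0) -%R) mL2.
congr measurable_fun; apply/funext => w /=.
by rewrite addr0 mulmxN mulmx1.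
Qed.

Let pL : {mfun Omega >-> (X * X)%type} := HB.pack (fun w => (L1 w, L2 w))
  (isMeasurableFun.Build _ _ _ _ _ (measurable_fun_pair mL1 mL2)).
Let pLN : {mfun Omega >-> (X * X)%type} := HB.pack (fun w => (L1 w, - L2 w))
  (isMeasurableFun.Build _ _ _ _ _ (measurable_fun_pair mL1 mL2N)).

Let pair_law E : measurable E -> P (pL @^-1` E) = P (pLN @^-1` E).
Proof. by apply: rectangles_same_law => B C mB mC; exact: L_sym. Qed.

Let eta1 : {mfun Omega >-> 'rV[R]_n} := HB.pack (fun w => (xi1 w).1)
  (isMeasurableFun.Build _ _ _ _ _ (measurableT_comp measurable_fst (@measurable_funPT _ _ _ _ xi1))).
Let eta2 : {mfun Omega >-> 'rV[R]_n} := HB.pack (fun w => (xi2 w).1)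
  (isMeasurableFun.Build _ _ _ _ _ (measurableT_comp measurable_fst (@measurable_funPT _ _ _ _ xi2))).
Let k1 : {mfun Omega >-> D} := HB.pack (fun w => (xi1 w).2)
  (isMeasurableFun.Build _ _ _ _ _ (measurableT_comp measurable_snd (@measurable_funPT _ _ _ _ xi1))).
Let k2 : {mfun Omega >-> D} := HB.pack (fun w => (xi2 w).2)
  (isMeasurableFun.Build _ _ _ _ _ (measurableT_comp measurable_snd (@measurable_funPT _ _ _ _ xi2))).

Let k12 : independent_RV P k1 k2.
Proof.
move=> B C mB mC.
have mS (F : set D) : measurable [set z : X | F z.2].
  by have := @measurable_snd _ _ 'rV[R]_n D measurableT F; rewrite setTI; apply.
exact: (xi12 (mS B) (mS C)).
Qed.

Let ksym (F : set (D * D)) :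
  P [set w | F (k1 w + k2 w, k1 w + beta (k2 w))] =
  P [set w | F (k1 w + k2 w, - (k1 w + beta (k2 w)))].
Proof.
have mF : measurable [set z : X * X | F (z.1.2, z.2.2)].
  have m2 : measurable_fun setT (fun z : X * X => (z.1.2, z.2.2)).
    apply: measurable_fun_pair.
      exact: measurableT_comp measurable_snd measurable_fst.
    exact: measurableT_comp measurable_snd measurable_snd.
  by have := m2 measurableT F (measurable_discrete_group2 F); rewrite setTI.
exact: (pair_law mF).
Qed.

Section fibers.
Variables (K : set D) (y1 : D) (m : R).
Hypotheses (m0 : 0 < m) (Ksub : finite_subgroup K).
Hypothesis p1E : forall x, pmfD P k1 x = if `[< K (x + beta y1) >] then m else 0.
Hypothesis p2E : forall y, pmfD P k2 y = if `[< K (y - y1) >] then m else 0.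
Hypothesis Kbeta : forall k, K k -> K (beta k).
Hypothesis Kinj : forall y y', K (y - y1) -> K (y' - y1) ->
  y - beta y = y' - beta y' -> y = y'.
Hypothesis Kpos : forall x y, K (x + beta y1) -> K (y - y1) -> exists x' y',
  [/\ K (x' + beta y1), K (y' - y1), x' + y' = x + y & x' + beta y' = - (x + beta y)].

Let K0 : K 0. Proof. by case: Ksub. Qed.
Let KB x y : K x -> K y -> K (x - y). Proof. by case: Ksub => _ + _; apply. Qed.
Let KN x : K x -> K (- x). Proof. by move=> Kx; rewrite -sub0r; exact: KB. Qed.
Let KD x y : K x -> K y -> K (x + y).
Proof. by move=> Kx Ky; rewrite -[y]opprK; apply: KB => //; exact: KN. Qed.

Let beta0 : beta 0 = 0. Proof. exact: morph_sub0 betaD. Qed.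
Let betaN x : beta (- x) = - beta x.
Proof. by apply/eqP; rewrite -addr_eq0 -betaD addNr beta0. Qed.

Let h_y1 y : K (y - y1) -> h y = h y1.
Proof.
move=> Ky; rewrite -[y](subrK y1) hD.
by rewrite (additive_finite_subgroup0 hD Ksub Ky) add0r.
Qed.

(** Since [h] is constant on the coset [y1 + K], its contribution to [L2] is the
constant [h y1]; translating [eta1] by it removes [h] from the relations
below. *)
Let Phi1 x u := cE P (phase (k1 @^-1` [set x]) (fun w => dotrV (eta1 w + h y1) u)).
Let Phi2 y u := cE P (phase (k2 @^-1` [set y]) (fun w => dotrV (eta2 w) u)).

Let F x y u v (l : X * X) : R[i] :=
  phase [set l : X * X | l.1.2 = x + y /\ l.2.2 = x + beta y]
    (fun l => dotrV (l.1.1 + h y1) u + dotrV l.2.1 v) l.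

Let cF x y u v : cbmfun (F x y u v).
Proof.
apply: cbmfun_phase.
  have m2 : measurable_fun setT (fun z : X * X => (z.1.2, z.2.2)).
    apply: measurable_fun_pair.
      exact: measurableT_comp measurable_snd measurable_fst.
    exact: measurableT_comp measurable_snd measurable_snd.
  have := m2 measurableT _ (measurable_discrete_group2
    [set z | z.1 = x + y /\ z.2 = x + beta y]).
  by rewrite setTI.
apply: measurable_funD.
  apply: measurableT_comp (measurable_dotrV u) _ => /=.
  apply: measurable_rV_add; last exact: measurable_cst.
  exact: measurableT_comp measurable_fst measurable_fst.
apply: measurableT_comp (measurable_dotrV v) _ => /=.
exact: measurableT_comp measurable_fst measurable_snd.
Qed.

Let measurable_D2 (B : set D) : measurable [set z : X | B z.2].
Proof. by have := @measurable_snd _ _ 'rV[R]_n D measurableT B; rewrite setTI; apply. Qed.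

(** On the supports the discrete components of the two forms determine the pair
[(k1, k2)], by [Kinj]; so restricting to the values of the forms amounts to
restricting to [k1 = x] and [k2 = y], and independence splits the
expectation. *)
Let joint x y u v : K (x + beta y1) -> K (y - y1) ->
  cE P (fun w => F x y u v (pL w)) = Phi1 x (u + v) * Phi2 y (u + v *m A^T).
Proof.
move=> Kx Ky.
pose F1 (z : X) : R[i] := phase [set z : X | z.2 = x] (fun z => dotrV (z.1 + h y1) (u + v)) z.
pose F2 (z : X) : R[i] := phase [set z : X | z.2 = y] (fun z => dotrV z.1 (u + v *m A^T)) z.
have c1 : cbmfun F1.
  apply: cbmfun_phase; first exact: (measurable_D2 [set x]).
  apply: measurableT_comp (measurable_dotrV (u + v)) _ => /=.
  by apply: measurable_rV_add; [exact: measurable_fst|exact: measurable_cst].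
have c2 : cbmfun F2.
  apply: cbmfun_phase; first exact: (measurable_D2 [set y]).
  exact: measurableT_comp (measurable_dotrV _) measurable_fst.
have -> : Phi1 x (u + v) * Phi2 y (u + v *m A^T) =
    cE P (fun w => F1 (xi1 w) * F2 (xi2 w)) by rewrite (cE_indep xi12 c1 c2).
apply: (cE_ae_eq (D := k1 @^-1` [set x | 0 < pmfD P k1 x] `&` k2 @^-1` [set x | 0 < pmfD P k2 x])).
- exact: cbmfun_comp (@measurable_funPT _ _ _ _ pL) (cF x y u v).
- apply: cbmfunM.
    exact: cbmfun_comp (@measurable_funPT _ _ _ _ xi1) c1.
  exact: cbmfun_comp (@measurable_funPT _ _ _ _ xi2) c2.
- by apply: measurableI; exact: measurable_preimage_D.
- rewrite setCI.
  have N1 := null_outside_support P k1; have N2 := null_outside_support P k2.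
  exact: etrans (measureU0 (measurable_preimage_D k1 _) (measurable_preimage_D k2 _) N2) N1.
move=> w; rewrite inE => -[/= + +]; rewrite p1E p2E.
case: asboolP => [Kx' _|]; last by rewrite ltxx.
case: asboolP => [Ky' _|]; last by rewrite ltxx.
rewrite /F /F1 /F2 /phase !indicE /=.
have [[e1 e2]|ne] := pselect ((xi1 w).2 = x /\ (xi2 w).2 = y).
  rewrite !mem_set//=; last by rewrite /L1 /L2/= e1 e2.
  rewrite !mul1r -expiD; congr expi.
  have -> : h (xi2 w).2 = h y1 by rewrite e2 h_y1.
  rewrite !dotrVDl !dotrVDr.
  have -> : dotrV ((xi2 w).1 *m A) v = dotrV (xi2 w).1 (v *m A^T).
    by rewrite /dotrV trmx_mul trmxK mulmxA.
  by ring.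
rewrite memNset; last first.
  rewrite /L1 /L2 /= => -[e1 e2]; apply: ne.
  suff e : (xi2 w).2 = y by split=> //; apply: (addIr y); rewrite -{1}e.
  have e1' : (xi1 w).2 + (xi2 w).2 = x + y := e1.
  have e2' : (xi1 w).2 + beta (xi2 w).2 = x + beta y := e2.
  apply: Kinj => //; have e := congr2 +%R e1' (congr1 -%R e2').
  by apply: (eq_of_subr e); zmodule.
have [e1|n1] := pselect ((xi1 w).2 = x); last first.
  by rewrite [xi1 w \in _]memNset// !mul0r.
by rewrite [xi2 w \in _]memNset ?mul0r ?mulr0// => e2; apply: ne.
Qed.

(** Changing the sign of [L2] turns the event of the pair [(x, y)] into that of
[(x', y')] and [v] into [- v]. *)
Let functional_eq x y x' y' u v : K (x + beta y1) -> K (y - y1) ->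
  K (x' + beta y1) -> K (y' - y1) -> x' + y' = x + y -> x' + beta y' = - (x + beta y) ->
  Phi1 x (u + v) * Phi2 y (u + v *m A^T) = Phi1 x' (u - v) * Phi2 y' (u - v *m A^T).
Proof.
move=> Kx Ky Kx' Ky' e1 e2; rewrite -joint//.
rewrite (cE_same_law (Y := pLN) pair_law (cF x y u v)).
rewrite -[in RHS]mulNmx -joint//; congr (cE P); apply/funext => w.
rewrite /F /phase.
have -> : \1_[set l : X * X | l.1.2 = x + y /\ l.2.2 = x + beta y] (pLN w) =
    \1_[set l : X * X | l.1.2 = x' + y' /\ l.2.2 = x' + beta y'] (pL w) :> R.
  rewrite !indicE; congr (_%:R); congr nat_of_bool; apply/idP/idP.
    rewrite !inE/= e1 e2 => -[-> <-]; split=> //; by rewrite opprK.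
  by rewrite !inE/= e1 e2 => -[-> ->]; rewrite opprK.
congr (_ * expi (_ + _)).
by rewrite dotrVNr /dotrV /= mulNmx mxE.
Qed.

Let f1 x := cond_char P (k1 @^-1` [set x]) (fun w => eta1 w + h y1).
Let f2 y := cond_char P (k2 @^-1` [set y]) (fun w => eta2 w + 0).

Let mC : m%:C%C != 0 :> R[i]. Proof. by rewrite fmorph_eq0 gt_eqF. Qed.

Let f1E x u : K (x + beta y1) -> f1 x u = Phi1 x u / m%:C%C.
Proof. by move=> Kx; rewrite /f1 /cond_char -/(pmfD P k1 x) p1E asboolT. Qed.

Let f2E y u : K (y - y1) -> f2 y u = Phi2 y u / m%:C%C.
Proof.
move=> Ky; rewrite /f2 /cond_char -/(pmfD P k2 y) p2E asboolT//.
by congr (cE P (phase _ _) / _); apply/funext => w; rewrite addr0.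
Qed.

Let cf1 x : K (x + beta y1) -> charlike (f1 x).
Proof.
move=> Kx; apply: charlike_cond_char; first exact: measurable_preimage_D.
  by apply: measurable_rV_add; [exact: measurable_funPT|exact: measurable_cst].
by rewrite pmfDE p1E asboolT// lte_fin.
Qed.

Let cf2 y : K (y - y1) -> charlike (f2 y).
Proof.
move=> Ky; apply: charlike_cond_char; first exact: measurable_preimage_D.
  by apply: measurable_rV_add; [exact: measurable_funPT|exact: measurable_cst].
by rewrite pmfDE p2E asboolT// lte_fin.
Qed.

Let norm_eq x y x' y' u v : K (x + beta y1) -> K (y - y1) ->
  K (x' + beta y1) -> K (y' - y1) -> x' + y' = x + y -> x' + beta y' = - (x + beta y) ->
  f1 x (u + v) * f2 y (u + v *m A^T) = f1 x' (u - v) * f2 y' (u - v *m A^T).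
Proof.
move=> Kx Ky Kx' Ky' e1 e2.
rewrite (f1E (u + v) Kx) (f2E (u + v *m A^T) Ky).
rewrite (f1E (u - v) Kx') (f2E (u - v *m A^T) Ky').
have E := functional_eq u v Kx Ky Kx' Ky' e1 e2.
by rewrite mulrACA E -mulrACA.
Qed.

(** For [x = - beta y] the discrete component of [L2] is 0 and the pair is sent to
itself. *)
Let f12_cubic y : K (y - y1) -> [/\ forall u, f1 (- beta y) u != 0,
  forall u, f2 y u != 0, cubic (f1 (- beta y)) & cubic (f2 y)].
Proof.
move=> Ky; have Kx : K (- beta y + beta y1).
  have -> : - beta y + beta y1 = - beta (y - y1) by rewrite betaD betaN; zmodule.
  exact/KN/Kbeta.
apply: (heyde_pair_cubic (cf1 Kx) (cf2 Ky) (M := A^T)).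
- by rewrite unitmx_tr.
- by rewrite -(trmx1 R n) -linearD/= unitmx_tr.
- by move=> u v; apply: norm_eq => //; rewrite addNr oppr0.
Qed.

Let beta_surj x : K (x + beta y1) -> exists2 y, K (y - y1) & x = - beta y.
Proof.
move=> Kx; have binj : injective beta.
  move=> a b e; apply/subr0_eq/beta_inj.
  by rewrite betaD betaN e subrr.
have [k Kk kE] := finite_subgroup_surj Ksub Kbeta binj (KN Kx).
exists (y1 + k); first by rewrite (_ : y1 + k - y1 = k)//; zmodule.
by rewrite betaD kE; zmodule.
Qed.

Let f1_cubic x : K (x + beta y1) -> (forall u, f1 x u != 0) /\ cubic (f1 x).
Proof. by move=> /beta_surj[y Ky ->]; have [] := f12_cubic Ky. Qed.

(** At [v = u] the right hand side of [norm_eq] is [f2 b (u - u A^T)], where [b]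
belongs to the image of the pair; [b - beta b = 2 x + (1 + beta) y] determines
[b], so the left hand side depends on that combination only. *)
Let rel x y x' y' u : K (x + beta y1) -> K (y - y1) ->
  K (x' + beta y1) -> K (y' - y1) -> x + x + (y + beta y) = x' + x' + (y' + beta y') ->
  f1 x (u + u) * f2 y (u + u *m A^T) = f1 x' (u + u) * f2 y' (u + u *m A^T).
Proof.
move=> Kx Ky Kx' Ky' e.
have [a [b [Ka Kb e1 e2]]] := Kpos Kx Ky.
have [a' [b' [Ka' Kb' e1' e2']]] := Kpos Kx' Ky'.
have one x1 : K (x1 + beta y1) -> f1 x1 (u - u) = 1.
  by move=> Kx1; rewrite subrr; exact: charlike0 (cf1 Kx1).
apply: etrans (norm_eq u u Kx Ky Ka Kb e1 e2) _.
apply: etrans (esym (norm_eq u u Kx' Ky' Ka' Kb' e1' e2')).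
apply: (congr2 *%R); first exact: etrans (one _ Ka) (esym (one _ Ka')).
apply: (congr1 (fun y => f2 y _)); apply: (Kinj Kb Kb').
have E := congr2 +%R (congr2 +%R e1 (congr1 -%R e2))
  (congr2 +%R (congr1 -%R e1') (congr2 +%R e2' e)).
by apply: (eq_of_subr E); zmodule.
Qed.

Let x0 := - beta y1.
Let Kx0 k : K k -> K (x0 + k + beta y1).
Proof. by move=> Kk; rewrite (_ : _ + _ = k)// /x0; zmodule. Qed.
Let Ky1 k : K k -> K (y1 + k - y1).
Proof. by move=> Kk; rewrite (_ : _ - _ = k)//; zmodule. Qed.

Let shift_rel k k' l u : K k -> K k' -> K l -> l + beta l = k + k ->
  f1 (x0 + (k' + k)) (u + u) * f2 (y1 + 0) (u + u *m A^T) =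
  f1 (x0 + k') (u + u) * f2 (y1 + l) (u + u *m A^T).
Proof.
move=> Kk Kk' Kl e; apply: rel; [exact/Kx0/KD|exact: Ky1|exact: Kx0|exact: Ky1|].
by rewrite addr0 betaD; apply: (eq_of_subr (esym e)); zmodule.
Qed.

(** By [shift_rel] the ratio of [f1 (x0 + k)] and [f1 x0] is multiplicative in
[k], an element of finite order. *)
Let f1_const k u : K k -> f1 (x0 + k) u = f1 (x0 + 0) u.
Proof.
move=> Kk.
have [l Kl lE] : exists2 l, K l & l + beta l = k + k.
  apply: (finite_subgroup_surj Ksub (f := fun g => g + beta g)).
  - by move=> g Kg; apply: KD => //; exact: Kbeta.
  - move=> a b /= e; apply/subr0_eq/beta1_inj; rewrite betaD betaN.
    by apply: (eq_of_subr e); zmodule.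
  - exact: KD.
have [j j0 kj] := finite_subgroup_order Ksub Kk.
have [z1 c1] := f1_cubic (Kx0 Kk); have [z0 c0] := f1_cubic (Kx0 K0).
have d0 v : f2 (y1 + 0) v != 0 by have [_ + _ _] := f12_cubic (Ky1 K0); apply.
have cross (a e b f b0 c : R[i]) : a * e = b * f -> c * e = b0 * f ->
    a * b0 * e = b * c * e.
  by move=> E1 E2; rewrite mulrAC E1 mulrAC -mulrA -E2 mulrA.
have mul k' v : K k' -> f1 (x0 + (k' + k)) (v + v) * f1 (x0 + 0) (v + v) =
    f1 (x0 + k') (v + v) * f1 (x0 + k) (v + v).
  move=> Kk'; apply: (mulIf (d0 (v + v *m A^T))).
  have r0 := shift_rel v Kk K0 Kl lE; rewrite add0r in r0.
  exact: cross (shift_rel v Kk Kk' Kl lE) r0.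
have Kj i : K (k *+ i).
  by elim: i => [|i IH]; rewrite ?mulr0n// mulrSr; exact: KD.
have pow i v : f1 (x0 + k *+ i) (v + v) * f1 (x0 + 0) (v + v) ^+ i =
    f1 (x0 + k) (v + v) ^+ i * f1 (x0 + 0) (v + v).
  elim: i => [|i IH]; first by rewrite mulr0n !expr0 mulr1 mul1r.
  by rewrite mulrSr exprS mulrA mul// mulrAC IH exprS; ring.
apply: cubic_root_eq => //; [exact: charlike0 (cf1 (Kx0 Kk))|exact: charlike0 (cf1 (Kx0 K0))|].
exists j => // v; rewrite (halfD v); have := pow j (2^-1 *: v).
by rewrite kj mulrC => /(mulIf (z0 _)) ->.
Qed.

Let f2_const l u : K l -> f2 (y1 + l) u = f2 (y1 + 0) u.
Proof.
move=> Kl.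
have [k Kk kE] : exists2 k, K k & k + k = l + beta l.
  apply: (finite_subgroup_surj Ksub (f := fun g => g + g)).
  - by move=> g Kg; exact: KD.
  - move=> a b /= e; apply/subr0_eq/two_inj.
    by apply: (eq_of_subr e); zmodule.
  - by apply: KD => //; exact: Kbeta.
have uT : 1%:M + A^T \in unitmx by rewrite -(trmx1 R n) -linearD/= unitmx_tr.
pose v := u *m invmx (1%:M + A^T).
have -> : u = v + v *m A^T by rewrite -[LHS](mulmxKV uT u) mulmxDr mulmx1.
have := shift_rel v Kk K0 Kl (esym kE).
rewrite add0r f1_const// => /(mulfI ((f1_cubic (Kx0 K0)).1 _)) ->//.
Qed.

(** By [f1_const] and [f2_const] the conditional laws over the fibers
coincide. *)
Lemma heyde_product_fibers : exists l : seq D,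
  [/\ uniq l, (forall z, (z \in l) = `[< K z >]),
     is_gaussian (distribution P eta1) /\ is_gaussian (distribution P eta2),
     (forall z, pmfD P (shift_mfun k1 (- beta y1)) z = if z \in l then m else 0) /\
     (forall z, pmfD P (shift_mfun k2 y1) z = if z \in l then m else 0) &
     (forall z B, z \in l -> measurable B ->
       P (eta1 @^-1` B `&` shift_mfun k1 (- beta y1) @^-1` [set z]) =
       (m%:E * P (eta1 @^-1` B))%E) /\
     (forall z B, z \in l -> measurable B ->
       P (eta2 @^-1` B `&` shift_mfun k2 y1 @^-1` [set z]) =
       (m%:E * P (eta2 @^-1` B))%E)].
Proof.
have [l ul lE] : exists2 l, uniq l & forall z, (z \in l) = `[< K z >].
  have [_ _ /finite_seqP[l lE]] := Ksub; exists (undup l); first exact: undup_uniq.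
  by move=> z; rewrite mem_undup; apply/idP/asboolP; rewrite lE.
have c1E z : shift_mfun k1 (- beta y1) @^-1` [set z] = k1 @^-1` [set x0 + z].
  apply/seteqP; split => w /= e; first by rewrite -e /x0; zmodule.
  by rewrite e /x0; zmodule.
have c2E z : shift_mfun k2 y1 @^-1` [set z] = k2 @^-1` [set y1 + z].
  apply/seteqP; split => w /= e; first by rewrite -e; zmodule.
  by rewrite e; zmodule.
have p1 z : pmfD P (shift_mfun k1 (- beta y1)) z = if z \in l then m else 0.
  rewrite /pmfD c1E -/(pmfD P k1 (x0 + z)) p1E lE (_ : x0 + z + beta y1 = z)//.
  by rewrite /x0; zmodule.
have p2 z : pmfD P (shift_mfun k2 y1) z = if z \in l then m else 0.
  rewrite /pmfD c2E -/(pmfD P k2 (y1 + z)) p2E lE (_ : y1 + z - y1 = z)//.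
  by zmodule.
have [z1 q1] := f1_cubic (Kx0 K0); have [_ z2 _ q2] := f12_cubic (Ky1 K0).
have e1 x u : x \in l -> cond_char P (shift_mfun k1 (- beta y1) @^-1` [set x])
    (fun w => eta1 w + h y1) u = f1 (x0 + 0) u.
  by rewrite lE c1E => /asboolP Kx; exact: f1_const.
have e2 x u : x \in l -> cond_char P (shift_mfun k2 y1 @^-1` [set x])
    (fun w => eta2 w + 0) u = f2 (y1 + 0) u.
  by rewrite lE c2E => /asboolP Kx; exact: f2_const.
exists l; split => //.
  split.
    exact: (gaussian_marginal ul p1 m0 (cf1 (Kx0 K0)) z1 q1 e1).
  exact: (gaussian_marginal ul p2 m0 (cf2 (Ky1 K0)) z2 q2 e2).
split=> z B zl mB; first exact: (fiber_prob ul p1 m0 e1 zl mB).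
exact: (fiber_prob ul p2 m0 e2 zl mB).
Qed.

End fibers.

Lemma heyde_product_structure : exists (K : set D) (g1 g2 : D) (m : R) (l : seq D),
  [/\ 0 < m, finite_subgroup K, (forall k, K k -> K (beta k) /\ h k = 0),
     uniq l & forall z, (z \in l) = `[< K z >]] /\
  [/\ is_gaussian (distribution P eta1) /\ is_gaussian (distribution P eta2),
     (forall z, pmfD P (shift_mfun k1 g1) z = if z \in l then m else 0) /\
     (forall z, pmfD P (shift_mfun k2 g2) z = if z \in l then m else 0) &
     (forall z B, z \in l -> measurable B ->
       P (eta1 @^-1` B `&` shift_mfun k1 g1 @^-1` [set z]) =
       (m%:E * P (eta1 @^-1` B))%E) /\
     (forall z B, z \in l -> measurable B ->
       P (eta2 @^-1` B `&` shift_mfun k2 g2 @^-1` [set z]) =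
       (m%:E * P (eta2 @^-1` B))%E)].
Proof.
have [K [y1 [m [m0 [Ksub p1E p2E Kbeta [Kinj Kpos]]]]]] :=
  coset_structure betaD two_inj beta_inj beta1_inj k12 ksym.
have [l [ul lE g12 p12 q12]] := heyde_product_fibers m0 Ksub p1E p2E Kbeta Kinj Kpos.
exists K, (- beta y1), y1, m, l; split; split => //.
by move=> k Kk; split; [exact: Kbeta|exact: (additive_finite_subgroup0 hD Ksub)].
Qed.

End heyde_product.

(** * Product form of the laws *)

Section uniform_haar.
Context d (Omega : measurableType d) (R : realType) (P : probability Omega R).
Variable G : countZmodType.
Local Notation D := (discrete_group G).
Variables (k : {mfun Omega >-> D}) (l : seq D) (m : R) (K : set D).
Hypotheses (ul : uniq l) (kl : forall x, pmfD P k x = if x \in l then m else 0).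
Hypotheses (m0 : 0 < m) (Ksub : finite_subgroup K)
  (lE : forall z, (z \in l) = `[< K z >]).

Lemma uniform_massE (C : set D) :
  distribution P k C = ((\sum_(x <- l | x \in C) m)%:E)%E.
Proof.
have := fin_split ul kl m0 C measurableT; rewrite setTI => e.
rewrite [LHS]e -sumEFin big_seq_cond [RHS]big_seq_cond; apply: eq_bigr => x /andP[xl _].
by rewrite setTI pmfDE kl xl.
Qed.

(** Translation by an element of [K] permutes the atoms, which have equal
masses. *)
Lemma uniform_haar : is_haar_distribution K (distribution P k).
Proof.
split.
  apply: etrans (uniform_massE _) _; rewrite big_seq_cond (eq_bigl (fun x => x \in l)) => [|x]; last first.
    by rewrite lE; case: asboolP => //= Kx; rewrite mem_set.
  rewrite -big_seq big_const_seq count_predT iter_addr_0 -mulr_natl.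
  by rewrite (sum_mass ul kl m0).
move=> x A Kx; apply: etrans (uniform_massE _) _; apply/esym; apply: etrans (uniform_massE _) _.
congr EFin; apply/esym.
have pl : perm_eq l (map (fun z => x + z) l).
  apply: uniq_perm => //; first by rewrite map_inj_uniq//; exact: addrI.
  have [K0 KB _] := Ksub.
  have KN y : K y -> K (- y) by move=> Ky; rewrite -sub0r; exact: KB.
  move=> z; rewrite lE; apply/asboolP/mapP => [Kz|[y yl ->]].
    exists (z - x); last by rewrite addrC subrK.
    by rewrite lE; apply/asboolP; exact: KB.
  rewrite -[x]opprK addrC; apply: KB; last exact: KN.
  by apply/asboolP; rewrite -lE.
rewrite (perm_big _ pl) big_map; apply: eq_bigl => z.
apply/idP/idP; last by rewrite !inE => Az; exists z.
by rewrite !inE => -[y Ay /addrI <-].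
Qed.

End uniform_haar.

Section convolution_formula.
Variables (R : realType) (n : nat) (G : countZmodType).
Local Notation X := (RnxG R n G).
Local Notation D := (discrete_group G).

Let measurable_addE (A : set X) : measurable A -> measurable (@addX R n G @^-1` A).
Proof.
by move=> mA; rewrite -[Y in measurable Y]setTI; exact: measurable_addX.
Qed.

Lemma measurable_translate (p : X) (A : set X) : measurable A ->
  measurable [set x | A (x + p)].
Proof.
move=> mA; have := measurableT_comp (@measurable_addX R n G)
  (measurable_fun_pair (@measurable_id _ X setT) (@measurable_cst _ _ X X setT p)).
by move=> /(_ measurableT A mA); rewrite setTI.
Qed.

Lemma convolution_dirac (mu : probability X R) (p : X) (A : set X) : measurable A ->
  convolution mu \d_p A = mu [set x | A (x + p)].
Proof.
move=> mA; have mAp := measurable_translate p mA.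
change (\int[mu]_x \d_p (xsection (@addX R n G @^-1` A) x) = mu [set x | (A (x + p)%R)])%E.
transitivity (\int[mu]_x (\1_[set x | A (x + p)] x)%:E)%E; last first.
  by rewrite integral_indic// setIT.
apply: eq_integral => x _ /=; rewrite diracE indicE; congr (_%:R%:E); congr nat_of_bool.
by apply/idP/idP; rewrite !inE /xsection/= ?inE.
Qed.

(** The factors live on complementary subgroups, where addition is the
identification of a pair with an element of the product. *)
Lemma convolution_emb (gamma : probability 'rV[R]_n R) (mu : probability D R)
    (A : set X) : measurable A ->
  convolution (distribution gamma embR) (distribution mu embG) A =
  (gamma \x mu)%E A.
Proof.
move=> mA; rewrite /convolution.
change ((distribution gamma embR \x distribution mu embG)%E (@addX R n G @^-1` A) = (gamma \x mu)%E A).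
rewrite /product_measure1 ge0_integral_distribution//; last first.
  exact: measurable_fun_xsection (measurable_addE mA).
have embE v (k : D) : @addX R n G (embR v, embG k) = (v, k).
  by congr (_, _); [exact: addr0|exact: add0r].
apply: eq_integral => v _ /=; congr (mu _).
by apply/seteqP; split=> k /=; rewrite /xsection/= !inE /preimage/= embE.
Qed.

End convolution_formula.

Section product_law.
Variables (R : realType) (n : nat) (G : countZmodType).
Local Notation X := (RnxG R n G).
Local Notation D := (discrete_group G).
Context d (Omega : measurableType d) (P : probability Omega R).
Variables (xi : {mfun Omega >-> X}) (eta : {mfun Omega >-> 'rV[R]_n})
  (k c : {mfun Omega >-> D}) (g : D) (l : seq D) (m : R).
Hypotheses (xiE : forall w, xi w = (eta w, k w)).
Hypotheses (ul : uniq l) (m0 : 0 < m)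
  (kl : forall x, pmfD P (shift_mfun k g) x = if x \in l then m else 0)
  (cl : forall x, pmfD P c x = if x \in l then m else 0).
Hypothesis fib : forall z B, z \in l -> measurable B ->
  P (eta @^-1` B `&` shift_mfun k g @^-1` [set z]) = (m%:E * P (eta @^-1` B))%E.

(** The hypothesis on the fibers makes [eta] independent of [k - g], whose law is
that of [c]. *)
Lemma product_law (A : set X) : measurable A ->
  distribution P xi A =
  convolution (convolution (distribution (distribution P eta) embR)
    (distribution (distribution P c) embG)) \d_(embG g) A.
Proof.
move=> mA; have mAg := measurable_translate (embG g) mA.
rewrite convolution_dirac// convolution_emb//.
pose zeta : {mfun Omega >-> X} := HB.pack (fun w => (eta w, shift_mfun k g w))
  (isMeasurableFun.Build _ _ _ _ _ (measurable_pairRV eta (shift_mfun k g))).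
rewrite (product_measure_unique (m' := distribution P zeta)).
- have e w : zeta w + embG g = xi w.
    by rewrite xiE; congr (_, _); [exact: addr0|exact: subrK].
  rewrite /distribution /pushforward; congr (P _).
  by apply/seteqP; split => w /=; rewrite e.
- move=> B C mB mC.
  have meB : measurable (eta @^-1` B).
    by rewrite -[Y in measurable Y]setTI; exact: measurable_funPT.
  transitivity (\sum_(x <- l | x \in C) P (eta @^-1` B `&` shift_mfun k g @^-1` [set x]))%E.
    exact: (fin_split ul kl m0 C meB).
  rewrite [X in (_ * X)%E](uniform_massE ul cl m0) -sumEFin.
  rewrite ge0_sume_distrr; last by move=> *; rewrite lee_fin ltW.
  rewrite big_seq_cond [RHS]big_seq_cond; apply: eq_bigr => x /andP[xl _].
  by rewrite fib// muleC.
- exact: mAg.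
Qed.

End product_law.

(** * Symmetric conditional laws on the product *)

Theorem theorem2 (R : realType) (n : nat) (G : countZmodType)
    (G_no_order2 : forall g : G, g *+ 2 = 0 -> g = 0)
    (alpha : RnxG R n G -> RnxG R n G)
    (alpha_aut : topological_automorphism alpha)
    (ker_trivial : [set x | x + alpha x = 0] = [set 0])
    (d : measure_display) (Omega : measurableType d) (P : probability Omega R)
    (xi1 xi2 : {RV P >-> RnxG R n G})
    (xi_indep : independent_RV P xi1 xi2)
    (L2_symmetric : same_conditional_distribution P
       (fun w => xi1 w + alpha (xi2 w)) (fun w => - (xi1 w + alpha (xi2 w)))
       (fun w => xi1 w + xi2 w)) :
  exists (gamma1 gamma2 : probability 'rV[R]_n R) (K : set (discrete_group G))
      (m_K : probability (discrete_group G) R) (g1 g2 : discrete_group G),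
    [/\ is_gaussian gamma1 /\ is_gaussian gamma2,
      finite_subgroup K /\ is_haar_distribution K m_K,
      forall A, measurable A ->
        distribution P xi1 A =
        convolution (convolution (distribution gamma1 embR)
          (distribution m_K embG)) \d_(embG g1) A,
      forall A, measurable A ->
        distribution P xi2 A =
        convolution (convolution (distribution gamma2 embR)
          (distribution m_K embG)) \d_(embG g2) A
      & alpha @` (embG @` K) = embG @` K].
Proof.
have [A [h [beta [aE [uA u1A] hD betaD [beta_inj beta1_inj]]]]] :=
  automorphism_structure alpha_aut ker_trivial.
have two_inj (g : discrete_group G) : g + g = 0 -> g = 0.
  by move=> g2; apply: G_no_order2; rewrite mulr2n.
have aF : alpha = fun z => (z.1 *m A + h z.2, beta z.2).
  by apply/funext => z; rewrite {1}[z]surjective_pairing aE.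
have sym B C : measurable B -> measurable C ->
    P ((fun w => xi1 w + xi2 w) @^-1` B `&` (fun w => xi1 w + alpha (xi2 w)) @^-1` C) =
    P ((fun w => xi1 w + xi2 w) @^-1` B `&` (fun w => - (xi1 w + alpha (xi2 w))) @^-1` C).
  by have [k [kL kN]] := L2_symmetric => mB mC; rewrite kL// kN.
rewrite aF in sym.
have [K [g1 [g2 [m [l]]]]] :=
  heyde_product_structure uA u1A hD betaD two_inj beta_inj beta1_inj xi_indep sym.
move=> [[m0 Ksub KE ul lE] [[gs1 gs2] [p1 p2] [q1 q2]]].
do 2!eexists; exists K; eexists; exists g1, g2; split.
- split; [exact: gs1|exact: gs2].
- by split=> //; exact: (uniform_haar ul p2 m0 Ksub lE).
- by move=> B mB; apply: (product_law _ ul m0 p1 p2 q1 mB) => w; exact: surjective_pairing.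
- by move=> B mB; apply: (product_law _ ul m0 p2 p2 q2 mB) => w; exact: surjective_pairing.
(* On [K] the map [h] vanishes, and the injection [beta] is onto by
   finiteness. *)
have betaI : injective beta.
  move=> x y e; apply/subr0_eq/beta_inj; apply: (addIr (beta y)).
  by rewrite -betaD subrK add0r.
have aK k : K k -> alpha (embG k) = embG (beta k).
  by move=> Kk; rewrite aE; congr (_, _); rewrite mul0mx add0r (KE _ Kk).2.
rewrite image_comp; apply/seteqP; split => _ [k Kk <-].
  by exists (beta k); [exact: (KE _ Kk).1|rewrite /= aK].
have [x Kx <-] := finite_subgroup_surj Ksub (fun k Kk => (KE k Kk).1) betaI Kk.
by exists x => //=; rewrite aK.
Qed.
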